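(* Let $\psi\in L^2(\mathbb R)$ be admissible with constant $C_\psi$, and let $f\in L^2(\mathbb R)$ be nontrivial (not a.e. zero). Then $$\left\{\int_{\mathbb R\times\mathbb R^+}t^2\big|\mathcal A^{\psi}_{\Lambda_S}[f](t,\zeta)\big|^2\,\frac{d\zeta\,dt}{\zeta^2}\right\}^{1/2}\left\{\int_{\mathbb R}\omega^2\big|\widehat f_{\Lambda_S}(\omega)\big|^2\,d\omega\right\}^{1/2}\ge\frac{\sqrt{C_\psi}\,|B|}{2}\,\|f\|_2^2,$$ where the integrals take values in $[0,\infty]$.
   Context: Fix real parameters $A,B,C,D,p,q$ with $AD-BC=1$ and $B\neq0$ (collected in $\Lambda_S$). $z^*$ denotes the complex conjugate of $z$, and $\mathbb R^+=(0,\infty)$. Put $K_B=\frac1{\sqrt{2\pi B}}$ (principal square root) and $$\mathcal K_{\Lambda_S}(x,\omega)=K_B^*\exp\left\{\frac{i}{2B}\big(Ax^2+2x(p-\omega)-2\omega(Dp-Bq)+D\omega^2\big)\right\}.$$ The special affine Fourier transform (SAFT) is $\widehat f_{\Lambda_S}(\omega)=\int_{\mathbb R}f(x)\mathcal K_{\Lambda_S}(x,\omega)\,dx$ for $f\in L^1(\mathbb R)\cap L^2(\mathbb R)$, extended to a unitary operator on $L^2(\mathbb R)$. For $\psi\in L^2(\mathbb R)$, $t\in\mathbb R$, $\zeta>0$, put $$\psi^{\Lambda_S}_{t,\zeta}(x)=\frac{K_B}{\sqrt\zeta}\,\psi\left(\frac{x-t}{\zeta}\right)\exp\left\{\frac{iAx(t-x)}{B}\right\}.$$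 The novel special affine wavelet transform of $f\in L^2(\mathbb R)$ is $\mathcal A^{\psi}_{\Lambda_S}[f](t,\zeta)=\int_{\mathbb R}f(x)\,\big(\psi^{\Lambda_S}_{t,\zeta}(x)\big)^*dx$. Let $\Psi(x,\zeta)=\exp\left\{\frac{i}{2B}\big(Ax^2(\zeta^2-1)+2xp(\zeta-1)\big)\right\}\psi^*(-x)$ and let $\widehat\Psi_{\Lambda_S}(\zeta\omega,\zeta)$ denote the SAFT of $x\mapsto\Psi(x,\zeta)$ evaluated at $\zeta\omega$. The function $\psi$ is called admissible if there is a constant $C_\psi$ with $0<C_\psi<\infty$ such that $$\int_{\mathbb R^+}\frac{|\widehat\Psi_{\Lambda_S}(\zeta\omega,\zeta)|^2}{\zeta}\,d\zeta=C_\psi\quad\text{for a.e. }\omega\in\mathbb R.$$ *)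

(* Defs.v *)
From HB Require Import structures.
From mathcomp Require Export all_boot all_order all_algebra.
From mathcomp Require Export all_classical all_reals all_analysis.
From mathcomp Require Export complex.

Set Implicit Arguments.
Unset Strict Implicit.
Unset Printing Implicit Defensive.

Import Order.TTheory GRing.Theory Num.Theory.
Import numFieldNormedType.Exports.
Import ComplexField.Normc.

Local Open Scope classical_set_scope.
Local Open Scope ring_scope.

(* The real parameter set of the transform; the conditions [AD - BC = 1] and
   [B != 0] are hypotheses of the theorem. *)
Record saft_param (R : realType) := SaftParam {
  sA : R; sB : R; sC : R; sD : R; sp : R; sq : R }.

Section SpecialAffineWavelet.
Context {R : realType}.
Implicit Types (L : saft_param R) (f g psi : R -> R[i]).

Local Notation leb := (@lebesgue_measure R).
Local Notation Rplus := (`]0, +oo[%classic : set (measurableTypeR R)).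

(* exp(i theta) for real theta, by Euler's formula. *)
Definition expi (theta : R) : R[i] := Complex (cos theta) (sin theta).

Definition cmeasurable d (T : measurableType d) (D : set T) (f : T -> R[i]) :=
  measurable_fun D (fun x => complex.Re (f x)) /\
  measurable_fun D (fun x => complex.Im (f x)).

(* [normc] is the modulus valued in [R]; the modulus of ssrnum is valued in
   [R[i]]. *)
Definition cLnorm (p : \bar R) f : \bar R :=
  ('N[leb]_p [EFin \o (fun x => normc (f x))])%E.

(* Elements of [L^p] are handled through representatives. *)
Definition cLp (p : \bar R) f :=
  cmeasurable [set: measurableTypeR R] f /\ (cLnorm p f < +oo)%E.

(* Lebesgue integral over R of a complex-valued integrable function. *)
Definition cintegral f : R[i] :=
  Complex (Rintegral leb setT (fun x => complex.Re (f x)))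
          (Rintegral leb setT (fun x => complex.Im (f x))).

(* [sqrtc] is the principal square root; [sB L] may be negative. *)
Definition KB L : R[i] := (sqrtc (real_complex R (2 * pi * sB L)))^-1.

Definition saft_kernel L (x w : R) : R[i] :=
  conjc (KB L) *
  expi ((sA L * x ^+ 2 + 2 * x * (sp L - w)
         - 2 * w * (sD L * sp L - sB L * sq L) + sD L * w ^+ 2) / (2 * sB L)).

Definition saft_integral L f : R -> R[i] :=
  fun w => cintegral (fun x => f x * saft_kernel L x w).

(* [g] represents the image of [f] under the continuous extension to [L^2] of
   the integral transform defined on [L^1 `&` L^2]. *)
Definition is_saft L f g :=
  cLp 2%:E g /\
  exists fn : nat -> R -> R[i],
    [/\ forall n, cLp 1%:E (fn n) /\ cLp 2%:E (fn n),
        (fun n => cLnorm 2%:E (fun x => fn n x - f x)) @ \oo --> 0%E &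
        (fun n => cLnorm 2%:E (fun w => saft_integral L (fn n) w - g w))
          @ \oo --> 0%E].

(* For [f] in [L^2], such a [g] exists and is unique almost everywhere
   (Plancherel); [saft L f] is an unspecified representative. *)
Definition saft L f : R -> R[i] := xget (fun=> 0) (is_saft L f).

Definition saw_atom L psi (t z : R) : R -> R[i] := fun x =>
  KB L / real_complex R (Num.sqrt z) * psi ((x - t) / z)
  * expi (sA L * x * (t - x) / sB L).

Definition sawt L psi f (t z : R) : R[i] :=
  cintegral (fun x => f x * conjc (saw_atom L psi t z x)).

Definition saw_Psi L psi (x z : R) : R[i] :=
  expi ((sA L * x ^+ 2 * (z ^+ 2 - 1) + 2 * x * sp L * (z - 1)) / (2 * sB L))
  * conjc (psi (- x)).

(* For each [z] the SAFT of [saw_Psi L psi ^~ z] is only determined almost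
   everywhere, so its values at the points [z * w] with [w] fixed and [z]
   varying are read off a jointly measurable version [G]; by Fubini the
   condition does not depend on the version. *)
Definition saw_admissible L psi (Cpsi : R) :=
  0 < Cpsi /\
  exists G : measurableTypeR R * measurableTypeR R -> R[i],
    [/\ cmeasurable ([set: measurableTypeR R] `*` Rplus) G,
        forall z : R, 0 < z ->
          {ae leb, forall w, G (w, z) = saft L (saw_Psi L psi ^~ z) w} &
        {ae leb, forall w : R,
          (\int[leb]_(z in Rplus) (normc (G (z * w, z)) ^+ 2 / z)%:E)%E
          = Cpsi%:E}].

End SpecialAffineWavelet.

(* Main.v *)
(* Multiplication by a chirp turns the SAFT of [f] into the Fourier transform F^ of the chirped signal, rescaled by
   [B].  By Parseval the wavelet transform at (t, z) is, up to a phase and an explicit factor, the inverse Fourier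
   transform h_z(t) of H(v, z) = F^(v) V_z^(z v), where V_z is the chirped wavelet, and admissibility says that the
   integral of |H(v, z)|^2 dz / z is a constant multiple of |F^(v)|^2 for almost every v.  What remains is Heisenberg's
   inequality for the vector-valued function v |-> H(v, .), obtained without differentiating: the L^2 norm of
   H(v + d, .) - H(v, .) is at most d times the spread of h in t because |e^{is} - 1| <= |s|, while the integral of
   v (|H(v, .)|^2 - |H(v + d, .)|^2) is d times the total mass; AM-GM compares the two and d tends to 0.
   Plancherel's theorem is obtained by regularising with the Poisson kernel: this gives equality for cut-off continuous
   functions and an inequality in general, which density upgrades to equality. *)
Require Import Defs.
From mathcomp Require Import ring lra measurable_realfun.
Import Order.TTheory GRing.Theory Num.Theory.
Import numFieldNormedType.Exports.
Import ComplexField.Normc.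
Local Open Scope classical_set_scope.
Local Open Scope ring_scope.
Set Implicit Arguments.
Unset Strict Implicit.
Unset Printing Implicit Defensive.

Local Notation leb := (@lebesgue_measure _).

(** Two features of the definitions shape the proof. The SAFT on L^2 is an unspecified
    representative of a class modulo null sets, so the L^2 Fourier transform is treated as a
    relation, [isFT], stable under a.e. modification, and a completeness argument shows that a
    representative exists at all. The wavelet transform, by contrast, is an honest integral at every
    (t, z): F^ and the dilated V_z^ are both square integrable, so every slice H(., z) is integrable
    and its Fourier transform makes sense pointwise. Plancherel on the intersection of L^1 and L^2
    can then be applied slice by slice. Differentiation is avoided because nothing is known about
    the regularity of F^; only second moments are available, and shifts need no more than these. The
    constant: AM-GM with a free parameter l gives N <= l X + Y / l for all l > 0, hence N^2 <= 4 X
    Y, where N is the mass of H, 2 pi X its spread in t and Y its second moment in v. The 4 becomes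
    the 1/2 of the theorem, and |B| remains after the substitution w = B v and the normalisation
    |K_B|^2 = 1 / (2 pi |B|). *)

Lemma measurable_cos (R : realType) : measurable_fun [set: R] (@cos R).
Proof. by apply: continuous_measurable_fun; exact: continuous_cos. Qed.

Lemma measurable_sin (R : realType) : measurable_fun [set: R] (@sin R).
Proof. by apply: continuous_measurable_fun; exact: continuous_sin. Qed.

Ltac meas1 := lazymatch goal with
  | |- measurable_fun _ (fun x => x) => exact: measurable_id
  | |- measurable_fun _ (fun x => x.1) => exact: measurable_fst
  | |- measurable_fun _ (fun x => x.2) => exact: measurable_snd
  | |- measurable_fun _ (fun x => fst _) => apply: (measurableT_comp measurable_fst)
  | |- measurable_fun _ (fun x => snd _) => apply: (measurableT_comp measurable_snd)
  | |- measurable_fun _ (fun x => (_, _)) => apply: measurable_fun_pair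
  | |- measurable_fun _ (fun x => _ * _) => apply: measurable_funM
  | |- measurable_fun _ (fun x => _ + - _) => apply: measurable_funB
  | |- measurable_fun _ (fun x => _ + _) => apply: measurable_funD
  | |- measurable_fun _ (fun x => - _) => apply: measurable_funN
  | |- measurable_fun _ (fun x => _ ^+ _) => apply: measurable_funX
  | |- measurable_fun _ (fun x => cos _) => apply: (measurableT_comp (@measurable_cos _))
  | |- measurable_fun _ (fun x => sin _) => apply: (measurableT_comp (@measurable_sin _))
  | |- measurable_fun _ (fun x => expR _) => apply: (measurableT_comp (@measurable_expR _))
  | |- measurable_fun _ (fun x => `|_|) => apply: (measurableT_comp (@normr_measurable _ setT))
  | H : measurable_fun setT ?a |- measurable_fun _ (fun x => ?a _) => first [exact: H | apply: (measurableT_comp H)]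
  | |- measurable_fun _ fst => exact: measurable_fst
  | |- measurable_fun _ snd => exact: measurable_snd
  | |- measurable_fun _ Num.norm => exact: normr_measurable
  | |- measurable_fun _ ( *%R _) => apply: measurable_funM
  | |- measurable_fun _ (fun x => _) => exact: measurable_cst
  end.
Ltac meas := repeat first [ meas1 | assumption ].

(** * Affine changes of variables *)

Section Affine.
Context (R : realType).
Local Notation mR := (measurableTypeR R).

Lemma measurable_affine (a b : R) : measurable_fun [set: mR] (fun x : mR => a * x + b : mR).
Proof. by apply: measurable_funD => //; apply: measurable_funM. Qed.

(** Uniqueness of Lebesgue measure: the right-hand side is a scaled pushforward, hence a measure in
    [A], and it only has to be compared on half-open intervals. For [a < 0] the preimage is closed
    on the other side, which does not change its length. *)
Lemma lebesgue_measure_affine (a b : R) (A : set mR) : a != 0 -> measurable A ->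
  leb A = (`|a|%:E * leb ((fun x : mR => (a * x + b)%R) @^-1` A))%E.
Proof.
move=> a0 mA.
pose phi := (fun x : mR => a * x + b : mR).
pose nu := mscale (NngNum (normr_ge0 a)) (pushforward leb phi) : {measure set mR -> \bar R}.
rewrite [RHS](_ : _ = nu (measurable_affine a b) A)//.
apply: lebesgue_measure_unique => // X [[x y] _ <-] /=.
rewrite /mscale /= /pushforward /=.
have [a_gt0|a_lt0|] := ltrgt0P a; last by move/eqP: a0.
- rewrite (_ : phi @^-1` `]x, y] = `](x - b) / a, (y - b) / a]%classic); last first.
    apply/seteqP; split => u /=; rewrite !in_itv/= /phi ltr_pdivrMr// ler_pdivlMr// => /andP[h1 h2]; apply/andP; split; lra.
  rewrite !lebesgue_measure_itv/= !lte_fin ltr_pM2r ?invr_gt0// ltrD2r.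
  case: ifP => _; rewrite ?mule0// -!EFinD -EFinM; congr EFin; field.
  by [].
- rewrite (_ : phi @^-1` `]x, y] = `[(y - b) / a, (x - b) / a[%classic); last first.
    apply/seteqP; split => u /=; rewrite !in_itv/= /phi ler_ndivrMr// ltr_ndivlMr// => /andP[h1 h2]; apply/andP; split; lra.
  rewrite !lebesgue_measure_itv/= !lte_fin ltr_nM2r ?invr_lt0// ltrD2r.
  case: ifP => _; rewrite ?mule0// -!EFinD -EFinM; congr EFin; field.
  by [].
Qed.

Lemma ge0_integral_affine (a b : R) (f : mR -> \bar R) : a != 0 ->
  measurable_fun setT f -> (forall x, 0 <= f x)%E ->
  (\int[leb]_x f x = `|a|%:E * \int[leb]_x f (a * x + b)%R)%E.
Proof.
move=> a0 mf f0.
pose phi := (fun x : mR => a * x + b : mR).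
pose nu := mscale (NngNum (normr_ge0 a)) (pushforward leb phi) : {measure set mR -> \bar R}.
rewrite (eq_measure_integral (nu (measurable_affine a b))); last by move=> A mA _; exact: lebesgue_measure_affine.
rewrite ge0_integral_mscale//=; congr (_ * _)%E.
by rewrite ge0_integral_pushforward//; exact: measurable_affine.
Qed.

Lemma ae_affine (a b : R) (P : mR -> Prop) : a != 0 ->
  {ae (@lebesgue_measure R), forall x, P x} -> {ae (@lebesgue_measure R), forall x, P (a * x + b)}.
Proof.
move=> a0 [N [mN N0 PN]].
have mA : measurable ((fun x : mR => (a * x + b)%R : mR) @^-1` N).
  by rewrite -[X in measurable X]setTI; exact: measurable_affine.
exists ((fun x : mR => a * x + b) @^-1` N); split => //.
  move: N0; rewrite (lebesgue_measure_affine b a0)// => /eqP.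
  by rewrite mule_eq0 eqe normr_eq0 (negbTE a0)/= => /eqP.
by move=> x /= Px; apply: PN.
Qed.

Lemma integrable_affine (a b : R) (f : mR -> \bar R) : a != 0 ->
  leb.-integrable setT f -> leb.-integrable setT (fun x => f (a * x + b)).
Proof.
move=> a0 /integrableP[mf foo].
have mf' : measurable_fun setT (fun x : mR => f (a * x + b)).
  by apply: measurableT_comp mf _; exact: measurable_affine.
apply/integrableP; split => //.
move: foo; rewrite (ge0_integral_affine b a0)//; last by apply: measurableT_comp.
case: (integral leb setT _) => [r _||_]; [exact: ltry| |by []].
by rewrite gt0_muley// lte_fin normr_gt0.
Qed.

Lemma integral_affine (a b : R) (f : mR -> \bar R) : a != 0 ->
  leb.-integrable setT f ->
  (\int[leb]_x f x = `|a|%:E * \int[leb]_x f (a * x + b)%R)%E.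
Proof.
move=> a0 intf; have [mf _] := integrableP _ _ _ intf.
rewrite [in LHS]integralE [in RHS]integralE.
rewrite [in RHS]muleBr//; last first.
  apply: fin_num_adde_defl; rewrite fin_numN; apply: (integrable_neg_fin_num (mu := leb)) => //.
  exact: integrable_affine.
congr (_ - _)%E; (rewrite (ge0_integral_affine b a0)//; last first); try exact: measurable_funepos; try exact: measurable_funeneg.
- congr (_ * _)%E; apply: eq_integral => x _.
  by rewrite !funeposE.
- by congr (_ * _)%E; apply: eq_integral => x _; rewrite !funenegE.
Qed.

Lemma Rintegral_affine (a b : R) (f : mR -> R) : a != 0 ->
  leb.-integrable setT (EFin \o f) ->
  \int[leb]_x f x = `|a| * \int[leb]_x f (a * x + b).
Proof.
move=> a0 intf; rewrite /Rintegral (integral_affine b a0)//= fineM//.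
by apply: integrable_fin_num => //; apply: (integrable_affine _ a0 intf).
Qed.

End Affine.

(** * Plancherel for real functions *)

Section PoissonKernel.
Context (R : realType).
Local Notation mR := (measurableTypeR R).

(** An antiderivative in [v] of [expR (- e * v) * (1 + cos (x * v))]. The summand 1 keeps the
    integrand nonnegative, so the fundamental theorem on a half-line applies without an
    integrability proof; it is subtracted again in [Rintegral_poisson]. *)
Let F (e x v : R) : R := - expR (- e * v) / e + expR (- e * v) * (x * sin (x * v) - e * cos (x * v)) / (e ^+ 2 + x ^+ 2).

Let is_deriveF (e x v : R) : 0 < e -> is_derive v (1:R) (F e x) (expR (- e * v) * (1 + cos (x * v))).
Proof.
move=> e0; apply: is_derive_eq.
rewrite /GRing.scale/= !mulr1; field.
by rewrite !gt_eqF// ltr_pwDl ?exprn_gt0// sqr_ge0.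
Qed.

Let cvgF (e x : R) : 0 < e -> F e x v @[v --> +oo] --> 0.
Proof.
move=> e0.
have h : expR (- e * v) @[v --> +oo] --> 0.
  rewrite (_ : (fun v => expR (- e * v)) = (fun z => expR (- z)) \o (fun z => e * z)); last first.
    by apply: eq_fun => v; rewrite mulNr.
  apply: (@cvg_comp _ _ _ _ _ _ (pinfty_nbhs R)); last exact: cvgr_expR.
  exact: gt0_cvgMry.
pose K := e^-1 + (`|x| + e) / (e ^+ 2 + x ^+ 2).
have D0 : 0 < e ^+ 2 + x ^+ 2 by rewrite ltr_pwDl ?exprn_gt0// sqr_ge0.
apply: norm_cvg0; apply: (@squeeze_cvgr _ _ _ _ (fun=> 0) (fun v => K * expR (- e * v))).
- near=> v; rewrite normr_ge0/=.
  have -> : F e x v = (- e^-1 + (x * sin (x * v) - e * cos (x * v)) * (e ^+ 2 + x ^+ 2)^-1) * expR (- e * v) by rewrite /F; ring.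
  rewrite normrM (ger0_norm (expR_ge0 _)) ler_wpM2r ?expR_ge0//.
  apply: (le_trans (ler_normD _ _)); rewrite normrN (gtr0_norm (x := e^-1)) ?invr_gt0// lerD2l.
  rewrite normrM (gtr0_norm (x := _^-1)) ?invr_gt0// ler_wpM2r ?invr_ge0 ?(ltW D0)//.
  apply: (le_trans (ler_normB _ _)); rewrite !normrM (gtr0_norm e0) lerD//.
    by rewrite ler_piMr// ler_norml sin_geN1 sin_le1.
  by rewrite ler_piMr ?(ltW e0)// ler_norml cos_geN1 cos_le1.
- exact: cvg_cst.
- by rewrite -(mulr0 K); apply: cvgM; [exact: cvg_cst|exact: h].
Unshelve. all: by end_near.
Qed.

Lemma continuous_wt (e x : R) : continuous (fun v : R => expR (- e * v) * (1 + cos (x * v))).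
Proof.
move=> v; apply: differentiable_continuous; apply/derivable1_diffP; exact: ex_derive.
Qed.

Lemma integral_poisson_half (e x : R) : 0 < e ->
  (\int[leb]_(v in `[0%R, +oo[) (expR (- e * v) * (1 + cos (x * v)))%:E = (e^-1 + e / (e ^+ 2 + x ^+ 2))%:E)%E.
Proof.
move=> e0.
have cF v : {for v, continuous (F e x)}.
  apply: differentiable_continuous; apply/derivable1_diffP.
  by have := is_deriveF x v e0; case.
rewrite (@ge0_continuous_FTC2y _ _ (F e x) 0 0).
- rewrite /F !mulr0 expR0 sin0 cos0 -EFinB; congr EFin; field.
  by rewrite !gt_eqF// ltr_pwDl ?exprn_gt0// sqr_ge0.
- move=> v _; rewrite mulr_ge0 ?expR_ge0// -lerBlDl sub0r cos_geN1.
- by apply: continuous_subspaceT => v; exact: continuous_wt.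
- exact: cvgF.
- move=> v _. by have := is_deriveF x v e0; case.
- by apply: cvg_at_right_filter; exact: cF.
- move=> v _; rewrite derive1E. by have := is_deriveF x v e0; case.
Qed.

Lemma integral_poisson_full (e x : R) : 0 < e ->
  (\int[leb]_(v in [set: mR]) (expR (- e * `|v|) * (1 + cos (x * v)))%:E = (2 / e + 2 * e / (e ^+ 2 + x ^+ 2))%:E)%E.
Proof.
move=> e0; rewrite ge0_symfun_integralT.
- rewrite -set_itvcy.
  under eq_integral => v.
    rewrite inE/= in_itv/= andbT => v0; rewrite ger0_norm//; over.
  by rewrite integral_poisson_half// -EFinM; congr EFin; ring.
- by move=> v; rewrite mulr_ge0 ?expR_ge0// -lerBlDl sub0r cos_geN1.
- move=> v; apply: cvgM.
    apply: (continuous_comp (f := fun v : R => - e * `|v|)); last exact: continuous_expR.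
    by apply: continuousM; [exact: cst_continuous|exact: norm_continuous].
  apply: cvgD; first exact: cvg_cst.
  apply: (continuous_comp (f := fun v : R => x * v)); last exact: continuous_cos.
  by apply: continuousM; [exact: cst_continuous|exact: cvg_id].
- by move=> v /=; rewrite normrN mulrN cosN.
Qed.

Lemma measurable_expR_norm (e : R) : measurable_fun [set: mR] (fun v : mR => expR (- e * `|v|)).
Proof. meas. Qed.

Lemma measurable_cosM (x : R) : measurable_fun [set: mR] (fun v : mR => cos (x * v)).
Proof. meas. Qed.

(** The case [x = 0] of the previous integral, where the factor [1 + cos] equals 2. The integral is
    an extended real at this stage, so the value [+oo] has to be excluded before dividing by 2. *)
Lemma integral_expR_norm (e : R) : 0 < e ->
  (\int[leb]_(v in [set: mR]) (expR (- e * `|v|))%:E = (2 / e)%:E)%E.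
Proof.
move=> e0; have := integral_poisson_full 0 e0.
under eq_integral do rewrite mul0r cos0 mulrC EFinM.
rewrite ge0_integralZl_EFin//; last by apply/measurable_EFinP; exact: measurable_expR_norm.
set I := (integral _ _ _).
have : (0 <= I)%E by apply: integral_ge0 => v _; rewrite lee_fin expR_ge0.
case: I => [r||]//=; last by rewrite gt0_muley.
move=> _; rewrite -EFinM => -[h]; congr EFin.
apply: (mulfI (x := 1 + 1)); rewrite // h; field.
by rewrite gt_eqF.
Qed.

Lemma integrable_expR_norm (e : R) : 0 < e ->
  leb.-integrable setT (fun v : mR => (expR (- e * `|v|))%:E).
Proof.
move=> e0; apply/integrableP; split; first by apply/measurable_EFinP; exact: measurable_expR_norm.
under eq_integral do rewrite gee0_abs ?lee_fin ?expR_ge0//.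
by rewrite integral_expR_norm// ltry.
Qed.

Lemma integrable_poisson (e x : R) : 0 < e ->
  leb.-integrable setT (fun v : mR => (expR (- e * `|v|) * cos (x * v))%:E).
Proof.
move=> e0; apply: (le_integrable _ _ _ (integrable_expR_norm e0)) => //.
  apply/measurable_EFinP; apply: measurable_funM; [exact: measurable_expR_norm|exact: measurable_cosM].
move=> v _; rewrite !abse_EFin lee_fin normrM ler_piMr//.
by rewrite ler_norml cos_geN1 cos_le1.
Qed.

Lemma Rintegral_poisson (e x : R) : 0 < e ->
  (\int[leb]_v (expR (- e * `|v|) * cos (x * v))) = 2 * e / (e ^+ 2 + x ^+ 2).
Proof.
move=> e0; have ip := integrable_poisson x e0; have ie := integrable_expR_norm e0.
have := integral_poisson_full x e0.
under eq_integral do rewrite mulrDr mulr1 EFinD.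
rewrite integralD// integral_expR_norm// /Rintegral => /(congr1 fine).
rewrite fineD//; last exact: integrable_fin_num.
by move/addrI.
Qed.

(** The mass of the rescaled Poisson kernel; this is where the factor [2 * pi] of Plancherel's
    identity comes from. *)
Lemma integral_oneDsqrV : (\int[leb]_(u in [set: R]) (2 / (1 + u ^+ 2))%:E = (2 * pi)%:E)%E.
Proof.
have h : forall u : R, 0 < 1 + u ^+ 2 by move=> u; rewrite ltr_wpDr ?sqr_ge0.
rewrite ge0_symfun_integralT.
- rewrite -set_itvcy.
  under eq_integral do rewrite EFinM.
  rewrite ge0_integralZl_EFin//.
  + rewrite integral0y_oneDsqr -!EFinM; congr EFin. by field.
  + by move=> u _; rewrite lee_fin invr_ge0 ltW.
  + apply/measurable_EFinP/measurable_funTS. apply: continuous_measurable_fun. exact: continuous_oneDsqrV.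
- by move=> u; rewrite divr_ge0// ltW.
- move=> u; apply: cvgM; first exact: cvg_cst. exact: continuous_oneDsqrV.
- by move=> u /=; rewrite sqrrN.
Qed.

End PoissonKernel.

(** * Fubini and measurability for real-valued integrals *)

Section RFubini.
Context (R : realType).
Local Notation mR := (measurableTypeR R).

Lemma le_integrableR d (T : measurableType d) (mu : {measure set T -> \bar R}) (f g : T -> R) :
  measurable_fun setT f -> (forall x, `|f x| <= g x) -> mu.-integrable setT (EFin \o g) ->
  mu.-integrable setT (EFin \o f).
Proof.
move=> mf fg; apply: le_integrable => //; first exact/measurable_EFinP.
by move=> x _; rewrite /= lee_fin (le_trans (fg x))// ler_norm.
Qed.

(** Integrability is not assumed: the positive and negative parts have measurable Tonelli integrals,
    and both the difference and [fine] preserve measurability, whatever value they take where the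
    integral does not converge. *)
Lemma measurable_Rintegral d (T : measurableType d) (f : T * mR -> R) : measurable_fun setT f ->
  measurable_fun setT (fun t => (\int[leb]_y f (t, y))).
Proof.
move=> mf; apply: (measurableT_comp (f := fine)) => //.
rewrite (_ : (fun x => _) = (fun x => \int[leb]_y ((EFin \o f)^\+ (x, y)) - \int[leb]_y ((EFin \o f)^\- (x, y)))%E).
  apply: emeasurable_funB; apply: (measurable_fun_fubini_tonelli_F (m2 := leb)) => //.
  - by apply: measurable_funepos; exact/measurable_EFinP.
  - by apply: measurable_funeneg; exact/measurable_EFinP.
apply/funext => x; rewrite integralE.
by congr (_ - _)%E; apply: eq_integral => y _; rewrite ?funeposE ?funenegE.
Qed.

Lemma integrable_prodM (g h : mR -> R) : leb.-integrable setT (EFin \o g) -> leb.-integrable setT (EFin \o h) ->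
  (leb \x leb)%E.-integrable setT (EFin \o (fun z : mR * mR => g z.1 * h z.2)).
Proof.
move=> /[dup] ig /integrableP[/measurable_EFinP mg goo] /[dup] ih /integrableP[/measurable_EFinP mh hoo].
apply/integrable12ltyP; first by apply/measurable_EFinP; meas.
under eq_integral.
  move=> x _; under eq_integral do rewrite /= normrM EFinM.
  rewrite ge0_integralZl_EFin//; last by apply/measurable_EFinP; meas.
  over.
rewrite /= ge0_integralZr//.
- by rewrite lte_mul_pinfty// ?integral_ge0// ge0_fin_numE// integral_ge0.
- by apply/measurable_EFinP; meas.
- exact: integral_ge0.
Qed.

(** Integrability of every fibre, not of almost every one, is what allows [fine] to be undone
    pointwise under the outer integrals. *)
Lemma Rintegral_fubini (f : mR * mR -> R) : (leb \x leb)%E.-integrable setT (EFin \o f) ->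
  (forall x, leb.-integrable setT (fun y => (f (x, y))%:E)) ->
  (forall y, leb.-integrable setT (fun x => (f (x, y))%:E)) ->
  (\int[leb]_x (\int[leb]_y f (x, y))) = (\int[leb]_y (\int[leb]_x f (x, y))).
Proof.
move=> fi f1 f2; have := Fubini fi; rewrite /Rintegral => h; congr fine.
under eq_integral do rewrite fineK ?integrable_fin_num//.
by under [RHS]eq_integral do rewrite fineK ?integrable_fin_num//.
Qed.

End RFubini.

(** * Poisson regularisation, autocorrelation and Bessel's inequality *)

Section RealPoisson.
Context (R : realType).
Local Notation mR := (measurableTypeR R).

Lemma integrable_bddM d (T : measurableType d) (mu : {measure set T -> \bar R}) (a g : T -> R) (M : R) :
  mu.-integrable setT (EFin \o a) -> measurable_fun setT g -> (forall x, `|g x| <= M) ->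
  mu.-integrable setT (EFin \o (fun x => a x * g x)).
Proof.
move=> ia mg gM; have /integrableP[/measurable_EFinP ma _] := ia.
apply: (@le_integrableR R _ _ _ _ (fun x => M * `|a x|)); first by meas.
- by move=> x; rewrite normrM mulrC ler_wpM2r.
- have := integrableZl measurableT M (integrable_norm ia).
  by apply: eq_integrable.
Qed.

Lemma integrableZlR d (T : measurableType d) (mu : {measure set T -> \bar R}) (k : R) (f : T -> R) :
  mu.-integrable setT (EFin \o f) -> mu.-integrable setT (EFin \o (fun x => k * f x)).
Proof. by move=> /(integrableZl measurableT k); apply: eq_integrable. Qed.

Lemma integrableZrR d (T : measurableType d) (mu : {measure set T -> \bar R}) (k : R) (f : T -> R) :
  mu.-integrable setT (EFin \o f) -> mu.-integrable setT (EFin \o (fun x => f x * k)).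
Proof. by move=> /(integrableZlR k); apply: eq_integrable => // x _ /=; rewrite mulrC. Qed.

Lemma integrableDR d (T : measurableType d) (mu : {measure set T -> \bar R}) (f g : T -> R) :
  mu.-integrable setT (EFin \o f) -> mu.-integrable setT (EFin \o g) -> mu.-integrable setT (EFin \o (fun x => f x + g x)).
Proof. by move=> fi gi; have := integrableD measurableT fi gi; apply: eq_integrable. Qed.

(** For real [a] the Fourier transform is [cosT a - i sinT a], so its squared modulus is
    [cosT a v ^+ 2 + sinT a v ^+ 2]. *)
Definition cosT (a : mR -> R) (v : R) : R := \int[leb]_x (a x * cos (v * x)).
Definition sinT (a : mR -> R) (v : R) : R := \int[leb]_x (a x * sin (v * x)).

Lemma ler_norm_cos (x : R) : `|cos x| <= 1.
Proof. by rewrite ler_norml cos_geN1 cos_le1. Qed.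

Lemma ler_norm_sin (x : R) : `|sin x| <= 1.
Proof. by rewrite ler_norml sin_geN1 sin_le1. Qed.

Lemma integrable_cosT (a : mR -> R) (v : R) : leb.-integrable setT (EFin \o a) ->
  leb.-integrable setT (EFin \o (fun x : mR => a x * cos (v * x))).
Proof. move=> ia; apply: (integrable_bddM ia (M := 1)); first by meas. move=> x; exact: ler_norm_cos. Qed.

Lemma integrable_sinT (a : mR -> R) (v : R) : leb.-integrable setT (EFin \o a) ->
  leb.-integrable setT (EFin \o (fun x : mR => a x * sin (v * x))).
Proof. move=> ia; apply: (integrable_bddM ia (M := 1)); first by meas. move=> x; exact: ler_norm_sin. Qed.

Lemma measurable_cosT (a : mR -> R) : measurable_fun setT a -> measurable_fun [set: mR] (cosT a).
Proof.
move=> ma; apply: (measurable_Rintegral (f := fun z : mR * mR => a z.2 * cos (z.1 * z.2))).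
by meas.
Qed.

Lemma measurable_sinT (a : mR -> R) : measurable_fun setT a -> measurable_fun [set: mR] (sinT a).
Proof.
move=> ma; apply: (measurable_Rintegral (f := fun z : mR * mR => a z.2 * sin (z.1 * z.2))).
by meas.
Qed.

Lemma norm_cosT (a : mR -> R) v : leb.-integrable setT (EFin \o a) ->
  `|cosT a v| <= \int[leb]_x `|a x|.
Proof.
move=> ia; apply: (le_trans (le_normr_Rintegral _ _)) => //; first exact: integrable_cosT.
apply: le_Rintegral => //; [exact/integrable_norm/integrable_cosT|exact: integrable_norm|].
by move=> x _; rewrite normrM ler_piMr// ler_norm_cos.
Qed.

Lemma norm_sinT (a : mR -> R) v : leb.-integrable setT (EFin \o a) ->
  `|sinT a v| <= \int[leb]_x `|a x|.
Proof.
move=> ia; apply: (le_trans (le_normr_Rintegral _ _)) => //; first exact: integrable_sinT.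
apply: le_Rintegral => //; [exact/integrable_norm/integrable_sinT|exact: integrable_norm|].
by move=> x _; rewrite normrM ler_piMr// ler_norm_sin.
Qed.

(** The subtraction formula for cos. Multiplying by [a x] and integrating in [x] writes the squared
    modulus of the transform as a double integral with kernel [cos (v * (x - y))]. *)
Lemma fourier_square_split (a : mR -> R) x v : leb.-integrable setT (EFin \o a) ->
  cosT a v * cos (v * x) + sinT a v * sin (v * x) = \int[leb]_y (a y * cos (v * (x - y))).
Proof.
move=> ia; rewrite /cosT /sinT -!RintegralZr//; [|exact: integrable_sinT|exact: integrable_cosT].
rewrite -RintegralD//.
- by apply: eq_Rintegral => y _; rewrite mulrBr cosB; ring.
- by apply: (integrable_bddM (M := 1) (integrable_cosT v ia)) => // y; exact: ler_norm_cos.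
- by apply: (integrable_bddM (M := 1) (integrable_sinT v ia)) => // y; exact: ler_norm_sin.
Qed.

Definition autocorr (a : mR -> R) (s : R) : R := \int[leb]_x (a x * a (x - s)).

(** The square is expanded into a double integral over x and y, and the integral over v is carried
    inside by two applications of Fubini. There it meets the damped cosine and produces the Poisson
    kernel in [x - y]. *)
Lemma Rintegral_poisson_sqr (a : mR -> R) (e : R) : 0 < e ->
  leb.-integrable setT (EFin \o a) ->
  (\int[leb]_v (expR (- e * `|v|) * (cosT a v ^+ 2 + sinT a v ^+ 2))) =
  (\int[leb]_x (a x * \int[leb]_u (a (x - e * u) * (2 / (1 + u ^+ 2))))).
Proof.
move=> e0 ia; have /integrableP[/measurable_EFinP ma _] := ia.
have mC := measurable_cosT ma; have mS := measurable_sinT ma.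
pose w (v : mR) := expR (- e * `|v|).
have mw : measurable_fun setT w by exact: measurable_expR_norm.
have iw : leb.-integrable setT (EFin \o w) by exact: integrable_expR_norm.
have w1 v : `|w v| <= 1.
  by rewrite ger0_norm ?expR_ge0// -expR0 ler_expR mulNr oppr_le0 mulr_ge0// ltW.
pose I1 := \int[leb]_x `|a x|.
pose h (z : mR * mR) := w z.1 * (cosT a z.1 * cos (z.1 * z.2) + sinT a z.1 * sin (z.1 * z.2)) * a z.2.
have mh : measurable_fun setT h by rewrite /h; meas.
pose k (z : mR * mR * mR) := w z.1.1 * (a z.2 * cos (z.1.1 * (z.1.2 - z.2))).
(* This bound, uniform in [v] and [x], dominates [h] by a multiple of [w v * |a x|], which is
   integrable on the product. *)
have CS (v x : R) : `|cosT a v * cos (v * x) + sinT a v * sin (v * x)| <= 2 * I1.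
  rewrite (le_trans (ler_normD _ _))// !normrM mulr_natl mulr2n lerD//.
    by rewrite (le_trans _ (norm_cosT v ia))// ler_piMr// ler_norm_cos.
  by rewrite (le_trans _ (norm_sinT v ia))// ler_piMr// ler_norm_sin.
have ih : (leb \x leb)%E.-integrable setT (EFin \o h).
  apply: (@le_integrableR R _ _ _ _ (fun z => 2 * I1 * (w z.1 * `|a z.2|))) => //.
    move=> z; rewrite /h !normrM -mulrA mulrA [2 * I1 * _]mulrA ler_wpM2r//.
    rewrite mulrC (ger0_norm (expR_ge0 _)) ler_wpM2r ?expR_ge0//; exact: CS.
  have := integrableZl measurableT (2 * I1) (integrable_prodM iw (integrable_norm ia)).
  by apply: eq_integrable.
transitivity (\int[leb]_v (\int[leb]_x h (v, x))).
  apply: eq_Rintegral => v _; rewrite /h/=.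
  under eq_Rintegral do rewrite -mulrA mulrDl -!mulrA ![cos _ * a _]mulrC ![sin _ * a _]mulrC.
  rewrite RintegralZl//; last by apply: integrableDR; apply: integrableZlR; [exact: integrable_cosT|exact: integrable_sinT].
  rewrite RintegralD//; [|exact/integrableZlR/integrable_cosT|exact/integrableZlR/integrable_sinT].
  by rewrite !RintegralZl//; [exact: integrable_sinT|exact: integrable_cosT].
have iCS x : leb.-integrable setT (EFin \o (fun v : mR => w v * (cosT a v * cos (v * x) + sinT a v * sin (v * x)))).
  by apply: (integrable_bddM (M := 2 * I1) iw); first by meas.
rewrite Rintegral_fubini//; first last.
- by move=> x; have := integrableZrR (a x) (iCS x); apply: eq_integrable.
- move=> v; apply: (eq_integrable measurableT _ _ _ (integrableZlR (w v) (integrable_bddM (M := 2 * I1) (g := fun x : mR => cosT a v * cos (v * x) + sinT a v * sin (v * x)) ia _ _))) => //; last by meas.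
  by move=> x _; congr EFin; rewrite /h/=; ring.
apply: eq_Rintegral => x _; rewrite /h/=.
rewrite RintegralZr//.
rewrite mulrC; congr (_ * _).
transitivity (\int[leb]_v (\int[leb]_y (a y * (w v * cos ((x - y) * v))))).
  apply: eq_Rintegral => v _; rewrite fourier_square_split// -RintegralZl//.
    by apply: eq_Rintegral => y _; rewrite mulrCA [v * _]mulrC.
  by apply: (integrable_bddM (M := 1) ia) => [|y]; [meas|exact: ler_norm_cos].
rewrite (Rintegral_fubini (f := fun z : mR * mR => a z.2 * (w z.1 * cos ((x - z.2) * z.1))))//=; first last.
- by move=> y; apply: integrableZlR; exact: integrable_poisson.
- move=> v; apply: (integrable_bddM (M := 1) ia) => [|y]; first by meas.
  by rewrite normrM (le_trans _ (w1 v))// ler_piMr// ler_norm_cos.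
- apply: (le_integrableR _ _ (integrable_prodM iw (integrable_norm ia))) => /=; first by meas.
  move=> z; rewrite !normrM mulrCA mulrC -mulrA mulrC.
  rewrite ler_wpM2r// (ger0_norm (expR_ge0 _)) ler_piMl ?expR_ge0//; exact: ler_norm_cos.
transitivity (\int[leb]_y (a y * (2 * e / (e ^+ 2 + (x - y) ^+ 2)))).
  apply: eq_Rintegral => y _; rewrite RintegralZl// ?Rintegral_poisson//.
  exact: integrable_poisson.
have mK : measurable_fun setT (fun y : mR => 2 * e / (e ^+ 2 + (x - y) ^+ 2)).
  apply: continuous_measurable_fun => y; apply: cvgM; first exact: cvg_cst.
  apply: cvgV; first by rewrite gt_eqF// ltr_pwDl ?exprn_gt0// sqr_ge0.
  apply: cvgD; first exact: cvg_cst.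
  apply: (continuous_comp (f := fun y => x - y) (g := fun z => z ^+ 2)); last exact: exprn_continuous.
  by apply: cvgB; [exact: cvg_cst|exact: cvg_id].
have iK : leb.-integrable setT (EFin \o (fun y : mR => a y * (2 * e / (e ^+ 2 + (x - y) ^+ 2)))).
  apply: (integrable_bddM (M := 2 / e) ia) => // y.
  have D0 : 0 < e ^+ 2 + (x - y) ^+ 2 by rewrite ltr_pwDl ?exprn_gt0// sqr_ge0.
  rewrite ger0_norm; last by rewrite divr_ge0 ?mulr_ge0 ?(ltW D0) ?(ltW e0).
  rewrite ler_pdivrMr// mulrAC ler_pdivlMr//.
  by rewrite -mulrA ler_wpM2l// -expr2 lerDl sqr_ge0.
(* The substitution y = x - e u makes the kernel independent of [e]: e * 2e / (e^2 + e^2 u^2) = 2 /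
   (1 + u^2). *)
rewrite (Rintegral_affine (a := - e) x) ?oppr_eq0 ?gt_eqF//.
rewrite normrN gtr0_norm// -RintegralZl//; last by apply: (integrable_affine (a := - e) x _ iK); rewrite oppr_eq0 gt_eqF.
apply: eq_Rintegral => u _; rewrite [- e * u + x]addrC mulNr mulrCA; congr (_ * _).
have U0 : 1 + u ^+ 2 != 0 by rewrite gt_eqF// ltr_pwDl// sqr_ge0.
have -> : e ^+ 2 + (x - (x - e * u)) ^+ 2 = e ^+ 2 * (1 + u ^+ 2) by ring.
field.
by rewrite U0 gt_eqF.
Qed.

Lemma integrable_mulL2 d (T : measurableType d) (mu : {measure set T -> \bar R}) (a b : T -> R) :
  measurable_fun setT a -> measurable_fun setT b ->
  mu.-integrable setT (EFin \o (fun x => a x ^+ 2)) -> mu.-integrable setT (EFin \o (fun x => b x ^+ 2)) ->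
  mu.-integrable setT (EFin \o (fun x => a x * b x)).
Proof.
move=> ma mb ia ib; apply: (le_integrableR (g := fun x => 2^-1 * (a x ^+ 2 + b x ^+ 2))); first by meas.
- move=> x; rewrite ler_norml; apply/andP; split.
    by have := sqr_ge0 (a x + b x); rewrite sqrrD; lra.
  by have := sqr_ge0 (a x - b x); rewrite sqrrB; lra.
- by apply: integrableZlR; exact: integrableDR.
Qed.

Lemma integrable_shift_sqr (a : mR -> R) (s : R) : leb.-integrable setT (EFin \o (fun x => a x ^+ 2)) ->
  leb.-integrable setT (EFin \o (fun x : mR => a (x - s) ^+ 2)).
Proof.
move=> ia; have := integrable_affine (a := 1) (- s) (oner_neq0 _) ia.
by apply: eq_integrable => // x _; rewrite mul1r.
Qed.

Lemma Rintegral_shift (a : mR -> R) (s : R) : leb.-integrable setT (EFin \o a) ->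
  \int[leb]_x (a (x - s)) = \int[leb]_x (a x).
Proof.
move=> ia; rewrite (Rintegral_affine (a := 1) (- s) (oner_neq0 _) ia) normr1 mul1r.
by apply: eq_Rintegral => x _; rewrite mul1r.
Qed.

(** From 2 |a b| <= a^2 + b^2 and translation invariance. The bound does not depend on [s], so it
    serves as the dominating constant in the limits below. *)
Lemma norm_autocorr (a : mR -> R) (s : R) : measurable_fun setT a ->
  leb.-integrable setT (EFin \o (fun x => a x ^+ 2)) ->
  leb.-integrable setT (EFin \o (fun x : mR => a x * a (x - s))) /\
  \int[leb]_x `|a x * a (x - s)| <= \int[leb]_x (a x ^+ 2).
Proof.
move=> ma ia; have ias := integrable_shift_sqr s ia.
have mas : measurable_fun setT (fun x : mR => a (x - s)) by meas.
have i2 := integrable_mulL2 ma mas ia ias; split => //.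
apply: (@le_trans _ _ (\int[leb]_x (2^-1 * (a x ^+ 2 + a (x - s) ^+ 2)))).
  apply: le_Rintegral => //; first exact: integrable_norm.
  - by apply: integrableZlR; exact: integrableDR.
  - move=> x _; rewrite ler_norml; apply/andP; split.
      by have := sqr_ge0 (a x + a (x - s)); rewrite sqrrD; lra.
    by have := sqr_ge0 (a x - a (x - s)); rewrite sqrrB; lra.
rewrite RintegralZl//; last exact: integrableDR.
rewrite RintegralD// (Rintegral_shift (a := fun x => a x ^+ 2))//; lra.
Qed.

(** The Poisson kernel at scale 1, normalised to have mass [2 * pi]. *)
Let q (u : mR) : R := 2 / (1 + u ^+ 2).

Lemma measurable_q : measurable_fun [set: mR] q.
Proof.
apply: continuous_measurable_fun => u; apply: cvgM; first exact: cvg_cst.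
exact: continuous_oneDsqrV.
Qed.

Lemma q_ge0 (u : R) : 0 <= q u.
Proof. by rewrite /q divr_ge0// addr_ge0// sqr_ge0. Qed.

Lemma q_le2 (u : R) : `|q u| <= 2.
Proof. by rewrite ger0_norm ?q_ge0// /q ler_pdivrMr ?ltr_pwDl ?sqr_ge0// ler_peMr// lerDl sqr_ge0. Qed.

Lemma integrable_q : leb.-integrable setT (EFin \o q).
Proof.
apply/integrableP; split; first by apply/measurable_EFinP; exact: measurable_q.
under eq_integral do rewrite gee0_abs ?lee_fin ?q_ge0//.
by rewrite integral_oneDsqrV ltry.
Qed.

Lemma Rintegral_qM (c : R) : \int[leb]_u (q u * c) = 2 * pi * c.
Proof. by rewrite RintegralZr ?integrable_q// {1}/Rintegral integral_oneDsqrV. Qed.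

(** Exchanging x and u in the previous formula leaves the autocorrelation averaged against the
    kernel [q]. As [e] tends to 0 its argument tends to 0, where the autocorrelation is the squared
    norm. *)
Lemma Rintegral_poisson_autocorr (a : mR -> R) (e : R) : 0 < e ->
  leb.-integrable setT (EFin \o a) -> leb.-integrable setT (EFin \o (fun x => a x ^+ 2)) ->
  (\int[leb]_v (expR (- e * `|v|) * (cosT a v ^+ 2 + sinT a v ^+ 2))) =
  (\int[leb]_u (q u * autocorr a (e * u))).
Proof.
move=> e0 ia ia2; have /integrableP[/measurable_EFinP ma _] := ia.
have mq := measurable_q.
rewrite (Rintegral_poisson_sqr e0 ia).
pose f (z : mR * mR) := a z.1 * (a (z.1 - e * z.2) * q z.2).
have mf : measurable_fun setT f by rewrite /f; meas.
have iau x : leb.-integrable setT (EFin \o (fun u : mR => a (x - e * u) * q u)).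
  apply: (@integrable_bddM _ _ _ _ _ 2); [|exact: mq|exact: q_le2].
  have /eq_integrable : leb.-integrable setT (fun u => (EFin \o a) (- e * u + x)).
    by apply: integrable_affine => //; rewrite oppr_eq0 gt_eqF.
  by apply => // u _ /=; rewrite addrC mulNr.
transitivity (\int[leb]_x (\int[leb]_u f (x, u))).
  by apply: eq_Rintegral => x _; rewrite /f/= RintegralZl.
have fu u : leb.-integrable setT (fun x : mR => (f (x, u))%:E).
  have [h _] := norm_autocorr (e * u) ma ia2.
  have := integrableZrR (q u) h.
  by apply: eq_integrable => // x _; rewrite /f/= mulrA.
rewrite Rintegral_fubini//; first last.
- by move=> x; have := integrableZlR (a x) (iau x); apply: eq_integrable.
(* Absolute integrability on the product is checked by integrating over x first: [norm_autocorr]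
   bounds the inner integral by [q u] times the squared norm of [a]. *)
- apply/integrable21ltyP; first exact/measurable_EFinP.
  apply: (@le_lt_trans _ _ (\int[leb]_u (q u * \int[leb]_x (a x ^+ 2))%:E)%E); last first.
    by apply: integrable_lty => //; exact: integrableZrR integrable_q.
  apply: ge0_le_integral => //.
  + by move=> u _; exact: integral_ge0.
  + apply: (measurable_fun_fubini_tonelli_G (m1 := leb) (abse \o (EFin \o f))) => //.
      by apply: measurableT_comp => //; exact/measurable_EFinP.
    by move=> z; exact: abse_ge0.
  + by apply/measurable_EFinP; meas.
  + move=> u _; have [h1 h2] := norm_autocorr (e * u) ma ia2.
    rewrite -[leLHS]fineK ?lee_fin; last first.
      by apply: integrable_fin_num => //; exact: integrable_norm (fu u).
    apply: le_trans (ler_wpM2l (q_ge0 u) h2).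
    rewrite -RintegralZl//; last exact: integrable_norm.
    rewrite le_eqVlt; apply/orP; left; apply/eqP; apply: eq_Rintegral => x _.
    by rewrite /f/= mulrA normrM mulrC (ger0_norm (q_ge0 u)).
apply: eq_Rintegral => u _; rewrite /f/= /autocorr -RintegralZl//; last by case: (norm_autocorr (e * u) ma ia2).
by apply: eq_Rintegral => x _; rewrite mulrA mulrC.
Qed.

Lemma measurable_autocorr (a : mR -> R) : measurable_fun setT a -> measurable_fun [set: mR] (autocorr a).
Proof.
move=> ma; apply: (measurable_Rintegral (f := fun z : mR * mR => a z.2 * a (z.2 - z.1))); meas.
Qed.

(** Extended-real, because finiteness is itself a conclusion of Bessel's inequality. *)
Definition energyT (a : mR -> R) : \bar R := (\int[leb]_v (cosT a v ^+ 2 + sinT a v ^+ 2)%:E)%E.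

Lemma measurable_poisson_sqr (a : mR -> R) (e : R) : measurable_fun setT a ->
  measurable_fun [set: mR] (fun v : mR => expR (- e * `|v|) * (cosT a v ^+ 2 + sinT a v ^+ 2)).
Proof. by move=> ma; have := measurable_cosT ma; have := measurable_sinT ma => mS mC; meas. Qed.

Lemma integrable_poisson_sqr (a : mR -> R) (e : R) : 0 < e -> leb.-integrable setT (EFin \o a) ->
  leb.-integrable setT (EFin \o (fun v : mR => expR (- e * `|v|) * (cosT a v ^+ 2 + sinT a v ^+ 2))).
Proof.
move=> e0 ia; have /integrableP[/measurable_EFinP ma _] := ia.
apply: (integrable_bddM (M := 2 * (\int[leb]_x `|a x|) ^+ 2) (integrable_expR_norm e0)).
  by have := measurable_cosT ma; have := measurable_sinT ma => mS mC; meas.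
move=> v; rewrite ger0_norm ?addr_ge0 ?sqr_ge0// mulr_natl mulr2n lerD//.
  by rewrite -[X in X <= _]real_normK ?num_real// lerXn2r ?nnegrE// ?Rintegral_ge0// norm_cosT.
by rewrite -[X in X <= _]real_normK ?num_real// lerXn2r ?nnegrE// ?Rintegral_ge0// norm_sinT.
Qed.

(** With [e] equal to 1/(n+1) the weight exp(- e |v|) increases to 1, so monotone convergence
    applies even when the limit is infinite. *)
Lemma cvg_energyT (a : mR -> R) : leb.-integrable setT (EFin \o a) ->
  leb.-integrable setT (EFin \o (fun x => a x ^+ 2)) ->
  (\int[leb]_u (q u * autocorr a (n.+1%:R^-1 * u)))%:E @[n --> \oo] --> energyT a.
Proof.
move=> ia ia2; have /integrableP[/measurable_EFinP ma _] := ia.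
have e0 n : 0 < n.+1%:R^-1 :> R by rewrite invr_gt0.
rewrite (_ : (fun n => _) = (fun n => \int[leb]_v (expR (- n.+1%:R^-1 * `|v|) * (cosT a v ^+ 2 + sinT a v ^+ 2))%:E)%E); last first.
  apply/funext => n; rewrite -(Rintegral_poisson_autocorr (e0 n) ia ia2) /Rintegral fineK//.
  by apply: integrable_fin_num => //; exact: integrable_poisson_sqr.
have -> : energyT a = (\int[leb]_v (limn (fun n => (expR (- n.+1%:R^-1 * `|v|) * (cosT a v ^+ 2 + sinT a v ^+ 2))%:E)))%E.
  apply: eq_integral => v _; apply/esym/cvg_lim => //; apply: cvg_EFin; first by near=> n.
  rewrite -[X in _ --> X]mul1r; apply: cvgM; last exact: cvg_cst.
  apply: (@cvg_comp _ _ _ (fun n => - n.+1%:R^-1 * `|v|) expR _ (nbhs (0 : R))).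
    have : - n.+1%:R^-1 * `|v| @[n --> \oo] --> - 0 * `|v|.
      by apply: cvgM; [apply: cvgN; exact: cvg_harmonic|exact: cvg_cst].
    by rewrite oppr0 mul0r.
  by rewrite -(expR0 R); exact: continuous_expR.
apply: cvg_monotone_convergence => //.
- by move=> n; apply/measurable_EFinP; exact: measurable_poisson_sqr.
- by move=> n v _; rewrite lee_fin mulr_ge0 ?expR_ge0 ?addr_ge0 ?sqr_ge0.
- move=> v _ m n mn; rewrite lee_fin ler_wpM2r ?addr_ge0 ?sqr_ge0// ler_expR !mulNr lerN2 ler_wpM2r//.
  by rewrite lef_pV2 ?posrE// ler_nat.
Unshelve. all: by end_near.
Qed.

(** Each regularised energy is an average of autocorrelations, which never exceed the squared norm,
    against a kernel of mass [2 * pi]; the bound survives the limit. *)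
Lemma bessel_real (a : mR -> R) : leb.-integrable setT (EFin \o a) ->
  leb.-integrable setT (EFin \o (fun x => a x ^+ 2)) ->
  (energyT a <= (2 * pi * \int[leb]_x (a x ^+ 2))%:E)%E.
Proof.
move=> ia ia2; have /integrableP[/measurable_EFinP ma _] := ia.
have := cvg_energyT ia ia2 => h; rewrite -(cvg_lim _ h)//; apply: lime_le; first by apply/cvg_ex; eexists; exact: h.
near=> n; rewrite lee_fin.
have ai s : `|autocorr a s| <= \int[leb]_x (a x ^+ 2).
  have [h1 h2] := norm_autocorr s ma ia2; apply: le_trans h2; exact: le_normr_Rintegral.
apply: (@le_trans _ _ (\int[leb]_u (q u * \int[leb]_x (a x ^+ 2)))).
  apply: le_Rintegral => //.
  - have mA := measurable_autocorr ma.
    by apply: (integrable_bddM (M := \int[leb]_x (a x ^+ 2)) integrable_q) => //; meas.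
  - exact: integrableZrR integrable_q.
  - by move=> u _; rewrite ler_wpM2l ?q_ge0// (le_trans (ler_norm _))// ai.
by rewrite Rintegral_qM.
Unshelve. all: by end_near.
Qed.

(** Continuity of the autocorrelation at 0 turns Bessel's inequality into an equality, by dominated
    convergence against [q]. Only the scales 1/(n+1) occur, so a limit along these sequences is
    enough. *)
Lemma plancherel_autocorr (a : mR -> R) : leb.-integrable setT (EFin \o a) ->
  leb.-integrable setT (EFin \o (fun x => a x ^+ 2)) ->
  (forall u, autocorr a (n.+1%:R^-1 * u) @[n --> \oo] --> (\int[leb]_x (a x ^+ 2))) ->
  energyT a = (2 * pi * \int[leb]_x (a x ^+ 2))%:E.
Proof.
move=> ia ia2 ha; have /integrableP[/measurable_EFinP ma _] := ia.
have ai s : `|autocorr a s| <= \int[leb]_x (a x ^+ 2).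
  have [h1 h2] := norm_autocorr s ma ia2; apply: le_trans h2; exact: le_normr_Rintegral.
have /(cvg_lim _) <- // := cvg_energyT ia ia2; apply/cvg_lim => //.
have mA := measurable_autocorr ma.
have [] := @dominated_convergence _ _ _ leb setT measurableT
  (fun n u => (q u * autocorr a (n.+1%:R^-1 * u))%:E) (fun u => (q u * \int[leb]_x (a x ^+ 2))%:E)
  (fun u => (q u * \int[leb]_x (a x ^+ 2))%:E).
- move=> n; apply/measurable_EFinP. apply: measurable_funM; [exact: measurable_q|by meas].
- by apply/measurable_EFinP; apply: measurable_funM; [exact: measurable_q|by meas].
- apply: aeW => u _; apply: cvg_EFin; first by near=> n.
  by apply: cvgM; [exact: cvg_cst|exact: ha].
- exact: integrableZrR integrable_q.
- by apply: aeW => u n _; rewrite /= normrM (ger0_norm (q_ge0 u)) lee_fin ler_wpM2l ?q_ge0.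
move=> _ _; rewrite (_ : (\int[leb]_u (q u * \int[leb]_x (a x ^+ 2))%:E)%E = (2 * pi * \int[leb]_x (a x ^+ 2))%:E); last first.
  by rewrite -Rintegral_qM /Rintegral fineK//; apply: integrable_fin_num => //; exact: integrableZrR integrable_q.
rewrite [X in _ -> X @ _ --> _](_ : _ = (fun n => (\int[leb]_u (q u * autocorr a (n.+1%:R^-1 * u))%:E)%E))//.
apply/funext => n; rewrite /Rintegral fineK//.
apply: integrable_fin_num => //; apply: (integrable_bddM (M := \int[leb]_x (a x ^+ 2)) integrable_q) => //.
by meas.
Unshelve. all: by end_near.
Qed.

End RealPoisson.

(** * Cut-off continuous functions, density, and Plancherel for real functions *)

Section RealPlancherel.
Context (R : realType).
Local Notation mR := (measurableTypeR R).

Lemma ae_neq (c : R) : {ae (@lebesgue_measure R), forall x, x != c}.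
Proof.
exists [set c]; split => //; first by rewrite lebesgue_measure_set1.
by move=> x /= /negP; rewrite negbK => /eqP.
Qed.

Definition cut (N : R) (g : mR -> R) (x : mR) : R := \1_(`[- N, N]%classic : set mR) x * g x.

Lemma cutE N g x : cut N g x = if (- N <= x <= N) then g x else 0.
Proof.
rewrite /cut indicE; case: ifPn => h.
  by rewrite mem_set ?mul1r//= in_itv.
by rewrite memNset ?mul0r//= in_itv; apply/negP.
Qed.

Lemma integrable_cut1 (N : R) : leb.-integrable setT (EFin \o (\1_(`[- N, N]%classic : set mR) : mR -> R)).
Proof. exact: integrable_indic_itv. Qed.

Lemma measurable_cut N g : measurable_fun setT g -> measurable_fun setT (cut N g).
Proof. move=> mg; apply: measurable_funM => //; exact: measurable_indic. Qed.

Lemma integrable_cut (N M : R) (g : mR -> R) : measurable_fun setT g -> (forall x, `|g x| <= M) ->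
  leb.-integrable setT (EFin \o cut N g).
Proof. by move=> mg gM; apply: integrable_bddM (integrable_cut1 N) mg gM. Qed.

Lemma cut_sqr N g x : cut N g x ^+ 2 = cut N (fun x => g x ^+ 2) x.
Proof. by rewrite !cutE; case: ifP => // _; rewrite expr0n. Qed.

Lemma integrable_cut_sqr (N M : R) (g : mR -> R) : measurable_fun setT g -> (forall x, `|g x| <= M) ->
  leb.-integrable setT (EFin \o (fun x => cut N g x ^+ 2)).
Proof.
move=> mg gM; under eq_fun do rewrite cut_sqr.
apply: (@integrable_cut _ (M ^+ 2)); first by meas.
by move=> x; rewrite normrX lerXn2r ?nnegrE ?(le_trans _ (gM x)).
Qed.

(** Dominated convergence: the integrands converge almost everywhere and are bounded by M^2 on
    [-N, N], outside which the unshifted factor vanishes. *)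
Lemma cvg_autocorr_cut (N M : R) (g : mR -> R) u : continuous (g : R -> R) -> (forall x, `|g x| <= M) ->
  autocorr (cut N g) (n.+1%:R^-1 * u) @[n --> \oo] --> \int[leb]_x (cut N g x ^+ 2).
Proof.
move=> cg gM; have mg : measurable_fun setT g by exact: continuous_measurable_fun.
have M0 : 0 <= M by rewrite (le_trans _ (gM 0)).
have mk := measurable_cut N mg.
have cM x : `|cut N g x| <= M by rewrite cutE; case: ifP; rewrite ?normr0.
have [] := @dominated_convergence _ _ _ leb setT measurableT
  (fun n x => (cut N g x * cut N g (x - n.+1%:R^-1 * u))%:E) (fun x => (cut N g x ^+ 2)%:E)
  (fun x => (\1_(`[- N, N]%classic : set mR) x * (M * M))%:E).
- by move=> n; apply/measurable_EFinP; meas.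
- by apply/measurable_EFinP; meas.
(* The cut-off may jump at N and -N. At any other point, x and its small translates lie on the same
   side of the jumps, and continuity of [g] decides. *)
- apply: (@filterS2 _ (almost_everywhere leb) _ _ _ _ _ (ae_neq N) (ae_neq (- N))) => x xN xNN _.
  apply: cvg_EFin; first by near=> n.
  have hs : x - n.+1%:R^-1 * u @[n --> \oo] --> x.
    have : x - n.+1%:R^-1 * u @[n --> \oo] --> x - 0 * u.
      apply: cvgB; first exact: cvg_cst.
      by apply: cvgM; [exact: cvg_harmonic|exact: cvg_cst].
    by rewrite mul0r subr0.
  have [xI|xI] := boolP (- N <= x <= N); last first.
    rewrite [cut N g x]cutE (negbTE xI) expr0n/=.
    by under eq_cvg do rewrite /= mul0r; exact: cvg_cst.
  have {}xI : x \in `]- N, N[.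
    by rewrite in_itv/= !lt_neqAle eq_sym xNN xN.
  rewrite expr2; apply: cvgM; first exact: cvg_cst.
  have -> : cut N g x = g x by rewrite cutE; move: xI; rewrite in_itv/= => /andP[/ltW -> /ltW ->].
  apply: cvg_trans (continuous_cvg _ (cg x) hs); apply: near_eq_cvg.
  have hn : \forall n \near \oo, x - n.+1%:R^-1 * u \in `]- N, N[.
    by apply: (hs (`]- N, N[%classic : set R)); apply: open_nbhs_nbhs; split; [exact: interval_open|].
  apply: filterS hn => n /=; rewrite in_itv/= => /andP[h1 h2]; rewrite cutE (ltW h1) (ltW h2)//.
- by have := integrableZrR (M * M) (integrable_cut1 N).
- apply: aeW => x n _; rewrite /= lee_fin normrM.
  rewrite [cut N g x]/cut normrM ger0_norm// -mulrA ler_wpM2l// ler_pM//.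
move=> i1 _; rewrite -[X in _ --> X -> _]fineK; last exact: integrable_fin_num.
by move/fine_cvg.
Unshelve. all: by end_near.
Qed.

Lemma plancherel_cut (N M : R) (g : mR -> R) : continuous (g : R -> R) -> (forall x, `|g x| <= M) ->
  energyT (cut N g) = (2 * pi * \int[leb]_x (cut N g x ^+ 2))%:E.
Proof.
move=> cg gM; have mg : measurable_fun setT g by exact: continuous_measurable_fun.
apply: plancherel_autocorr; first exact: integrable_cut mg gM.
- exact: integrable_cut_sqr mg gM.
- by move=> u; exact: cvg_autocorr_cut cg gM.
Qed.


(** Both the domain and the range are truncated: [cut] restricts x, the inner indicator restricts
    [a x]. The difference is either 0 or [a x], so [a ^+ 2] dominates its square. *)
Lemma cvg_trunc_sqr (a : mR -> R) : measurable_fun setT a ->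
  leb.-integrable setT (EFin \o (fun x => a x ^+ 2)) ->
  (\int[leb]_x ((a x - cut n%:R (fun x => \1_(`[- n%:R, n%:R]%classic : set mR) (a x) * a x) x) ^+ 2)%:E)%E @[n --> \oo] --> 0%E.
Proof.
move=> ma ia2.
have mt n : measurable_fun setT (cut n%:R (fun x => \1_(`[- n%:R, n%:R]%classic : set mR) (a x) * a x)).
  apply: measurable_cut; apply: measurable_funM => //.
  by apply: (measurableT_comp _ ma); exact: measurable_indic.
have tE n x : cut n%:R (fun x => \1_(`[- n%:R, n%:R]%classic : set mR) (a x) * a x) x =
   if (`|x| <= n%:R) && (`|a x| <= n%:R) then a x else 0.
  rewrite cutE -ler_norml; case: ifP => //= _.
  by rewrite -/(cut _ id (a x)) cutE -ler_norml.
have [] := @dominated_convergence _ _ _ leb setT measurableT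
  (fun n x => ((a x - cut n%:R (fun x => \1_(`[- n%:R, n%:R]%classic : set mR) (a x) * a x) x) ^+ 2)%:E) (cst 0%E)
  (fun x => (a x ^+ 2)%:E).
- by move=> n; apply/measurable_EFinP; have := mt n => mn; meas.
- exact: measurable_cst.
- apply: aeW => x _; apply: cvg_EFin; first by near=> n.
  apply: cvg_near_cst; near=> n; rewrite /= tE ifT ?subrr ?expr0n//.
  by apply/andP; split; near: n; exact: nbhs_infty_ger.
- exact: ia2.
- apply: aeW => x n _; rewrite lee_fin tE; case: ifP => _; last by rewrite subr0 ger0_norm ?sqr_ge0.
  by rewrite subrr expr0n/= normr0 sqr_ge0.
by move=> _ _; rewrite integral0.
Unshelve. all: by end_near.
Qed.

Definition clamp (M x : R) : R := Num.max (- M) (Num.min M x).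

Lemma continuous_clamp (M : R) (g : R -> R) : continuous g -> continuous (fun x => clamp M (g x)).
Proof.
move=> cg x; apply: (@continuous_max R R (fun=> - M) (fun x => Num.min M (g x))); first exact: cvg_cst.
by apply: (@continuous_min R R (fun=> M) g x) => //; [exact: cst_continuous|exact: cg].
Qed.

Lemma norm_clamp (M x : R) : 0 <= M -> `|clamp M x| <= M.
Proof. by move=> M0; rewrite ler_norml /clamp; rewrite le_max lexx/= ge_max ge_min lexx/= andbT lerNl; lra. Qed.

(** Projecting onto an interval never increases the distance to a point of that interval. *)
Lemma clamp_dist (M x y : R) : `|x| <= M -> `|x - clamp M y| <= `|x - y|.
Proof.
rewrite ler_norml => /andP[h1 h2]; rewrite /clamp.
case: (leP M y) => h; [case: (leP (- M) M) => h'|case: (leP (- M) y) => h' //].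
- by rewrite !ler0_norm; lra.
- by exfalso; lra.
- by rewrite !ger0_norm; lra.
Qed.

Lemma cvge0_lt (u : nat -> \bar R) (e : R) : 0 < e -> u @ \oo --> 0%E -> \forall n \near \oo, (u n < e%:E)%E.
Proof.
move=> e0 h; exact: (h _ (nbhs_open_ereal_lt (f := fun=> e) e0)).
Qed.

(** Density in L^1 is upgraded to L^2. After truncation, the function is bounded by N and supported
    in [-N, N]; clamping the continuous approximant to [-N, N] keeps the error below 2N, so the
    squared error is at most 2N times the L^1 error. *)
Lemma continuous_dense_L2 (a : mR -> R) (eta : R) : 0 < eta -> measurable_fun setT a ->
  leb.-integrable setT (EFin \o (fun x => a x ^+ 2)) ->
  exists g : R -> R, exists M N : R, [/\ continuous g, (forall x, `|g x| <= M) &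
     (\int[leb]_x ((a x - cut N g x) ^+ 2)%:E <= eta%:E)%E].
Proof.
move=> eta0 ma ia2.
have e4 : 0 < eta / 4 by lra.
have [n _ /(_ n (leqnn n)) hn] := cvge0_lt e4 (cvg_trunc_sqr ma ia2).
set N : R := n%:R in hn.
have N0 : 0 <= N by [].
pose b0 (x : mR) := \1_(`[- N, N]%classic : set mR) (a x) * a x.
have mb0 : measurable_fun setT b0.
  by apply: measurable_funM => //; apply: (measurableT_comp _ ma); exact: measurable_indic.
have b0N x : `|b0 x| <= N.
  by rewrite /b0 -/(cut N id (a x)) cutE -ler_norml; case: ifP => //; rewrite normr0.
pose b := cut N b0.
have mb : measurable_fun setT b := measurable_cut N mb0.
have bN x : `|b x| <= N by rewrite /b cutE; case: ifP; rewrite ?normr0.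
have ib : leb.-integrable `[- N, N] (EFin \o b).
  by apply: integrableS (integrable_cut N mb0 b0N).
have [//||g [cg ig hg]] := approximation_continuous_integrable _ _ ib.
  by rewrite /= lebesgue_measure_itv/=; case: ifP => _; rewrite -?EFinB ltry.
(* Since (x + y)^2 <= 2 x^2 + 2 y^2, each of the two squared errors may cost eta / 4, and 2N eta /
   (8 (N + 1)) <= eta / 4. Adding 1 to N avoids a division by zero. *)
have e8 : 0 < eta / (8 * (N + 1)) by rewrite divr_gt0// mulr_gt0// ltr_wpDl.
have [m _ /(_ m (leqnn m)) hm] := cvge0_lt e8 hg.
exists (fun x => clamp N (g m x)), N, N; split.
- exact: continuous_clamp.
- by move=> x; exact: norm_clamp.
have mg : measurable_fun setT (g m : mR -> R) by exact: continuous_measurable_fun.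
have mh : measurable_fun setT (fun x : mR => clamp N (g m x)).
  by apply: continuous_measurable_fun; exact: continuous_clamp.
have mk := measurable_cut N mh.
pose d (x : mR) := 2 * N * (\1_(`[- N, N]%classic : set mR) x * `|b x - g m x|).
have md : measurable_fun setT d.
  by rewrite /d; meas; exact: measurable_indic.
have bkd x : (b x - cut N (fun x => clamp N (g m x)) x) ^+ 2 <= d x.
  rewrite /d indicE cutE; case: ifP => hx; last first.
    by rewrite /b cutE hx subrr expr0n/= mulr_ge0 ?mulr_ge0.
  rewrite mem_set ?mul1r//=.
  rewrite -real_normK ?num_real// expr2 ler_pM//; last exact: clamp_dist.
  by rewrite (le_trans (ler_normB _ _))// mulr_natl mulr2n lerD// norm_clamp.
apply: (@le_trans _ _ (2%:E * \int[leb]_x ((a x - b x) ^+ 2)%:E + 2%:E * \int[leb]_x (d x)%:E)%E).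
  rewrite -!ge0_integralZl_EFin//; last 4 first.
  - by move=> x _; rewrite lee_fin /d mulr_ge0 ?mulr_ge0.
  - exact/measurable_EFinP.
  - by move=> x _; rewrite lee_fin sqr_ge0.
  - by apply/measurable_EFinP; meas.
  rewrite -ge0_integralD//; last 4 first.
  - by move=> x _; rewrite -EFinM lee_fin mulr_ge0 ?sqr_ge0.
  - by apply/measurable_EFinP; meas.
  - by move=> x _; rewrite -EFinM lee_fin /d mulr_ge0 ?mulr_ge0 ?mulr_ge0.
  - by apply/measurable_EFinP; meas.
  apply: ge0_le_integral => //.
  - by move=> x _; rewrite lee_fin sqr_ge0.
  - by apply/measurable_EFinP; meas.
  - by apply/measurable_EFinP; meas.
  move=> x _; rewrite -!EFinM -EFinD lee_fin.
  have := bkd x; set k := cut _ _ _; have := sqr_ge0 (a x - b x - (b x - k)).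
  by nra.
have -> : (\int[leb]_x (d x)%:E = (2 * N)%:E * \int[leb]_(x in `[(- N)%R, N]) `|(b x - g m x)%:E|)%E.
  under eq_integral do rewrite /d EFinM.
  rewrite ge0_integralZl_EFin//; last 2 first.
  - by apply/measurable_EFinP; meas; exact: measurable_indic.
  - by rewrite mulr_ge0.
  congr (_ * _)%E; rewrite [RHS]integral_mkcond; apply: eq_integral => x _.
  by rewrite patchE indicE; case: ifPn; rewrite ?mul1r ?mul0r.
apply: (@le_trans _ _ (2%:E * (eta / 4)%:E + 2%:E * ((2 * N)%:E * (eta / (8 * (N + 1)))%:E))%E).
  apply: leeD; first by rewrite lee_wpmul2l// ltW.
  rewrite lee_wpmul2l// lee_wpmul2l ?lee_fin ?mulr_ge0//; exact: ltW.
rewrite -!EFinM -EFinD lee_fin.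
have : 2 * N * (eta / (8 * (N + 1))) <= eta / 4.
  rewrite mulrA ler_pdivrMr ?mulr_gt0 ?ltr_wpDl//; nra.
by lra.
Qed.


Lemma cosTD (a b : mR -> R) v : leb.-integrable setT (EFin \o a) -> leb.-integrable setT (EFin \o b) ->
  cosT (fun x => a x + b x) v = cosT a v + cosT b v.
Proof.
move=> ia ib; rewrite /cosT -RintegralD//; [|exact: integrable_cosT|exact: integrable_cosT].
by apply: eq_Rintegral => x _; rewrite mulrDl.
Qed.

Lemma sinTD (a b : mR -> R) v : leb.-integrable setT (EFin \o a) -> leb.-integrable setT (EFin \o b) ->
  sinT (fun x => a x + b x) v = sinT a v + sinT b v.
Proof.
move=> ia ib; rewrite /sinT -RintegralD//; [|exact: integrable_sinT|exact: integrable_sinT].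
by apply: eq_Rintegral => x _; rewrite mulrDl.
Qed.

Lemma cosTB (a b : mR -> R) v : leb.-integrable setT (EFin \o a) -> leb.-integrable setT (EFin \o b) ->
  cosT (fun x => a x - b x) v = cosT a v - cosT b v.
Proof.
move=> ia ib; rewrite /cosT -RintegralB//; [|exact: integrable_cosT|exact: integrable_cosT].
by apply: eq_Rintegral => x _; rewrite mulrBl.
Qed.

Lemma sinTB (a b : mR -> R) v : leb.-integrable setT (EFin \o a) -> leb.-integrable setT (EFin \o b) ->
  sinT (fun x => a x - b x) v = sinT a v - sinT b v.
Proof.
move=> ia ib; rewrite /sinT -RintegralB//; [|exact: integrable_sinT|exact: integrable_sinT].
by apply: eq_Rintegral => x _; rewrite mulrBl.
Qed.

Lemma measurable_energyT (a : mR -> R) : measurable_fun setT a ->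
  measurable_fun [set: mR] (fun v : mR => cosT a v ^+ 2 + sinT a v ^+ 2).
Proof. by move=> ma; have mC := measurable_cosT ma; have mS := measurable_sinT ma; meas. Qed.

Lemma energyTE (a : mR -> R) : energyT a = (\int[leb]_v (cosT a v ^+ 2 + sinT a v ^+ 2)%:E)%E.
Proof. by []. Qed.

Lemma energyT_ge0 (a : mR -> R) : (0 <= energyT a)%E.
Proof. by apply: integral_ge0 => v _; rewrite lee_fin addr_ge0 ?sqr_ge0. Qed.

Lemma integrableBR d (T : measurableType d) (mu : {measure set T -> \bar R}) (f g : T -> R) :
  mu.-integrable setT (EFin \o f) -> mu.-integrable setT (EFin \o g) -> mu.-integrable setT (EFin \o (fun x => f x - g x)).
Proof. by move=> fi gi; have := integrableB measurableT fi gi; apply: eq_integrable. Qed.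

Lemma integrable_sqrB d (T : measurableType d) (mu : {measure set T -> \bar R}) (a b : T -> R) :
  measurable_fun setT a -> measurable_fun setT b ->
  mu.-integrable setT (EFin \o (fun x => a x ^+ 2)) -> mu.-integrable setT (EFin \o (fun x => b x ^+ 2)) ->
  mu.-integrable setT (EFin \o (fun x => (a x - b x) ^+ 2)).
Proof.
move=> ma mb ia ib; apply: (le_integrableR (g := fun x => 2 * (a x ^+ 2 + b x ^+ 2))); first by meas.
- by move=> x; rewrite ger0_norm ?sqr_ge0//; have := sqr_ge0 (a x + b x); nra.
- by apply: integrableZlR; exact: integrableDR.
Qed.

Lemma parallelogram_arith (p A D' D K ea ed e : R) : A + D' = 2 * D + 2 * K -> ed <= 2 * p * D' ->
  2 * (2 * p * K) <= ea + ed -> 4 * p * D <= e -> 2 * p * A <= ea + e.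
Proof.
move=> h h1 h2 h3; have : p * A + p * D' = 2 * (p * D) + 2 * (p * K) by rewrite -mulrDr h; ring.
lra.
Qed.

Opaque energyT.

(* The defect [2 pi |a|^2 - |FT a|^2] is a nonnegative quadratic form which vanishes on a dense set, so by the
   parallelogram law it is bounded by twice its value at [a - k] for [k] in this set. *)
Lemma plancherel_real (a : mR -> R) : leb.-integrable setT (EFin \o a) ->
  leb.-integrable setT (EFin \o (fun x => a x ^+ 2)) ->
  energyT a = (2 * pi * \int[leb]_x (a x ^+ 2))%:E.
Proof.
move=> ia ia2; have /integrableP[/measurable_EFinP ma _] := ia.
have ba := bessel_real ia ia2; apply/eqP; rewrite eq_le ba/=.
have fa : energyT a \is a fin_num.
  by rewrite ge0_fin_numE ?energyT_ge0// (le_lt_trans ba)// ltry.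
rewrite -(fineK fa) lee_fin.
suff H (e : R) : 0 < e -> 2 * pi * \int[leb]_x (a x ^+ 2) <= fine (energyT a) + e by apply/ler_addgt0Pr.
move=> e0.
have p0 : 0 < pi :> R := pi_gt0 R.
(* Chosen so that the error term [4 * pi] times the squared norm of [a - k] is at most e / 2. *)
have e4 : 0 < e / (8 * pi) by rewrite divr_gt0// mulr_gt0.
have [g [M [N [cg gM]]]] := continuous_dense_L2 e4 ma ia2.
have mg : measurable_fun setT (g : mR -> R) by exact: continuous_measurable_fun.
pose k := cut N g; rewrite -/k => hk.
have ik : leb.-integrable setT (EFin \o k) := integrable_cut N mg gM.
have ik2 : leb.-integrable setT (EFin \o (fun x => k x ^+ 2)) := integrable_cut_sqr N mg gM.
have mk : measurable_fun setT k := measurable_cut N mg.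
pose d (x : mR) := a x - k x.
pose d' (x : mR) := d x - k x.
have id : leb.-integrable setT (EFin \o d) by exact: integrableBR.
have md : measurable_fun setT d by rewrite /d; meas.
have id2 : leb.-integrable setT (EFin \o (fun x => d x ^+ 2)) by exact: integrable_sqrB.
have id' : leb.-integrable setT (EFin \o d') by exact: integrableBR.
have id'2 : leb.-integrable setT (EFin \o (fun x => d' x ^+ 2)) by exact: integrable_sqrB.
have md' : measurable_fun setT d' by rewrite /d'; meas.
have pk : energyT k = (2 * pi * \int[leb]_x (k x ^+ 2))%:E := plancherel_cut N cg gM.
have bd' := bessel_real id' id'2.
have par : (energyT a + energyT d' = 2%:E * energyT d + 2%:E * energyT k)%E.
  have mT a' (m : measurable_fun setT a') := measurable_energyT m.
  rewrite !energyTE -!ge0_integralZl_EFin//; last 4 first.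
  - by move=> v _; rewrite lee_fin addr_ge0 ?sqr_ge0.
  - by apply/measurable_EFinP; exact: mT.
  - by move=> v _; rewrite lee_fin addr_ge0 ?sqr_ge0.
  - by apply/measurable_EFinP; exact: mT.
  rewrite -!ge0_integralD//; last 8 first.
  - by move=> v _; rewrite -EFinM lee_fin mulr_ge0 ?addr_ge0 ?sqr_ge0.
  - by apply/measurable_EFinP; apply: measurable_funM => //; exact: mT.
  - by move=> v _; rewrite -EFinM lee_fin mulr_ge0 ?addr_ge0 ?sqr_ge0.
  - by apply/measurable_EFinP; apply: measurable_funM => //; exact: mT.
  - by move=> v _; rewrite lee_fin addr_ge0 ?sqr_ge0.
  - by apply/measurable_EFinP; exact: mT.
  - by move=> v _; rewrite lee_fin addr_ge0 ?sqr_ge0.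
  - by apply/measurable_EFinP; exact: mT.
  apply: eq_integral => v _; rewrite -!EFinM -!EFinD; congr EFin.
  have -> : cosT a v = cosT d v + cosT k v.
    by rewrite -cosTD//; congr cosT; apply/funext => x; rewrite /d subrK.
  have -> : sinT a v = sinT d v + sinT k v.
    by rewrite -sinTD//; congr sinT; apply/funext => x; rewrite /d subrK.
  rewrite /d' cosTB// sinTB//; ring.
have parN : \int[leb]_x (a x ^+ 2) + \int[leb]_x (d' x ^+ 2) = 2 * \int[leb]_x (d x ^+ 2) + 2 * \int[leb]_x (k x ^+ 2).
  rewrite -!RintegralZl// -!RintegralD//; try exact: integrableZlR.
  apply: eq_Rintegral => x _; rewrite /d' /d; ring.
have fd' : energyT d' \is a fin_num.
  by rewrite ge0_fin_numE ?energyT_ge0// (le_lt_trans bd')// ltry.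
have hk' : \int[leb]_x (d x ^+ 2) <= e / (8 * pi).
  by rewrite -lee_fin /Rintegral fineK//; exact: integrable_fin_num.
have d0 : (0 <= energyT d)%E := energyT_ge0 d.
have h1 : fine (energyT d') <= 2 * pi * \int[leb]_x (d' x ^+ 2) by rewrite -lee_fin fineK.
(* Parallelogram law for the energies, with the nonnegative energy of [d] dropped and Plancherel
   known for [k]. *)
have h2 : 2 * (2 * pi * \int[leb]_x (k x ^+ 2)) <= fine (energyT a) + fine (energyT d').
  by rewrite -lee_fin EFinD (fineK fa) (fineK fd') par EFinM -pk leeDr// mule_ge0.
have h3 : 4 * pi * \int[leb]_x (d x ^+ 2) <= e.
  apply: (@le_trans _ _ (4 * pi * (e / (8 * pi)))); first by rewrite ler_wpM2l// mulr_ge0// ltW.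
  rewrite (_ : 4 * pi * _ = e / 2); first by rewrite ler_pdivrMr// mulr_natr mulr2n lerDl ltW.
  have : pi != 0 :> R by rewrite gt_eqF.
  by move: (pi) => p pN0; field.
exact: parallelogram_arith parN h1 h2 h3.
Qed.

End RealPlancherel.

(** * Complex-valued functions and their Fourier transform *)

Section ComplexBasics.
Context (R : realType).
Local Notation mR := (measurableTypeR R).
Local Notation Re := (@complex.Re R).
Local Notation Im := (@complex.Im R).
Implicit Types (z w : R[i]).

Lemma normc_ge0 z : 0 <= normc z.
Proof. by case: z => a b /=; rewrite sqrtr_ge0. Qed.

Lemma sqr_normc z : normc z ^+ 2 = Re z ^+ 2 + Im z ^+ 2.
Proof. by case: z => a b /=; rewrite sqr_sqrtr// addr_ge0 ?sqr_ge0. Qed.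

Lemma normc_Re z : `|Re z| <= normc z.
Proof.
rewrite -(ler_pXn2r (n := 2))// ?nnegrE ?normc_ge0// sqr_normc real_normK ?num_real//.
by rewrite lerDl sqr_ge0.
Qed.

Lemma normc_Im z : `|Im z| <= normc z.
Proof.
rewrite -(ler_pXn2r (n := 2))// ?nnegrE ?normc_ge0// sqr_normc real_normK ?num_real//.
by rewrite lerDr sqr_ge0.
Qed.

Lemma normc_real (r : R) : normc (real_complex R r) = `|r|.
Proof. by rewrite /normc/= expr0n/= addr0 sqrtr_sqr. Qed.

Lemma normc_conjc z : normc (conjc z) = normc z.
Proof. by case: z => a b /=; rewrite sqrrN. Qed.

Lemma normc_expi (t : R) : normc (expi t) = 1.
Proof. by rewrite /= cos2Dsin2 sqrtr1. Qed.

Lemma expiD (s t : R) : expi (s + t) = expi s * expi t.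
Proof. by rewrite /expi cosD sinD; apply/eqP; rewrite eq_complex/= eqxx/= addrC [X in _ == X]addrC; apply/eqP; ring. Qed.

Lemma expiN (t : R) : expi (- t) = conjc (expi t).
Proof. by rewrite /expi cosN sinN. Qed.

Lemma expi0 : expi (0 : R) = 1.
Proof. by rewrite /expi cos0 sin0. Qed.

Lemma ReD z w : Re (z + w) = Re z + Re w. Proof. by case: z; case: w. Qed.
Lemma ImD z w : Im (z + w) = Im z + Im w. Proof. by case: z; case: w. Qed.
Lemma ReN z : Re (- z) = - Re z. Proof. by case: z. Qed.
Lemma ImN z : Im (- z) = - Im z. Proof. by case: z. Qed.
Lemma ReM z w : Re (z * w) = Re z * Re w - Im z * Im w. Proof. by case: z; case: w. Qed.
Lemma ImM z w : Im (z * w) = Re z * Im w + Im z * Re w. Proof. by case: z; case: w => a b c d /=; ring. Qed.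
Lemma ReJ z : Re (conjc z) = Re z. Proof. by case: z. Qed.
Lemma ImJ z : Im (conjc z) = - Im z. Proof. by case: z. Qed.
Lemma complex_ext z w : Re z = Re w -> Im z = Im w -> z = w.
Proof. by case: z; case: w => a b c d /= -> ->. Qed.

Section measurability.
Context d (T : measurableType d).
Implicit Types (f g : T -> R[i]).

Lemma cmeasurableD f g : cmeasurable setT f -> cmeasurable setT g -> cmeasurable setT (fun x => f x + g x).
Proof.
move=> [f1 f2] [g1 g2]; split.
- by apply: (eq_measurable_fun (fun x => Re (f x) + Re (g x))); [move=> x _; rewrite ReD|meas].
- by apply: (eq_measurable_fun (fun x => Im (f x) + Im (g x))); [move=> x _; rewrite ImD|meas].
Qed.

Lemma cmeasurableN f : cmeasurable setT f -> cmeasurable setT (fun x => - f x).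
Proof.
move=> [f1 f2]; split.
- by apply: (eq_measurable_fun (fun x => - Re (f x))); [move=> x _; rewrite ReN|meas].
- by apply: (eq_measurable_fun (fun x => - Im (f x))); [move=> x _; rewrite ImN|meas].
Qed.

Lemma cmeasurableB f g : cmeasurable setT f -> cmeasurable setT g -> cmeasurable setT (fun x => f x - g x).
Proof. by move=> mf mg; apply: cmeasurableD => //; exact: cmeasurableN. Qed.

Lemma cmeasurableM f g : cmeasurable setT f -> cmeasurable setT g -> cmeasurable setT (fun x => f x * g x).
Proof.
move=> [f1 f2] [g1 g2]; split.
- by apply: (eq_measurable_fun (fun x => Re (f x) * Re (g x) - Im (f x) * Im (g x))); [move=> x _; rewrite ReM|meas].
- by apply: (eq_measurable_fun (fun x => Re (f x) * Im (g x) + Im (f x) * Re (g x))); [move=> x _; rewrite ImM|meas].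
Qed.

Lemma cmeasurableJ f : cmeasurable setT f -> cmeasurable setT (fun x => conjc (f x)).
Proof.
move=> [f1 f2]; split.
- by apply: (eq_measurable_fun (fun x => Re (f x))); [move=> x _; rewrite ReJ|meas].
- by apply: (eq_measurable_fun (fun x => - Im (f x))); [move=> x _; rewrite ImJ|meas].
Qed.

Lemma cmeasurable_cst (c : R[i]) : cmeasurable setT (fun _ : T => c).
Proof. by split; exact: measurable_cst. Qed.

Lemma cmeasurable_expi (t : T -> R) : measurable_fun setT t -> cmeasurable setT (fun x => expi (t x)).
Proof. by move=> mt; split => /=; meas. Qed.

Lemma measurable_sqrt : measurable_fun [set: R] (@Num.sqrt R).
Proof. by apply: continuous_measurable_fun; exact: sqrt_continuous. Qed.

Lemma measurable_normc f : cmeasurable setT f -> measurable_fun setT (fun x => normc (f x)).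
Proof.
move=> [f1 f2]; rewrite (_ : (fun x => _) = (fun x => Num.sqrt (Re (f x) ^+ 2 + Im (f x) ^+ 2))).
  by apply: (measurableT_comp measurable_sqrt); meas.
by apply/funext => x; rewrite -sqr_normc sqrtr_sqr ger0_norm// normc_ge0.
Qed.

End measurability.

Lemma cmeasurable_comp d d' (T : measurableType d) (U : measurableType d') (f : U -> R[i]) (h : T -> U) :
  measurable_fun setT h -> cmeasurable setT f -> cmeasurable setT (fun x => f (h x)).
Proof. by move=> mh [f1 f2]; split; [exact: (measurableT_comp f1)|exact: (measurableT_comp f2)]. Qed.

End ComplexBasics.

Section Ge0EFin.
Context d (T : measurableType d) (R : realType) (mu : {measure set T -> \bar R}).
Implicit Types (f g : T -> R).

Lemma ge0_integralD_EFin f g : measurable_fun setT f -> measurable_fun setT g ->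
  (forall x, 0 <= f x) -> (forall x, 0 <= g x) ->
  (\int[mu]_x (f x + g x)%:E = \int[mu]_x (f x)%:E + \int[mu]_x (g x)%:E)%E.
Proof.
move=> mf mg f0 g0; under eq_integral do rewrite EFinD.
by rewrite ge0_integralD//; [move=> x _; rewrite lee_fin|exact/measurable_EFinP|move=> x _; rewrite lee_fin|exact/measurable_EFinP].
Qed.

Lemma ge0_integralZ_EFin (k : R) f : 0 <= k -> measurable_fun setT f -> (forall x, 0 <= f x) ->
  (\int[mu]_x (k * f x)%:E = k%:E * \int[mu]_x (f x)%:E)%E.
Proof.
move=> k0 mf f0; under eq_integral do rewrite EFinM.
by rewrite ge0_integralZl_EFin//; [move=> x _; rewrite lee_fin|exact/measurable_EFinP].
Qed.

Lemma ge0_le_integral_EFin f g : measurable_fun setT f -> measurable_fun setT g ->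
  (forall x, 0 <= f x) -> (forall x, f x <= g x) ->
  (\int[mu]_x (f x)%:E <= \int[mu]_x (g x)%:E)%E.
Proof.
move=> mf mg f0 fg; apply: ge0_le_integral => //; [by move=> x _; rewrite lee_fin|exact/measurable_EFinP| exact/measurable_EFinP|].
by move=> x _; rewrite lee_fin.
Qed.

End Ge0EFin.

(** * Complex L^1 and L^2, the Fourier transform and its extension to L^2 *)

Section CL2.
Context (R : realType).
Local Notation mR := (measurableTypeR R).
Local Notation Re := (@complex.Re R).
Local Notation Im := (@complex.Im R).
Implicit Types (f g : mR -> R[i]).

Local Notation L1 := (cLp 1%:E).
Local Notation L2 := (cLp 2%:E).

Lemma cLnorm_sqrt f : cLnorm 2%:E f = sqrte (\int[leb]_x (normc (f x) ^+ 2)%:E)%E.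
Proof.
rewrite /cLnorm unlock /= poweR12_sqrt; last by apply: integral_ge0 => x _; rewrite lee_fin powR_ge0.
by congr sqrte; apply: eq_integral => x _; rewrite ger0_norm ?normc_ge0// powR_mulrn ?normc_ge0.
Qed.

Lemma csq_ge0 f : (0 <= \int[leb]_x (normc (f x) ^+ 2)%:E)%E.
Proof. by apply: integral_ge0 => x _; rewrite lee_fin sqr_ge0. Qed.

Lemma cLnorm2E f : (cLnorm 2%:E f ^+ 2 = \int[leb]_x (normc (f x) ^+ 2)%:E)%E.
Proof. by rewrite cLnorm_sqrt sqr_sqrte// csq_ge0. Qed.

Lemma cL2P f : L2 f <-> cmeasurable setT f /\ leb.-integrable setT (EFin \o (fun x => normc (f x) ^+ 2)).
Proof.
have e : (cLnorm 2%:E f < +oo)%E = (\int[leb]_x (normc (f x) ^+ 2)%:E < +oo)%E.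
  by rewrite cLnorm_sqrt -!ge0_fin_numE ?sqrte_ge0 ?csq_ge0// sqrte_fin_num// csq_ge0.
split => -[mf h]; split => //.
  apply/integrableP; split; first by apply/measurable_EFinP; apply: measurable_funX; exact: measurable_normc.
  by under eq_integral do rewrite gee0_abs ?lee_fin ?sqr_ge0//; rewrite -e.
by rewrite e; have := integrable_lty measurableT h.
Qed.

Lemma cL1P f : L1 f <-> cmeasurable setT f /\ leb.-integrable setT (EFin \o (fun x => normc (f x))).
Proof.
rewrite /cLp /cLnorm Lnorm1; split => -[mf h]; split => //.
  apply/integrableP; split => //; apply/measurable_EFinP; exact: measurable_normc.
by have /integrableP[_] := h.
Qed.

Lemma cLnorm_le f (g : mR -> R) : cmeasurable setT f -> measurable_fun setT g -> (forall x, normc (f x) <= g x) ->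
  (cLnorm 2%:E f <= 'N[leb]_2%:E [EFin \o g])%E.
Proof.
move=> mf mg fg; rewrite cLnorm_sqrt unlock/= poweR12_sqrt; last by apply: integral_ge0 => x _; rewrite lee_fin powR_ge0.
rewrite lee_sqrt; last by apply: integral_ge0 => x _; rewrite lee_fin powR_ge0.
apply: ge0_le_integral => //.
- by move=> x _; rewrite lee_fin sqr_ge0.
- by apply/measurable_EFinP; apply: measurable_funX; exact: measurable_normc.
- apply: (eq_measurable_fun (fun x : mR => (g x ^+ 2)%:E)).
    by move=> x _; rewrite powR_mulrn// real_normK ?num_real.
  by apply/measurable_EFinP; meas.
move=> x _; rewrite lee_fin powR_mulrn// lerXn2r ?nnegrE ?normc_ge0//.
by rewrite (le_trans (fg x))// ler_norm.
Qed.

Lemma cLnorm_triangle f g : cmeasurable setT f -> cmeasurable setT g ->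
  (cLnorm 2%:E (fun x => f x + g x)%R <= cLnorm 2%:E f + cLnorm 2%:E g)%E.
Proof.
move=> mf mg; have nf := measurable_normc mf; have ng := measurable_normc mg.
apply: le_trans (@eminkowski _ _ _ (@lebesgue_measure R) (fun x => normc (f x)) (fun x => normc (g x)) 2%:E nf ng _); last by rewrite lee_fin ler1n.
apply: cLnorm_le; [exact: cmeasurableD|exact: measurable_funD|].
by move=> x; exact: le_normcD.
Qed.

(** A real-valued norm for use with limits and field arithmetic. As [fine] sends [+oo] to 0, it is
    the L^2 norm only for members of L^2. *)
Definition nL2 f : R := fine (cLnorm 2%:E f).

Lemma nL2_ge0 f : 0 <= nL2 f.
Proof. by rewrite fine_ge0// cLnorm_sqrt sqrte_ge0. Qed.

Lemma nL2E f : L2 f -> (nL2 f)%:E = cLnorm 2%:E f.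
Proof. by move=> [_ h]; rewrite fineK// ge0_fin_numE// cLnorm_sqrt sqrte_ge0. Qed.

Lemma nL2_sqr f : L2 f -> nL2 f ^+ 2 = \int[leb]_x (normc (f x) ^+ 2).
Proof.
move=> /[dup] L2f /cL2P[mf i2]; apply: EFin_inj.
rewrite EFin_expe nL2E// cLnorm2E /Rintegral fineK//; exact: integrable_fin_num.
Qed.

Lemma L2D f g : L2 f -> L2 g -> L2 (fun x => f x + g x).
Proof.
move=> [mf hf] [mg hg]; split; first exact: cmeasurableD.
by rewrite (le_lt_trans (cLnorm_triangle mf mg))// lte_add_pinfty.
Qed.

Lemma eq_normc_L2 f g : cmeasurable setT g -> (forall x, normc (g x) = normc (f x)) -> L2 f -> L2 g.
Proof.
by move=> mg fg [_ h]; split => //; rewrite (_ : cLnorm _ g = cLnorm 2%:E f)// /cLnorm; congr Lnorm; apply/funext => x /=; rewrite fg.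
Qed.

Lemma eq_normc_nL2 f g : (forall x, normc (g x) = normc (f x)) -> nL2 g = nL2 f.
Proof. by move=> fg; rewrite /nL2 /cLnorm; congr (fine (Lnorm _ _ _)); apply/funext => x /=; rewrite fg. Qed.

Lemma L2N f : L2 f -> L2 (fun x => - f x).
Proof. by move=> L2f; have [mf _] := L2f; apply: eq_normc_L2 L2f; [exact: cmeasurableN|move=> x; exact: normcN]. Qed.

Lemma L2B f g : L2 f -> L2 g -> L2 (fun x => f x - g x).
Proof. by move=> Lf Lg; apply: L2D => //; exact: L2N. Qed.

Lemma nL2D f g : L2 f -> L2 g -> nL2 (fun x => f x + g x) <= nL2 f + nL2 g.
Proof.
move=> Lf Lg; rewrite -lee_fin EFinD !nL2E//; last exact: L2D.
by case: Lf => mf _; case: Lg => mg _; exact: cLnorm_triangle.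
Qed.

Lemma nL2N f : nL2 (fun x => - f x) = nL2 f.
Proof. by apply: eq_normc_nL2 => x; exact: normcN. Qed.

Lemma nL2_sub f g : L2 f -> L2 g -> `|nL2 f - nL2 g| <= nL2 (fun x => f x - g x).
Proof.
move=> Lf Lg; rewrite ler_norml; apply/andP; split.
  rewrite lerNl opprB lerBlDr.
  have := nL2D (L2B Lg Lf) Lf; rewrite -(nL2N (fun x => g x - f x)).
  rewrite (_ : (fun x => g x - f x + f x) = g); last by apply/funext => x; rewrite subrK.
  by rewrite (_ : (fun x => - (g x - f x)) = (fun x => f x - g x))//; apply/funext => x; rewrite opprB.
rewrite lerBlDr; have := nL2D (L2B Lf Lg) Lg.
by rewrite (_ : (fun x => f x - g x + g x) = f)//; apply/funext => x; rewrite subrK.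
Qed.

Lemma L1D f g : L1 f -> L1 g -> L1 (fun x => f x + g x).
Proof.
move=> /cL1P[mf hf] /cL1P[mg hg]; apply/cL1P; split; first exact: cmeasurableD.
apply: (le_integrableR _ _ (integrableDR hf hg)).
  by apply: measurable_normc; exact: cmeasurableD.
by move=> x; rewrite ger0_norm ?normc_ge0// le_normcD.
Qed.

Lemma L1_bddM f g (M : R) : L1 f -> cmeasurable setT g -> (forall x, normc (g x) <= M) -> L1 (fun x => f x * g x).
Proof.
move=> /cL1P[mf hf] mg gM; apply/cL1P; split; first exact: cmeasurableM.
apply: (le_integrableR _ _ (integrableZrR M hf)).
  by apply: measurable_normc; exact: cmeasurableM.
by move=> x; rewrite ger0_norm ?normc_ge0// normcM ler_wpM2l ?normc_ge0.
Qed.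

Lemma L2_bddM f g (M : R) : L2 f -> cmeasurable setT g -> (forall x, normc (g x) <= M) -> L2 (fun x => f x * g x).
Proof.
move=> /cL2P[mf hf] mg gM; apply/cL2P; split; first exact: cmeasurableM.
apply: (le_integrableR _ _ (integrableZrR (M ^+ 2) hf)).
  by apply: measurable_funX; apply: measurable_normc; exact: cmeasurableM.
move=> x; rewrite ger0_norm ?sqr_ge0// normcM exprMn ler_wpM2l ?sqr_ge0//.
by rewrite lerXn2r ?nnegrE ?normc_ge0 ?(le_trans (normc_ge0 _) (gM x)).
Qed.

Lemma L2M_L1 f g : L2 f -> L2 g -> L1 (fun x => f x * g x).
Proof.
move=> /cL2P[mf hf] /cL2P[mg hg]; apply/cL1P; split; first exact: cmeasurableM.
have h := integrable_mulL2 (measurable_normc mf) (measurable_normc mg) hf hg.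
by apply: eq_integrable h => // x _ /=; rewrite normcM.
Qed.

Lemma L1_Re f : L1 f -> leb.-integrable setT (EFin \o (fun x => Re (f x))).
Proof. by move=> /cL1P[[m1 m2] h]; apply: (le_integrableR _ _ h) => // x; exact: normc_Re. Qed.

Lemma L1_Im f : L1 f -> leb.-integrable setT (EFin \o (fun x => Im (f x))).
Proof. by move=> /cL1P[[m1 m2] h]; apply: (le_integrableR _ _ h) => // x; exact: normc_Im. Qed.

Lemma L2_Re f : L2 f -> leb.-integrable setT (EFin \o (fun x => Re (f x) ^+ 2)).
Proof.
move=> /cL2P[[m1 m2] h]; apply: (le_integrableR _ _ h); first by meas.
by move=> x; rewrite ger0_norm ?sqr_ge0// sqr_normc lerDl sqr_ge0.
Qed.

Lemma L2_Im f : L2 f -> leb.-integrable setT (EFin \o (fun x => Im (f x) ^+ 2)).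
Proof.
move=> /cL2P[[m1 m2] h]; apply: (le_integrableR _ _ h); first by meas.
by move=> x; rewrite ger0_norm ?sqr_ge0// sqr_normc lerDr sqr_ge0.
Qed.


(** The unnormalised convention, so Plancherel carries the factor [2 * pi] and the norm is
    multiplied by its square root. *)
Definition FT f (v : R) : R[i] := cintegral (fun x => f x * expi (- (v * x))).

Lemma FT_Re f v : L1 f -> Re (FT f v) = cosT (fun x => Re (f x)) v + sinT (fun x => Im (f x)) v.
Proof.
move=> L1f; rewrite /FT /cintegral/= /cosT /sinT -RintegralD//.
- by apply: eq_Rintegral => x _; rewrite ReM expiN ReJ ImJ/=; ring.
- exact: integrable_cosT (L1_Re L1f).
- exact: integrable_sinT (L1_Im L1f).
Qed.

Lemma FT_Im f v : L1 f -> Im (FT f v) = cosT (fun x => Im (f x)) v - sinT (fun x => Re (f x)) v.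
Proof.
move=> L1f; rewrite /FT /cintegral/= /cosT /sinT -RintegralB//.
- by apply: eq_Rintegral => x _; rewrite ImM expiN ReJ ImJ/=; ring.
- exact: integrable_cosT (L1_Im L1f).
- exact: integrable_sinT (L1_Re L1f).
Qed.

Lemma cosTN (a : mR -> R) v : cosT a (- v) = cosT a v.
Proof. by apply: eq_Rintegral => x _; rewrite mulNr cosN. Qed.

Lemma sinTN (a : mR -> R) v : leb.-integrable setT (EFin \o a) -> sinT a (- v) = - sinT a v.
Proof.
move=> ia; rewrite /sinT -[RHS]mulN1r -RintegralZl//; last exact: integrable_sinT.
by apply: eq_Rintegral => x _; rewrite mulNr sinN; ring.
Qed.

Opaque cosT sinT FT.

Lemma cmeasurable_FT f : L1 f -> cmeasurable [set: mR] (FT f).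
Proof.
move=> L1f; have [[m1 m2] _] := L1f; split.
- have mC := measurable_cosT m1; have mS := measurable_sinT m2.
  by apply: (eq_measurable_fun (fun v => cosT (fun x => Re (f x)) v + sinT (fun x => Im (f x)) v)); [move=> v _; rewrite FT_Re|meas].
- have mC := measurable_cosT m2; have mS := measurable_sinT m1.
  by apply: (eq_measurable_fun (fun v => cosT (fun x => Im (f x)) v - sinT (fun x => Re (f x)) v)); [move=> v _; rewrite FT_Im|meas].
Qed.

Lemma Rintegral_normc_sqr f : L2 f ->
  \int[leb]_x (normc (f x) ^+ 2) = \int[leb]_x (Re (f x) ^+ 2) + \int[leb]_x (Im (f x) ^+ 2).
Proof.
move=> L2f; rewrite -RintegralD//; [|exact: L2_Re|exact: L2_Im].
by apply: eq_Rintegral => x _; rewrite sqr_normc.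
Qed.

(* The cross terms of the real and imaginary parts are odd in [v], so adding the values at [v] and [- v]
   reduces the claim to the real case. *)
Lemma plancherel_csq f : L1 f -> L2 f ->
  (\int[leb]_v (normc (FT f v) ^+ 2)%:E = (2 * pi * \int[leb]_x (normc (f x) ^+ 2))%:E)%E.
Proof.
move=> L1f L2f; have mF := measurable_normc (cmeasurable_FT L1f).
have [[m1 m2] _] := L1f.
pose X := (\int[leb]_v (normc (FT f v) ^+ 2)%:E)%E; rewrite -/X.
have XN : X = (\int[leb]_v (normc (FT f (- v)) ^+ 2)%:E)%E.
  rewrite /X (ge0_integral_affine (a := -1) 0)//.
  - rewrite normrN normr1 mul1e; apply: eq_integral => v _.
    by rewrite mulN1r addr0.
  - by apply/measurable_EFinP; meas.
  - by move=> v; rewrite lee_fin sqr_ge0.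
have X0 : (0 <= X)%E by exact: csq_ge0.
have mFN : measurable_fun [set: mR] (fun v : mR => normc (FT f (- v))).
  by apply: (measurableT_comp mF); exact: measurable_funN.
have mF2 : measurable_fun [set: mR] (fun v : mR => normc (FT f v) ^+ 2) by meas.
have mFN2 : measurable_fun [set: mR] (fun v : mR => normc (FT f (- v)) ^+ 2) by meas.
have : (X + X = 2%:E * (2 * pi * \int[leb]_x (normc (f x) ^+ 2))%:E)%E.
  rewrite [in X in (_ + X)%E]XN /X -(ge0_integralD_EFin _ mF2 mFN2); try by move=> v; exact: sqr_ge0.
  have mEr := measurable_energyT m1; have mEi := measurable_energyT m2.
  pose er (v : mR) := cosT (fun x => Re (f x)) v ^+ 2 + sinT (fun x => Re (f x)) v ^+ 2.
  pose ei (v : mR) := cosT (fun x => Im (f x)) v ^+ 2 + sinT (fun x => Im (f x)) v ^+ 2.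
  have e0 v : 0 <= er v by rewrite /er addr_ge0 ?sqr_ge0.
  have i0 v : 0 <= ei v by rewrite /ei addr_ge0 ?sqr_ge0.
  rewrite (eq_integral (fun v : mR => (2 * (er v + ei v))%:E)); last first.
    move=> v _; congr EFin; rewrite /er /ei.
    rewrite !sqr_normc (FT_Re v L1f) (FT_Im v L1f) (FT_Re (- v) L1f) (FT_Im (- v) L1f).
    by rewrite !cosTN (sinTN v (L1_Re L1f)) (sinTN v (L1_Im L1f)); ring.
  have Er : (\int[leb]_v (er v)%:E)%E = (2 * pi * \int[leb]_x (Re (f x) ^+ 2))%:E.
    by rewrite -(plancherel_real (L1_Re L1f) (L2_Re L2f)) energyTE.
  have Ei : (\int[leb]_v (ei v)%:E)%E = (2 * pi * \int[leb]_x (Im (f x) ^+ 2))%:E.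
    by rewrite -(plancherel_real (L1_Im L1f) (L2_Im L2f)) energyTE.
  have m : measurable_fun [set: mR] (fun v : mR => er v + ei v) := measurable_funD mEr mEi.
  apply: (etrans (ge0_integralZ_EFin leb (ler0n R 2) m (fun v => addr_ge0 (e0 v) (i0 v)))).
  apply: (congr1 (fun z => 2%:E * z)%E).
  apply: (etrans (ge0_integralD_EFin leb mEr mEi e0 i0)).
  apply: (etrans (congr2 adde Er Ei)).
  rewrite (Rintegral_normc_sqr L2f).
  move: (\int[leb]_x (Re (f x) ^+ 2)) (\int[leb]_x (Im (f x) ^+ 2)) => A B.
  by rewrite (mulrDr _ A B) EFinD.
move: X0; case: X {XN} => [r||]//= _.
by rewrite -EFinD -EFinM => -[h]; congr EFin; lra.
Qed.

Lemma L2_FT f : L1 f -> L2 f -> L2 (FT f).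
Proof.
move=> L1f L2f; apply/cL2P; have mF := cmeasurable_FT L1f; split => //.
apply/integrableP; split; first by apply/measurable_EFinP; apply: measurable_funX; exact: measurable_normc.
under eq_integral do rewrite gee0_abs ?lee_fin ?sqr_ge0//.
by rewrite plancherel_csq// ltry.
Qed.

Lemma nL2_FT f : L1 f -> L2 f -> nL2 (FT f) = Num.sqrt (2 * pi) * nL2 f.
Proof.
move=> L1f L2f; apply: (pexpIrn (n := 2)) => //; rewrite ?nnegrE ?mulr_ge0 ?nL2_ge0//.
rewrite exprMn sqr_sqrtr ?mulr_ge0 ?pi_ge0// !nL2_sqr//; last exact: L2_FT.
by rewrite [LHS]/Rintegral plancherel_csq.
Qed.


(** * Linearity of the complex integral and of the Fourier transform *)

Lemma cintegralD f g : L1 f -> L1 g -> cintegral (fun x => f x + g x) = cintegral f + cintegral g.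
Proof.
move=> L1f L1g; apply: complex_ext; rewrite /cintegral/=.
- rewrite -RintegralD//; [|exact: L1_Re|exact: L1_Re].
  by apply: eq_Rintegral => x _; rewrite ReD.
- rewrite -RintegralD//; [|exact: L1_Im|exact: L1_Im].
  by apply: eq_Rintegral => x _; rewrite ImD.
Qed.

Lemma cintegralZ (c : R[i]) f : L1 f -> cintegral (fun x => c * f x) = c * cintegral f.
Proof.
move=> L1f; have iR := L1_Re L1f; have iI := L1_Im L1f.
apply: complex_ext; rewrite /cintegral ?ReM ?ImM/=.
- rewrite -!RintegralZl// -RintegralB//; [|exact: integrableZlR|exact: integrableZlR].
  by apply: eq_Rintegral => x _; rewrite ReM.
- rewrite -!RintegralZl// -RintegralD//; [|exact: integrableZlR|exact: integrableZlR].
  by apply: eq_Rintegral => x _; rewrite ImM.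
Qed.

Lemma cintegralJ f : L1 f -> cintegral (fun x => conjc (f x)) = conjc (cintegral f).
Proof.
move=> L1f; apply: complex_ext; rewrite /cintegral ?ReJ ?ImJ/=.
- by apply: eq_Rintegral => x _; rewrite ReJ.
- rewrite -mulN1r -RintegralZl//; last exact: L1_Im.
  by apply: eq_Rintegral => x _; rewrite ImJ mulN1r.
Qed.

Lemma eq_cintegral f g : (forall x, f x = g x) -> cintegral f = cintegral g.
Proof. by move=> fg; congr cintegral; apply/funext. Qed.

Lemma L1_expi f (t : mR -> R) : measurable_fun setT t -> L1 f -> L1 (fun x => f x * expi (t x)).
Proof.
by move=> mt L1f; apply: (L1_bddM (M := 1) L1f (cmeasurable_expi mt)) => x; rewrite normc_expi.
Qed.

Lemma L2_expi f (t : mR -> R) : measurable_fun setT t -> L2 f -> L2 (fun x => f x * expi (t x)).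
Proof.
by move=> mt L2f; apply: (L2_bddM (M := 1) L2f (cmeasurable_expi mt)) => x; rewrite normc_expi.
Qed.

Lemma nL2_expi f (t : mR -> R) : nL2 (fun x => f x * expi (t x)) = nL2 f.
Proof. by apply: eq_normc_nL2 => x; rewrite normcM normc_expi mulr1. Qed.

Lemma L2Z (c : R[i]) f : L2 f -> L2 (fun x => c * f x).
Proof.
move=> L2f; have := L2_bddM (M := normc c) L2f (@cmeasurable_cst _ _ mR c) (fun=> lexx _).
by congr (cLp _ _); apply/funext => x; rewrite mulrC.
Qed.

Lemma L1Z (c : R[i]) f : L1 f -> L1 (fun x => c * f x).
Proof.
move=> L1f; have := L1_bddM (M := normc c) L1f (@cmeasurable_cst _ _ mR c) (fun=> lexx _).
by congr (cLp _ _); apply/funext => x; rewrite mulrC.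
Qed.

Lemma nL2Z (c : R[i]) f : L2 f -> nL2 (fun x => c * f x) = normc c * nL2 f.
Proof.
move=> L2f; apply: (pexpIrn (n := 2)) => //; rewrite ?nnegrE ?mulr_ge0 ?nL2_ge0 ?normc_ge0//.
rewrite exprMn !nL2_sqr//; last exact: L2Z.
rewrite -RintegralZl//; last by have /cL2P[] := L2f.
by apply: eq_Rintegral => x _; rewrite normcM exprMn.
Qed.

Let mexp (v : R) : measurable_fun [set: mR] (fun x : mR => - (v * x)).
Proof. by meas. Qed.

Lemma FTE f v : FT f v = cintegral (fun x => f x * expi (- (v * x))).
Proof. by []. Qed.

Lemma FTD f g v : L1 f -> L1 g -> FT (fun x => f x + g x) v = FT f v + FT g v.
Proof.
move=> L1f L1g; rewrite !FTE -cintegralD; [|exact: L1_expi|exact: L1_expi].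
by apply: eq_cintegral => x; rewrite mulrDl.
Qed.

Lemma FTZ c f v : L1 f -> FT (fun x => c * f x) v = c * FT f v.
Proof.
move=> L1f; rewrite !FTE -cintegralZ; last exact: L1_expi.
by apply: eq_cintegral => x; rewrite mulrA.
Qed.

(** The graph of the L^2 extension, in the same shape as [is_saft]. A relation makes no choice of
    representative, so the SAFT and the jointly measurable version in the admissibility condition
    can both be fed into it. *)
Definition isFT f g := L2 g /\ exists fn : nat -> mR -> R[i],
  [/\ forall n, L1 (fn n) /\ L2 (fn n), nL2 (fun x => fn n x - f x) @[n --> \oo] --> 0 &
      nL2 (fun v => FT (fn n) v - g v) @[n --> \oo] --> 0].

Lemma cvg_nL2 (fn : nat -> mR -> R[i]) f : (forall n, L2 (fn n)) -> L2 f ->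
  nL2 (fun x => fn n x - f x) @[n --> \oo] --> 0 -> nL2 (fn n) @[n --> \oo] --> nL2 f.
Proof.
move=> L2n L2f h; apply/cvgrPdist_le => e e0.
have /cvgrPdist_le/(_ e e0) := h; apply: filterS => n.
rewrite sub0r normrN ger0_norm ?nL2_ge0// => h1.
by rewrite distrC (le_trans (nL2_sub (L2n n) L2f)).
Qed.

(** Along the approximating sequence, the norms of the transforms converge to [nL2 g] and also, by
    Plancherel on the intersection of L^1 and L^2, to the right-hand side. *)
Lemma isFT_norm f g : L2 f -> isFT f g -> nL2 g = Num.sqrt (2 * pi) * nL2 f.
Proof.
move=> L2f [L2g [fn [Ln h1 h2]]].
have c1 : nL2 (fn n) @[n --> \oo] --> nL2 f by apply: cvg_nL2 => // n; case: (Ln n).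
have c2 : nL2 (FT (fn n)) @[n --> \oo] --> nL2 g.
  by apply: (cvg_nL2 (fn := fun n => FT (fn n))) => // n; case: (Ln n) => *; exact: L2_FT.
have c3 : nL2 (FT (fn n)) @[n --> \oo] --> Num.sqrt (2 * pi) * nL2 f.
  rewrite (_ : (fun n => _) = (fun n => Num.sqrt (2 * pi) * nL2 (fn n))); last first.
    by apply/funext => n; case: (Ln n) => *; rewrite nL2_FT.
  by apply: cvgM; [exact: cvg_cst|exact: c1].
by rewrite -(cvg_lim _ c2)// -(cvg_lim _ c3).
Qed.

Lemma cvg_nL2D (an bn : nat -> mR -> R[i]) a b : (forall n, L2 (an n)) -> (forall n, L2 (bn n)) -> L2 a -> L2 b ->
  nL2 (fun x => an n x - a x) @[n --> \oo] --> 0 -> nL2 (fun x => bn n x - b x) @[n --> \oo] --> 0 ->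
  nL2 (fun x => (an n x + bn n x) - (a x + b x)) @[n --> \oo] --> 0.
Proof.
move=> La Lb L2a L2b ha hb.
apply: (@squeeze_cvgr _ _ _ _ (fun=> 0) (fun n => nL2 (fun x => an n x - a x) + nL2 (fun x => bn n x - b x))).
- near=> n; rewrite nL2_ge0/=.
  rewrite (_ : (fun x => an n x + bn n x - _) = (fun x => (an n x - a x) + (bn n x - b x))).
    by apply: nL2D; exact: L2B.
  by apply/funext => x; rewrite opprD addrACA.
- exact: cvg_cst.
- by rewrite -(addr0 0); exact: cvgD.
Unshelve. all: by end_near.
Qed.

Lemma cvg_nL2Z c (an : nat -> mR -> R[i]) a : (forall n, L2 (an n)) -> L2 a ->
  nL2 (fun x => an n x - a x) @[n --> \oo] --> 0 -> nL2 (fun x => c * an n x - c * a x) @[n --> \oo] --> 0.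
Proof.
move=> La L2a ha; rewrite (_ : (fun n => _) = (fun n => normc c * nL2 (fun x => an n x - a x))); last first.
  apply/funext => n; rewrite -nL2Z; last exact: L2B.
  by congr nL2; apply/funext => x; rewrite mulrBr.
by rewrite -(mulr0 (normc c)); apply: cvgM; [exact: cvg_cst|].
Qed.

Lemma isFTD f g f' g' : L2 f -> L2 f' -> isFT f g -> isFT f' g' -> isFT (fun x => f x + f' x) (fun v => g v + g' v).
Proof.
move=> L2f L2f' [L2g [fn [Ln h1 h2]]] [L2g' [fn' [Ln' h1' h2']]].
split; first exact: L2D.
exists (fun n x => fn n x + fn' n x); split.
- by move=> n; case: (Ln n) => *; case: (Ln' n) => *; split; [exact: L1D|exact: L2D].
- by apply: cvg_nL2D => // n; [case: (Ln n)|case: (Ln' n)].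
- rewrite (_ : (fun n => _) = (fun n => nL2 (fun v => (FT (fn n) v + FT (fn' n) v) - (g v + g' v)))); last first.
    by apply/funext => n; congr nL2; apply/funext => v; case: (Ln n) => *; case: (Ln' n) => *; rewrite FTD.
  apply: (cvg_nL2D (an := fun n => FT (fn n)) (bn := fun n => FT (fn' n))) => // n.
    by case: (Ln n) => *; exact: L2_FT.
  by case: (Ln' n) => *; exact: L2_FT.
Qed.

Lemma isFTZ c f g : L2 f -> isFT f g -> isFT (fun x => c * f x) (fun v => c * g v).
Proof.
move=> L2f [L2g [fn [Ln h1 h2]]]; split; first exact: L2Z.
exists (fun n x => c * fn n x); split.
- by move=> n; case: (Ln n) => *; split; [exact: L1Z|exact: L2Z].
- by apply: cvg_nL2Z => // n; case: (Ln n).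
- rewrite (_ : (fun n => _) = (fun n => nL2 (fun v => c * FT (fn n) v - c * g v))); last first.
    by apply/funext => n; congr nL2; apply/funext => v; case: (Ln n) => *; rewrite FTZ.
  apply: (@cvg_nL2Z c (fun n => FT (fn n))) => // n.
  by case: (Ln n) => *; exact: L2_FT.
Qed.

Lemma L2J f : L2 f -> L2 (fun x => conjc (f x)).
Proof. by move=> L2f; have [mf _] := L2f; apply: eq_normc_L2 L2f; [exact: cmeasurableJ|move=> x; exact: normc_conjc]. Qed.

Lemma nL2_sqrD f g : L2 f -> L2 g ->
  nL2 (fun x => f x + g x) ^+ 2 = nL2 f ^+ 2 + nL2 g ^+ 2 + 2 * \int[leb]_x (Re (f x * conjc (g x))).
Proof.
move=> L2f L2g; rewrite !nL2_sqr//; last exact: L2D.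
have /cL2P[_ hf] := L2f; have /cL2P[_ hg] := L2g.
have hfg := L1_Re (L2M_L1 L2f (L2J L2g)).
rewrite -RintegralZl// -RintegralD// -RintegralD//; [|exact: integrableDR|exact: integrableZlR].
by apply: eq_Rintegral => x _; rewrite !sqr_normc ReD ImD ReM ReJ ImJ; ring.
Qed.

(** Polarisation: the norm identity for [f + f'], minus those for [f] and [f'], leaves twice the
    real part of the inner product on each side. *)
Lemma isFT_parseval_Re f g f' g' : L2 f -> L2 f' -> isFT f g -> isFT f' g' ->
  \int[leb]_v (Re (g v * conjc (g' v))) = 2 * pi * \int[leb]_x (Re (f x * conjc (f' x))).
Proof.
move=> L2f L2f' h h'; have [L2g _] := h; have [L2g' _] := h'.
have := congr1 (fun z => z ^+ 2) (isFT_norm (L2D L2f L2f') (isFTD L2f L2f' h h')).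
rewrite /= exprMn sqr_sqrtr ?mulr_ge0 ?pi_ge0// !nL2_sqrD//.
rewrite (isFT_norm L2f h) (isFT_norm L2f' h') !exprMn !sqr_sqrtr ?mulr_ge0 ?pi_ge0//.
rewrite !mulrDr => /addrI; rewrite mulrCA => /(mulfI _); apply; rewrite //.
Qed.

(** The imaginary part is the real identity with [f'] and [g'] multiplied by i, because Re (z conj
    (i w)) = Im (z conj w). *)
Lemma isFT_parseval f g f' g' : L2 f -> L2 f' -> isFT f g -> isFT f' g' ->
  cintegral (fun v => g v * conjc (g' v)) = real_complex R (2 * pi) * cintegral (fun x => f x * conjc (f' x)).
Proof.
move=> L2f L2f' h h'; apply: complex_ext; rewrite ?ReM ?ImM /=.
- by rewrite mul0r subr0 (isFT_parseval_Re L2f L2f' h h').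
pose i : R[i] := Complex 0 1.
have := isFT_parseval_Re L2f (L2Z i L2f') h (isFTZ i L2f' h').
rewrite mul0r addr0.
under eq_Rintegral do rewrite ReM ReJ ImJ ReM ImM /= !mul0r !mul1r sub0r add0r.
under [X in _ = _ * X -> _]eq_Rintegral do rewrite ReM ReJ ImJ ReM ImM /= !mul0r !mul1r sub0r add0r.
move=> E.
transitivity (\int[leb]_x (Re (g x) * - Im (g' x) - Im (g x) * - Re (g' x))).
  by apply: eq_Rintegral => x _; rewrite ImM ReJ ImJ; ring.
by rewrite E; congr (_ * _); apply: eq_Rintegral => x _; rewrite ImM ReJ ImJ; ring.
Qed.


(** The weights 4^k leave integrals of order (4/16)^k, so the weighted sum of squared increments is
    integrable, hence a.e. equal to a finite A. Each increment is then at most sqrt A * 2^-k, and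
    the telescoping series converges absolutely. *)
Lemma ae_cvg_fast (h : nat -> mR -> R) (C : R) : (forall k, measurable_fun setT (h k)) ->
  (forall k, (\int[leb]_x ((h k.+1 x - h k x) ^+ 2)%:E <= (C * (16^-1) ^+ k)%:E)%E) ->
  {ae (@lebesgue_measure R), forall x, cvgn (fun k => h k x)}.
Proof.
move=> mh hC.
pose s (x : mR) := (\sum_(k <oo) (4 ^+ k * (h k.+1 x - h k x) ^+ 2)%:E)%E.
have m4 k : measurable_fun setT (fun x : mR => 4 ^+ k * (h k.+1 x - h k x) ^+ 2).
  by have := mh k.+1; have := mh k => m1 m2; meas.
have t0 k x : (0 <= (4 ^+ k * (h k.+1 x - h k x) ^+ 2)%:E)%E.
  by rewrite lee_fin mulr_ge0 ?sqr_ge0// exprn_ge0.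
have ss : (\int[leb]_x s x < +oo)%E.
  rewrite integral_nneseries//; last by move=> k; exact/measurable_EFinP.
  apply: (@le_lt_trans _ _ (\sum_(k <oo) (C * (4^-1) ^+ k)%:E)%E).
    apply: lee_nneseries => [k _ _|k _]; first by apply: integral_ge0 => x _; exact: t0.
    rewrite (@ge0_integralZ_EFin _ _ _ leb); last 3 first.
    - by rewrite ?exprn_ge0.
    - by have := mh k.+1; have := mh k => m1 m2; meas.
    - by move=> x; exact: sqr_ge0.
    apply: le_trans (lee_wpmul2l _ (hC k)) _; first by rewrite lee_fin exprn_ge0.
    rewrite -EFinM lee_fin mulrCA -exprMn.
    by rewrite (_ : 4 * 16^-1 = 4^-1 :> R)//; field.
  have C0 : 0 <= C.
    by have := hC 0%N; rewrite expr0 mulr1 -lee_fin; apply: le_trans; apply: integral_ge0 => x _; rewrite lee_fin sqr_ge0.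
  apply: (@le_lt_trans _ _ (2 * C)%:E); last exact: ltry.
  apply: lime_le; first by apply: is_cvg_nneseries => n _ _; rewrite lee_fin mulr_ge0// exprn_ge0// invr_ge0.
  apply: nearW => n; rewrite sumEFin lee_fin.
  have -> : \sum_(0 <= k < n) (C * 4^-1 ^+ k) = 4 / 3 * C * (1 - 4^-1 ^+ n).
    elim: n => [|n IH]; first by rewrite big_nil expr0 subrr mulr0.
    by rewrite big_nat_recr//= IH exprS; field.
  have : 0 <= 4^-1 ^+ n :> R by rewrite exprn_ge0// invr_ge0.
  by move: (4^-1 ^+ n) => y y0; nra.
have is1 : leb.-integrable setT s.
  apply/integrableP; split.
    by apply: ge0_emeasurable_sum => // k _; exact/measurable_EFinP.
  by under eq_integral do rewrite gee0_abs ?nneseries_ge0//.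
have := integrable_ae measurableT is1.
apply: filterS => x /(_ I) fx.
pose A := fine (s x).
have hA k : 4 ^+ k * (h k.+1 x - h k x) ^+ 2 <= A.
  rewrite -lee_fin fineK//.
  apply: (@le_trans _ _ (\sum_(0 <= i < k.+1) (4 ^+ i * (h i.+1 x - h i x) ^+ 2)%:E)%E); last first.
    by apply: nneseries_lim_ge => i _ _; exact: t0.
  by rewrite big_nat_recr//= leeDr// sume_ge0.
have hd k : `|h k.+1 x - h k x| <= geometric (Num.sqrt A) (2^-1) k.
  rewrite /geometric /= -(ler_pXn2r (n := 2))// ?nnegrE ?mulr_ge0 ?sqrtr_ge0 ?exprn_ge0 ?invr_ge0//.
  rewrite real_normK ?num_real// exprMn sqr_sqrtr; last by apply: le_trans (hA 0%N); rewrite expr0 mul1r sqr_ge0.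
  have <- : 4^-1 ^+ k = 2^-1 ^+ k ^+ 2 :> R by rewrite -exprM mulnC exprM; congr (_ ^+ _); field.
  rewrite exprVn ler_pdivlMr ?exprn_gt0//.
  by rewrite mulrC.
have c1 : cvgn (series (telescope (fun k => h k x))).
  apply: normed_cvg; apply: (@series_le_cvg _ _ (geometric (Num.sqrt A) (2^-1))) => //.
  - by move=> n; exact: normr_ge0.
  - by move=> n; rewrite geometric_ge0// sqrtr_ge0.
  - by apply: is_cvg_geometric_series; rewrite ger0_norm ?invr_ge0// invf_lt1// ltr1n.
rewrite (_ : (fun k => h k x) = (fun k => h 0%N x + series (telescope (fun k => h k x)) k)); last first.
  by apply/funext => k; rewrite -eq_sum_telescope.
by apply: is_cvgD => //; exact: is_cvg_cst.
Qed.

Lemma le_limn_einf (u : nat -> \bar R) (B : \bar R) : (forall n, (u n <= B)%E) -> (limn_einf u <= B)%E.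
Proof.
move=> uB; rewrite limn_einf_lim; apply: lime_le; first exact: is_cvg_einfs.
apply: nearW => n; apply: le_trans (uB n); apply: ereal_inf_lbound; by exists n => /=.
Qed.

(** A limit that is measurable unconditionally: the upper limit always exists, and it is the limit
    wherever the sequence converges. *)
Definition limr (h : nat -> mR -> R) (x : mR) : R := fine (limn_esup (fun k => (h k x)%:E)).

Lemma measurable_limr (h : nat -> mR -> R) : (forall k, measurable_fun setT (h k)) -> measurable_fun setT (limr h).
Proof.
move=> mh; apply: (measurableT_comp (f := fine)) => //.
by apply: measurable_fun_limn_esup => k; exact/measurable_EFinP.
Qed.

Lemma cvg_limr (h : nat -> mR -> R) x : cvgn (fun k => h k x) -> h k x @[k --> \oo] --> limr h x.
Proof.
move=> /cvg_ex[l hl]; have : (h k x)%:E @[k --> \oo] --> l%:E by apply: cvg_EFin => //; near=> k.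
by move=> /cvg_limn_einf_sup[_]; rewrite /limr => ->.
Unshelve. all: by end_near.
Qed.

(** Completeness of L^2 for geometrically Cauchy sequences. The a.e. limits of the real and
    imaginary parts define the candidate, and Fatou's lemma turns the Cauchy estimate into an
    estimate of the distance to it. *)
Lemma riesz_fischer (F : nat -> mR -> R[i]) (C : R) : (forall k, L2 (F k)) ->
  (forall k, nL2 (fun x => F k.+1 x - F k x) <= C * 4^-1 ^+ k) ->
  exists g, L2 g /\ nL2 (fun x => F k x - g x) @[k --> \oo] --> 0.
Proof.
move=> LF hF.
have mF k : cmeasurable setT (F k) by case: (LF k).
have mre k : measurable_fun setT (fun x => Re (F k x)) by case: (mF k).
have mim k : measurable_fun setT (fun x => Im (F k x)) by case: (mF k).
have hsq k : (\int[leb]_x (normc (F k.+1 x - F k x) ^+ 2)%:E <= (C ^+ 2 * 16^-1 ^+ k)%:E)%E.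
  rewrite -cLnorm2E -nL2E; last exact: L2B.
  rewrite -EFin_expe lee_fin (_ : 16^-1 = 4^-1 ^+ 2 :> R); last by field.
  by rewrite -exprM mulnC exprM -exprMn lerXn2r ?nnegrE ?nL2_ge0// (le_trans (nL2_ge0 _) (hF k)).
have cre : {ae (@lebesgue_measure R), forall x, cvgn (fun k => Re (F k x))}.
  apply: (@ae_cvg_fast (fun k x => Re (F k x)) (C ^+ 2)) => // k; apply: le_trans (hsq k).
  apply: ge0_le_integral_EFin.
  - by have := mre k.+1; have := mre k => m1 m2; meas.
  - by apply: measurable_funX; apply: measurable_normc; exact: cmeasurableB.
  - by move=> x; exact: sqr_ge0.
  - by move=> x; rewrite sqr_normc ReD ReN lerDl sqr_ge0.
have cim : {ae (@lebesgue_measure R), forall x, cvgn (fun k => Im (F k x))}.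
  apply: (@ae_cvg_fast (fun k x => Im (F k x)) (C ^+ 2)) => // k; apply: le_trans (hsq k).
  apply: ge0_le_integral_EFin.
  - by have := mim k.+1; have := mim k => m1 m2; meas.
  - by apply: measurable_funX; apply: measurable_normc; exact: cmeasurableB.
  - by move=> x; exact: sqr_ge0.
  - by move=> x; rewrite sqr_normc ImD ImN lerDr sqr_ge0.
pose g (x : mR) : R[i] := Complex (limr (fun k x => Re (F k x)) x) (limr (fun k x => Im (F k x)) x).
have mg : cmeasurable setT g by split; [exact: measurable_limr mre|exact: measurable_limr mim].
have C0 : 0 <= C by have := le_trans (nL2_ge0 _) (hF 0%N); rewrite expr0 mulr1.
(* The factor [1 - 4^-1 ^+ j] is what makes the induction on j close; the geometric sum would allow
   4/3 in place of 2. *)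
have tel k j : nL2 (fun x => F k x - F (k + j)%N x) <= 2 * C * 4^-1 ^+ k * (1 - 4^-1 ^+ j).
  elim: j => [|j IH].
    rewrite addn0 expr0 subrr mulr0 (_ : (fun x => _) = (fun x => 0 * F k x)) ?nL2Z// ?normc0 ?mul0r//.
    by apply/funext => x; rewrite subrr mul0r.
  rewrite addnS (_ : (fun x => _) = (fun x => (F k x - F (k + j)%N x) + - (F (k + j).+1 x - F (k + j)%N x))); last first.
    by apply/funext => x; rewrite opprB addrA subrK.
  apply: le_trans (nL2D _ _) _; [exact: L2B|by apply: L2N; exact: L2B|].
  rewrite nL2N; apply: le_trans (lerD IH (hF _)) _.
  rewrite exprD exprS.
  have : 0 <= C * 4^-1 ^+ k * 4^-1 ^+ j by rewrite !mulr_ge0// exprn_ge0// invr_ge0.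
  by move: (4^-1 ^+ k) (4^-1 ^+ j) => y z; lra.
(* Fatou in j at fixed k: the integrand is the a.e. limit of |F k - F (k + j)|^2, whose integrals
   are bounded by [tel] uniformly in j. *)
have fat k : (\int[leb]_x (normc (F k x - g x) ^+ 2)%:E <= ((2 * C * 4^-1 ^+ k) ^+ 2)%:E)%E.
  have mk : measurable_fun setT (fun x => normc (F k x - g x) ^+ 2).
    by apply: measurable_funX; apply: measurable_normc; exact: cmeasurableB.
  have mkj j : measurable_fun setT (fun x => (normc (F k x - F (k + j)%N x) ^+ 2)%:E).
    by apply/measurable_EFinP; apply: measurable_funX; apply: measurable_normc; exact: cmeasurableB.
  apply: (@le_trans _ _ (\int[leb]_x limn_einf (fun j => (normc (F k x - F (k + j)%N x) ^+ 2)%:E))%E).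
    rewrite le_eqVlt; apply/orP; left; apply/eqP.
    have cinf x : cvgn (fun k => Re (F k x)) -> cvgn (fun k => Im (F k x)) ->
        limn_einf (fun j => (normc (F k x - F (k + j)%N x) ^+ 2)%:E) = (normc (F k x - g x) ^+ 2)%:E.
      move=> /(@cvg_limr (fun k x => Re (F k x))) cr /(@cvg_limr (fun k x => Im (F k x))) ci.
      have : (normc (F k x - F (k + j)%N x) ^+ 2)%:E @[j --> \oo] --> (normc (F k x - g x) ^+ 2)%:E.
        apply: cvg_EFin; first by near=> n.
        rewrite sqr_normc ReD ReN ImD ImN /=.
        under eq_fun do rewrite sqr_normc ReD ReN ImD ImN.
        have cr' : Re (F (k + j)%N x) @[j --> \oo] --> limr (fun k x => Re (F k x)) x.
          by under eq_fun do rewrite addnC; move: cr; rewrite -(cvg_shiftn k).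
        have ci' : Im (F (k + j)%N x) @[j --> \oo] --> limr (fun k x => Im (F k x)) x.
          by under eq_fun do rewrite addnC; move: ci; rewrite -(cvg_shiftn k).
        by apply: cvgD; rewrite !expr2; apply: cvgM; apply: cvgB => //; exact: cvg_cst.
      by move=> /cvg_limn_einf_sup[].
    apply: ae_eq_integral => //.
    - exact/measurable_EFinP.
    - apply: (eq_measurable_fun (fun x => (- limn_esup (fun j => - (normc (F k x - F (k + j)%N x) ^+ 2)%:E))%E)).
        by move=> x _; rewrite -limn_einfN; congr limn_einf; apply/funext => j; rewrite /= opprK.
      by apply: measurableT_comp => //; apply: measurable_fun_limn_esup => j; apply: measurableT_comp.
    - by apply: (@filterS2 _ _ _ _ _ _ _ cre cim) => x cr ci _; rewrite cinf.
  apply: le_trans (fatou _ _ _ _) _ => //.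
    by move=> n x _; rewrite lee_fin sqr_ge0.
  apply: le_limn_einf => j; rewrite -cLnorm2E -nL2E; last exact: L2B.
  rewrite -EFin_expe lee_fin lerXn2r ?nnegrE ?nL2_ge0//.
    by rewrite !mulr_ge0// exprn_ge0// invr_ge0.
  apply: le_trans (tel k j) _; rewrite ler_piMr//.
    by rewrite !mulr_ge0// exprn_ge0// invr_ge0.
have LFg k : L2 (fun x => F k x - g x).
  apply/cL2P; split; first exact: cmeasurableB.
  apply/integrableP; split.
    by apply/measurable_EFinP; apply: measurable_funX; apply: measurable_normc; exact: cmeasurableB.
  under eq_integral do rewrite gee0_abs ?lee_fin ?sqr_ge0//.
  by apply: (le_lt_trans (fat k)); exact: ltry.
exists g; split.
  have := L2B (LF 0%N) (LFg 0%N); congr (cLp _ _); apply/funext => x.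
  by rewrite opprB addrCA subrr addr0.
apply: (@squeeze_cvgr _ _ _ _ (fun=> 0) (fun k => 2 * C * 4^-1 ^+ k)).
- near=> k; rewrite nL2_ge0/= -(ler_pXn2r (n := 2))// ?nnegrE ?nL2_ge0//.
    by rewrite -lee_fin EFin_expe nL2E// cLnorm2E.
  by rewrite !mulr_ge0// exprn_ge0// invr_ge0.
- exact: cvg_cst.
- have := @cvg_geometric R (2 * C) (4^-1); apply.
  by rewrite ger0_norm ?invr_ge0// invf_lt1// ltr1n.
Unshelve. all: by end_near.
Qed.

(** Truncation to [-n, n] suffices: the product of [f] with an indicator of finite measure is a
    product of two L^2 functions, hence in L^1. *)
Lemma L1_L2_dense f (e : R) : 0 < e -> L2 f -> exists u, [/\ L1 u, L2 u & nL2 (fun x => u x - f x) <= e].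
Proof.
move=> e0 L2f; have /cL2P[mf i2] := L2f.
pose ind (n : nat) (x : mR) : R := \1_(`[- n%:R, n%:R]%classic : set mR) x.
have iE n x : ind n x = if `|x| <= n%:R then 1 else 0.
  by rewrite ler_norml -(cutE _ (cst 1)) /cut mulr1.
have mi n : cmeasurable setT (fun x : mR => real_complex R (ind n x)).
  by split => //=; apply: measurable_indic.
have L2i n : L2 (fun x : mR => real_complex R (ind n x)).
  apply/cL2P; split => //; apply: (eq_integrable _ (EFin \o ind n)) => //; last exact: integrable_cut1.
  by move=> x _; rewrite [LHS]/= [RHS]/comp normc_real iE; case: ifP; rewrite ?normr1 ?normr0 ?expr1n ?expr0n.
have L1u n := L2M_L1 L2f (L2i n).
have L2u n : L2 (fun x => f x * real_complex R (ind n x)).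
  apply: (@L2_bddM _ _ 1) => // x; rewrite normc_real iE; case: ifP; rewrite ?normr1 ?normr0//.
have tE n x : normc (f x * real_complex R (ind n x) - f x) ^+ 2 = if `|x| <= n%:R then 0 else normc (f x) ^+ 2.
  rewrite iE; case: ifP => _.
    by rewrite (_ : real_complex R 1 = 1)// mulr1 subrr normc0 expr0n.
  by rewrite (_ : real_complex R 0 = 0)// mulr0 sub0r normcN.
have [] := @dominated_convergence _ _ _ leb setT measurableT
  (fun n x => (normc (f x * real_complex R (ind n x) - f x) ^+ 2)%:E) (cst 0%E)
  (fun x => (normc (f x) ^+ 2)%:E).
- move=> n; apply/measurable_EFinP; apply: measurable_funX; apply: measurable_normc.
  by apply: cmeasurableB => //; exact: cmeasurableM.
- exact: measurable_cst.
- apply: aeW => x _; apply: cvg_EFin; first by near=> n.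
  apply: cvg_near_cst; near=> n; rewrite /= tE ifT//.
  by near: n; exact: nbhs_infty_ger.
- exact: i2.
- apply: aeW => x n _; rewrite lee_fin tE; case: ifP => _; last by rewrite ger0_norm ?sqr_ge0.
  by rewrite normr0 sqr_ge0.
move=> _ _; rewrite integral0 => /fine_cvgP[_ /cvgrPdist_le/(_ (e ^+ 2))[]]; first by rewrite exprn_gt0.
move=> n _ /(_ n (leqnn n)) /=; rewrite sub0r normrN => hn.
exists (fun x => f x * real_complex R (ind n x)); split => //.
rewrite -(ler_pXn2r (n := 2))// ?nnegrE ?nL2_ge0 ?(ltW e0)// nL2_sqr; last exact: L2B.
by apply: le_trans (ler_norm _) _.
Unshelve. all: by end_near.
Qed.

(** Approximants with error 4^-k have consecutive differences of norm at most 2 * 4^-k; Plancherel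
    multiplies this by sqrt (2 pi), so their transforms satisfy the hypothesis of
    [riesz_fischer]. *)
Lemma isFT_exists f : L2 f -> exists g, isFT f g.
Proof.
move=> L2f.
have /choice[u hu] : forall k, exists u, [/\ L1 u, L2 u & nL2 (fun x => u x - f x) <= 4^-1 ^+ k].
  by move=> k; apply: L1_L2_dense => //; rewrite exprn_gt0// invr_gt0.
have [||g [Lg hg]] := @riesz_fischer (fun k => FT (u k)) (Num.sqrt (2 * pi) * 2).
- by move=> k; case: (hu k) => *; exact: L2_FT.
- move=> k; have [L1a L2a ha] := hu k; have [L1b L2b hb] := hu k.+1.
  rewrite (_ : (fun x => _) = FT (fun x => u k.+1 x + -1 * u k x)); last first.
    by apply/funext => v; rewrite FTD// ?FTZ// ?mulN1r//; exact: L1Z.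
  rewrite nL2_FT; [|by apply: L1D => //; exact: L1Z|by apply: L2D => //; exact: L2Z].
  rewrite -mulrA ler_wpM2l ?sqrtr_ge0//.
  rewrite (_ : (fun x => _) = (fun x => (u k.+1 x - f x) + - (u k x - f x))); last first.
    by apply/funext => x; rewrite mulN1r opprB addrA subrK.
  apply: le_trans (nL2D _ _) _; [exact: L2B|by apply: L2N; exact: L2B|].
  rewrite nL2N; apply: le_trans (lerD hb ha) _.
  have : 0 <= 4^-1 ^+ k :> R by rewrite exprn_ge0// invr_ge0.
  by rewrite exprS; move: (4^-1 ^+ k) => y; lra.
exists g; split => //; exists u; split => //.
- by move=> n; case: (hu n).
- apply: (@squeeze_cvgr _ _ _ _ (fun=> 0) (fun k => 4^-1 ^+ k)).
  + by near=> k; rewrite nL2_ge0/=; case: (hu k).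
  + exact: cvg_cst.
  + by apply: cvg_expr; rewrite ger0_norm ?invr_ge0// invf_lt1// ltr1n.
Unshelve. all: by end_near.
Qed.

End CL2.

(** * The SAFT as a chirped Fourier transform *)

Section Saft.
Context (R : realType).
Local Notation mR := (measurableTypeR R).
Local Notation Re := (@complex.Re R).
Local Notation Im := (@complex.Im R).
Implicit Types (f g : mR -> R[i]).

Local Notation L1 := (cLp 1%:E).
Local Notation L2 := (cLp 2%:E).

Lemma expiNK (t : R) : expi (- t) * expi t = 1 :> R[i].
Proof. by rewrite -expiD addNr expi0. Qed.

Lemma conjcM (z w : R[i]) : conjc (z * w) = conjc z * conjc w.
Proof. exact: rmorphM. Qed.

Lemma conjcB (z w : R[i]) : conjc (z - w) = conjc z - conjc w.
Proof. exact: rmorphB. Qed.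

Lemma cmeasurable_affine (a b : R) f : cmeasurable setT f -> cmeasurable setT (fun x : mR => f (a * x + b)).
Proof. by move=> mf; apply: cmeasurable_comp; [exact: measurable_affine|exact: mf]. Qed.

Lemma L1J f : L1 f -> L1 (fun x => conjc (f x)).
Proof.
move=> /cL1P[mf hf]; apply/cL1P; split; first exact: cmeasurableJ.
by apply: eq_integrable hf => // x _; rewrite [RHS]/= normc_conjc.
Qed.

Lemma L1_affine (a b : R) f : a != 0 -> L1 f -> L1 (fun x : mR => f (a * x + b)).
Proof.
move=> a0 /cL1P[mf h]; apply/cL1P; split; first exact: cmeasurable_affine.
exact: (integrable_affine b a0 h).
Qed.

Lemma cintegral_affine (a b : R) f : a != 0 -> L1 f ->
  cintegral f = real_complex R `|a| * cintegral (fun x : mR => f (a * x + b)).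
Proof.
move=> a0 L1f; apply: complex_ext; rewrite ?ReM ?ImM /cintegral/= ?mul0r ?subr0 ?addr0.
- by rewrite -(Rintegral_affine b a0 (L1_Re L1f)).
- by rewrite -(Rintegral_affine b a0 (L1_Im L1f)).
Qed.

(** Dilations, reflections and the passages [unsaft] and [resaft] all have this form: an affine
    substitution times a factor of constant modulus. Such an operator multiplies the norm by a
    constant and so preserves L^2 limits. *)
Lemma L2_wcomp_affine (m : mR -> R[i]) (mu a b : R) f : a != 0 -> cmeasurable setT m -> (forall v, normc (m v) = mu) ->
  L2 f -> L2 (fun v : mR => m v * f (a * v + b)).
Proof.
move=> a0 mm hm /cL2P[mf i2]; apply/cL2P; split.
  by apply: cmeasurableM => //; exact: cmeasurable_affine.
apply: eq_integrable (integrableZlR (mu ^+ 2) (integrable_affine b a0 i2)) => // x _.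
by rewrite /= normcM hm exprMn.
Qed.

Lemma nL2_wcomp_affine (m : mR -> R[i]) (mu a b : R) f : a != 0 -> cmeasurable setT m -> (forall v, normc (m v) = mu) ->
  L2 f -> nL2 (fun v : mR => m v * f (a * v + b)) = mu / Num.sqrt `|a| * nL2 f.
Proof.
move=> a0 mm hm L2f; have mu0 : 0 <= mu by rewrite -(hm 0) normc_ge0.
have sa : 0 < `|a| by rewrite normr_gt0.
apply: (pexpIrn (n := 2)) => //; rewrite ?nnegrE ?mulr_ge0 ?nL2_ge0 ?invr_ge0 ?sqrtr_ge0//.
rewrite !exprMn exprVn sqr_sqrtr ?(ltW sa)// !nL2_sqr//; last exact: (L2_wcomp_affine b a0 mm hm).
have /cL2P[mf i2] := L2f.
rewrite (Rintegral_affine b a0 i2) -mulrA mulKf ?gt_eqF// -RintegralZl//; last exact: (integrable_affine b a0 i2).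
by apply: eq_Rintegral => x _; rewrite normcM hm exprMn.
Qed.

Lemma cvg_cLnorm (u : nat -> mR -> R[i]) : (forall n, L2 (u n)) ->
  (cLnorm 2%:E (u n) @[n --> \oo] --> 0%E) <-> (nL2 (u n) @[n --> \oo] --> 0).
Proof.
move=> Lu; split => [/fine_cvgP[]//|h].
rewrite (_ : (fun n => _) = (fun n => (nL2 (u n))%:E)); first by apply: cvg_EFin => //; near=> n.
by apply/funext => n; rewrite nL2E.
Unshelve. all: by end_near.
Qed.

Lemma nL2_ae_eq f g : L2 f -> cmeasurable setT g -> {ae (@lebesgue_measure R), forall x, f x = g x} ->
  L2 g /\ nL2 g = nL2 f.
Proof.
move=> [mf lf] mg fg.
have e : cLnorm 2%:E g = cLnorm 2%:E f.
  rewrite !cLnorm_sqrt; congr sqrte; apply: ae_eq_integral => //.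
  - by apply/measurable_EFinP; apply: measurable_funX; apply: measurable_normc.
  - by apply/measurable_EFinP; apply: measurable_funX; apply: measurable_normc.
  - by apply: filterS fg => x -> _.
by split; [split => //; rewrite e|rewrite /nL2 e].
Qed.

Lemma isFT_ae f g g' : isFT f g -> cmeasurable setT g' -> {ae (@lebesgue_measure R), forall x, g x = g' x} -> isFT f g'.
Proof.
move=> [L2g [fn [Ln h1 h2]]] mg' gg'; have [L2g' _] := nL2_ae_eq L2g mg' gg'.
split => //; exists fn; split => //.
rewrite (_ : (fun n => _) = (fun n => nL2 (fun v => FT (fn n) v - g v)))//.
apply/funext => n; have [L1n L2n] := Ln n; have LF := L2_FT L1n L2n.
have [|//|_ ->//] := @nL2_ae_eq (fun v => FT (fn n) v - g v) (fun v => FT (fn n) v - g' v) (L2B LF L2g).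
  by apply: cmeasurableB => //; case: LF.
by apply: filterS gg' => x ->.
Qed.

(** For integrable functions this is a substitution; both sides scale norms by constants, so the
    rule passes to the L^2 limit. It puts the reflected and dilated wavelet into a form to which
    Parseval applies. *)
Lemma isFT_flip f g (t z : R) : 0 < z -> L2 f -> isFT f g ->
  isFT (fun x => conjc (f ((t - x) / z))) (fun v => real_complex R z * expi (- (t * v)) * conjc (g (z * v))).
Proof.
move=> z0 L2f [L2g [fn [Ln h1 h2]]].
have zn0 : z != 0 by rewrite gt_eqF.
have a0 : - z^-1 != 0 by rewrite oppr_eq0 invr_eq0.
have aE x : (t - x) / z = - z^-1 * x + t / z by field.
have m1 : cmeasurable setT (fun _ : mR => 1 : R[i]) by exact: cmeasurable_cst.
have n1 (v : mR) : normc (1 : R[i]) = 1 by rewrite normc1.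
have L1c h : L1 h -> L1 (fun x => conjc (h ((t - x) / z))).
  move=> L1h; have := L1J (L1_affine (t / z) a0 L1h); congr (cLp _ _).
  by apply/funext => x; rewrite aE.
have nc h : L2 h -> L2 (fun x => conjc (h ((t - x) / z))) /\
    nL2 (fun x => conjc (h ((t - x) / z))) = 1 / Num.sqrt `|- z^-1| * nL2 h.
  move=> L2h; have := L2_wcomp_affine (t / z) a0 m1 n1 L2h => L2h'.
  have E : (fun x => conjc (h ((t - x) / z))) = (fun x => conjc (1 * h (- z^-1 * x + t / z))).
    by apply/funext => x; rewrite aE mul1r.
  rewrite E; split; first exact: L2J.
  rewrite -(nL2_wcomp_affine (t / z) a0 m1 n1 L2h); apply: eq_normc_nL2 => x; exact: normc_conjc.
have mm : cmeasurable setT (fun v : mR => real_complex R z * expi (- (t * v))).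
  by apply: cmeasurableM; [exact: cmeasurable_cst|apply: cmeasurable_expi; meas].
have nm (v : mR) : normc (real_complex R z * expi (- (t * v))) = z.
  by rewrite normcM normc_expi mulr1 normc_real gtr0_norm.
have nd h : L2 h -> L2 (fun v : mR => real_complex R z * expi (- (t * v)) * conjc (h (z * v))) /\
    nL2 (fun v => real_complex R z * expi (- (t * v)) * conjc (h (z * v))) = z / Num.sqrt `|z| * nL2 h.
  move=> L2h; have L2h' := L2J L2h.
  have E : (fun v : mR => real_complex R z * expi (- (t * v)) * conjc (h (z * v)))
         = (fun v : mR => real_complex R z * expi (- (t * v)) * conjc (h (z * v + 0))).
    by apply/funext => v; rewrite addr0.
  rewrite E; split; first exact: (L2_wcomp_affine 0 zn0 mm nm L2h').
  rewrite (nL2_wcomp_affine 0 zn0 mm nm L2h'); congr (_ * _); apply: eq_normc_nL2 => x; exact: normc_conjc.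
split; first by case: (nd g L2g).
exists (fun n x => conjc (fn n ((t - x) / z))); split.
- by move=> n; have [L1n L2n] := Ln n; split; [exact: L1c|case: (nc _ L2n)].
- rewrite (_ : (fun n => _) = (fun n => 1 / Num.sqrt `|- z^-1| * nL2 (fun x => fn n x - f x))).
    by rewrite -(mulr0 (1 / Num.sqrt `|- z^-1|)); apply: cvgM; [exact: cvg_cst|].
  apply/funext => n; have [L1n L2n] := Ln n.
  have [_ <-] := nc _ (L2B L2n L2f).
  by congr nL2; apply/funext => x; rewrite conjcB.
- rewrite (_ : (fun n => _) = (fun n => z / Num.sqrt `|z| * nL2 (fun v => FT (fn n) v - g v))).
    by rewrite -(mulr0 (z / Num.sqrt `|z|)); apply: cvgM; [exact: cvg_cst|].
  apply/funext => n; have [L1n L2n] := Ln n.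
  have [_ <-] := nd _ (L2B (L2_FT L1n L2n) L2g).
  congr nL2; apply/funext => v; rewrite conjcB mulrBr; congr (_ - _).
  have L1e : L1 (fun x => conjc (fn n ((t - x) / z)) * expi (- (v * x))).
    by apply: L1_expi; [meas|exact: L1c].
  have L1f : L1 (fun y : mR => fn n y * expi (- (z * v * y))) by apply: L1_expi => //; meas.
  (* The substitution x = t - z y, whose Jacobian supplies the factor z. *)
  rewrite !FTE (@cintegral_affine (- z) t _ _ L1e) ?oppr_eq0// normrN gtr0_norm// -mulrA; congr (_ * _).
  rewrite -cintegralJ// -cintegralZ; last exact: L1J.
  apply: eq_cintegral => y; rewrite conjcM -expiN opprK mulrCA -expiD; congr (_ * _).
    by congr (conjc (fn n _)); field.
  by congr expi; ring.
Qed.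

(** * Passing between the SAFT of a function and the Fourier transform of its chirped version *)

Section SaftFourier.
Variables (L : saft_param R) (hB : sB L != 0).

Definition chirp (x : mR) : R[i] := expi ((sA L * x ^+ 2 + 2 * sp L * x) / (2 * sB L)).

Definition phase (w : mR) : R[i] := expi ((- 2 * w * (sD L * sp L - sB L * sq L) + sD L * w ^+ 2) / (2 * sB L)).

Lemma KB_neq0 : KB L != 0.
Proof.
rewrite invr_eq0 sqrtc_eq0; apply/eqP => /(congr1 Re)/= /eqP.
by rewrite !mulf_eq0 pnatr_eq0 (gt_eqF (pi_gt0 R)) (negbTE hB).
Qed.

(** Squaring removes the complex square root, so the sign of [sB L] no longer matters. *)
Lemma sqr_normc_KB : normc (KB L) ^+ 2 = (2 * pi * `|sB L|)^-1.
Proof.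
rewrite normcV exprVn; congr (_^-1).
rewrite expr2 -normcM -expr2 sqr_sqrtc normc_real !normrM normr_nat ger0_norm//.
exact: pi_ge0.
Qed.

Lemma cmeasurable_chirp : cmeasurable setT chirp.
Proof. by apply: cmeasurable_expi; meas. Qed.

Lemma cmeasurable_phase : cmeasurable setT phase.
Proof. by apply: cmeasurable_expi; meas. Qed.

Lemma normc_chirp x : normc (chirp x) = 1. Proof. exact: normc_expi. Qed.

Lemma normc_phase x : normc (phase x) = 1. Proof. exact: normc_expi. Qed.

Lemma conjc_mul_expi (t : R) : conjc (expi t) * expi t = 1 :> R[i].
Proof. by rewrite -expiN expiNK. Qed.

Lemma L1_chirp f : L1 f -> L1 (fun x => f x * chirp x).
Proof. by move=> Lf; apply: L1_expi => //; meas. Qed.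

Lemma L2_chirp f : L2 f -> L2 (fun x => f x * chirp x).
Proof. by move=> Lf; apply: L2_expi => //; meas. Qed.

(** The exponent of the kernel is a sum of three parts: one in x alone ([chirp]), one in w alone
    ([phase]), and the bilinear term - x w / B, which is the Fourier kernel at frequency w / B. *)
Lemma saft_integralE f w : L1 f ->
  saft_integral L f w = conjc (KB L) * phase w * FT (fun x => f x * chirp x) (w / sB L).
Proof.
move=> L1f; rewrite FTE -cintegralZ; last by apply: L1_expi; [meas|exact: L1_chirp].
apply: eq_cintegral => x; rewrite /saft_kernel mulrCA -!mulrA; congr (_ * _).
rewrite [in RHS]mulrCA; congr (_ * _); rewrite -!expiD; congr expi.
by field.
Qed.

(* The Fourier transform of [f * chirp] expressed by the SAFT [g] of [f]. *)
Definition unsaft g (v : mR) : R[i] := (conjc (KB L))^-1 * conjc (phase (sB L * v)) * g (sB L * v).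

Definition resaft g (w : mR) : R[i] := conjc (KB L) * phase w * g (w / sB L).

Lemma conjKB_neq0 : conjc (KB L) != 0.
Proof. by rewrite conjc_eq0 KB_neq0. Qed.

Lemma L2_unsaft g : L2 g -> L2 (unsaft g) /\
  nL2 (unsaft g) = (normc (KB L))^-1 / Num.sqrt `|sB L| * nL2 g.
Proof.
move=> L2g.
have mm : cmeasurable setT (fun v : mR => (conjc (KB L))^-1 * conjc (phase (sB L * v))).
  apply: cmeasurableM; first exact: cmeasurable_cst.
  by apply: cmeasurableJ; apply: (@cmeasurable_comp _ _ _ _ _ phase); [meas|exact: cmeasurable_phase].
have nm (v : mR) : normc ((conjc (KB L))^-1 * conjc (phase (sB L * v))) = (normc (KB L))^-1.
  by rewrite normcM normcV normc_conjc normc_conjc normc_phase mulr1.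
have := L2_wcomp_affine 0 hB mm nm L2g; have := nL2_wcomp_affine 0 hB mm nm L2g.
by under eq_fun do rewrite addr0.
Qed.

Lemma L2_resaft g : L2 g -> L2 (resaft g) /\
  nL2 (resaft g) = normc (KB L) / Num.sqrt `|(sB L)^-1| * nL2 g.
Proof.
move=> L2g.
have mm : cmeasurable setT (fun v : mR => conjc (KB L) * phase v).
  by apply: cmeasurableM; [exact: cmeasurable_cst|exact: cmeasurable_phase].
have nm (v : mR) : normc (conjc (KB L) * phase v) = normc (KB L).
  by rewrite normcM normc_conjc normc_phase mulr1.
have b0 : (sB L)^-1 != 0 by rewrite invr_eq0.
have := L2_wcomp_affine 0 b0 mm nm L2g; have := nL2_wcomp_affine 0 b0 mm nm L2g.
rewrite (_ : (fun v : mR => conjc (KB L) * phase v * g ((sB L)^-1 * v + 0)) = resaft g)//.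
by apply/funext => v; rewrite addr0 [in LHS](mulrC _ v).
Qed.

Lemma unsaftB g g' v : unsaft g v - unsaft g' v = unsaft (fun w => g w - g' w) v.
Proof. by rewrite /unsaft mulrBr. Qed.

Lemma resaftB g g' v : resaft g v - resaft g' v = resaft (fun w => g w - g' w) v.
Proof. by rewrite /resaft mulrBr. Qed.

Lemma saft_integral_resaft f : L1 f -> saft_integral L f = resaft (FT (fun x => f x * chirp x)).
Proof. by move=> L1f; apply/funext => w; exact: saft_integralE. Qed.

Lemma resaftK g v : unsaft (resaft g) v = g v.
Proof.
rewrite /unsaft /resaft (mulrC (sB L)) mulfK// -!mulrA (mulrCA (conjc (phase _))).
by rewrite mulKf ?conjKB_neq0// mulrA conjc_mul_expi mul1r.
Qed.

Lemma chirpK (x : mR) : conjc (chirp x) * chirp x = 1.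
Proof. exact: conjc_mul_expi. Qed.

Lemma cvg_nL2_factor (c : R) (u w : nat -> mR -> R[i]) : (forall n, nL2 (u n) = c * nL2 (w n)) ->
  nL2 (w n) @[n --> \oo] --> 0 -> nL2 (u n) @[n --> \oo] --> 0.
Proof.
move=> uw h; rewrite (_ : (fun n => _) = (fun n => c * nL2 (w n))); last exact/funext.
by rewrite -(mulr0 c); apply: cvgM; [exact: cvg_cst|].
Qed.

Lemma is_saft_isFT f g : L2 f -> is_saft L f g -> isFT (fun x => f x * chirp x) (unsaft g).
Proof.
move=> L2f [L2g [fn [Ln h1 h2]]]; have [L2u _] := L2_unsaft L2g.
have LB n : L2 (fun x => fn n x - f x) by case: (Ln n) => _ L2n; exact: L2B.
have LF n : L2 (fun w => saft_integral L (fn n) w - g w).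
  case: (Ln n) => L1n L2n; apply: L2B => //; rewrite saft_integral_resaft//.
  by have [] := L2_resaft (L2_FT (L1_chirp L1n) (L2_chirp L2n)).
split => //; exists (fun n x => fn n x * chirp x); split.
- by move=> n; case: (Ln n) => *; split; [exact: L1_chirp|exact: L2_chirp].
- move/cvg_cLnorm: h1 => /(_ LB); apply: (cvg_nL2_factor (c := 1)) => n.
  by rewrite mul1r; apply: eq_normc_nL2 => x; rewrite -mulrBl normcM normc_chirp mulr1.
- move/cvg_cLnorm: h2 => /(_ LF); apply: (cvg_nL2_factor (c := (normc (KB L))^-1 / Num.sqrt `|sB L|)) => n.
  have [_ <-] := L2_unsaft (LF n); congr nL2; apply/funext => v.
  case: (Ln n) => L1n L2n; rewrite -unsaftB; congr (_ - _).
  by rewrite saft_integral_resaft// resaftK.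
Qed.

(** [saft] is defined by [xget], so this existence result is what guarantees that it satisfies
    [is_saft]. Approximants for the chirped function are divided by the chirp, and their transforms
    are carried back by [resaft]. *)
Lemma saft_exists f : L2 f -> exists g, is_saft L f g.
Proof.
move=> L2f; have [G [L2G [Fn [Ln h1 h2]]]] := isFT_exists (L2_chirp L2f).
have [L2r _] := L2_resaft L2G.
pose fn n x := Fn n x * conjc (chirp x).
have mJ : cmeasurable setT (fun x => conjc (chirp x)) by apply: cmeasurableJ; exact: cmeasurable_chirp.
have nJ x : normc (conjc (chirp x)) <= 1 by rewrite normc_conjc normc_chirp.
have L1n n : L1 (fn n) by case: (Ln n) => L1n _; exact: L1_bddM L1n mJ nJ.
have L2n n : L2 (fn n) by case: (Ln n) => _ L2n; exact: L2_bddM L2n mJ nJ.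
have FE n : (fun x => fn n x * chirp x) = Fn n by apply/funext => x; rewrite -mulrA chirpK mulr1.
have SE n : saft_integral L (fn n) = resaft (FT (Fn n)) by rewrite saft_integral_resaft// FE.
have LFT n : L2 (FT (Fn n)) by case: (Ln n) => *; exact: L2_FT.
exists (resaft G); split => //; exists fn; split => //.
- apply/cvg_cLnorm; first by move=> n; exact: L2B.
  apply: (cvg_nL2_factor (c := 1)) h1 => n; rewrite mul1r; apply: eq_normc_nL2 => x.
  rewrite (_ : fn n x - f x = (Fn n x - f x * chirp x) * conjc (chirp x)).
    by rewrite normcM normc_conjc normc_chirp mulr1.
  by rewrite mulrBl -mulrA (mulrC (chirp x)) chirpK mulr1.
- apply/cvg_cLnorm; first by move=> n; rewrite SE; apply: L2B => //; case: (L2_resaft (LFT n)).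
  move: h2; apply: (cvg_nL2_factor (c := normc (KB L) / Num.sqrt `|(sB L)^-1|)) => n; have [_ <-] := L2_resaft (L2B (LFT n) L2G).
  by congr nL2; apply/funext => v; rewrite SE resaftB.
Qed.

Lemma saftP f : L2 f -> is_saft L f (saft L f).
Proof. by move=> /saft_exists h; exact: (xgetPex (fun=> 0) h). Qed.

End SaftFourier.
End Saft.

(** * The uncertainty principle for kernels *)

Section Uncertainty.
Context (R : realType).
Local Notation mR := (measurableTypeR R).
Local Notation Re := (@complex.Re R).
Local Notation Im := (@complex.Im R).

Local Notation L1 := (cLp 1%:E).
Local Notation L2 := (cLp 2%:E).

Lemma norm_sin_le (x : R) : `|sin x| <= `|x|.
Proof.
wlog x0 : x / 0 < x.
  move=> h; case: (ltgtP x 0) => [xn|/h//|->]; last by rewrite sin0 normr0.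
  by have := h (- x); rewrite sinN !normrN oppr_gt0; apply.
have [|c _] := @MVT _ sin cos 0 x x0 (fun y _ => is_derive_sin y).
  by apply: continuous_subspaceT; exact: continuous_sin.
by rewrite sin0 !subr0 => ->; rewrite normrM ler_piMl// cos_max.
Qed.

(** |e^{is} - 1|^2 = 2 - 2 cos s = 4 sin^2 (s / 2), and |sin x| <= |x|. *)
Lemma sqr_normc_expi_sub1 (s : R) : normc (expi s - 1) ^+ 2 <= s ^+ 2.
Proof.
have -> : normc (expi s - 1) ^+ 2 = 2 - 2 * cos s.
  rewrite sqr_normc ReD ImD ReN ImN /= subr0.
  by have := cos2Dsin2 s; move: (cos s) (sin s) => a b; nra.
have -> : s = (s / 2) *+ 2 by rewrite -mulr_natr divfK.
rewrite cos_mulr2n; have : sin (s / 2) ^+ 2 <= (s / 2) ^+ 2.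
  by rewrite -(real_normK (num_real (sin _))) -[leRHS]real_normK ?num_real// lerXn2r ?nnegrE// norm_sin_le.
have := cos2Dsin2 (s / 2); rewrite !mulr2n; move: (s / 2) (cos (s / 2)) (sin (s / 2)) => y a b; nra.
Qed.

Lemma FT_shift (u : mR -> R[i]) (d t : R) : L1 u ->
  FT (fun v => u (v + d)) t = expi (t * d) * FT u t.
Proof.
move=> L1u; have := L1_affine d (oner_neq0 R) L1u; under eq_fun do rewrite mul1r; move=> L1d.
have L1e : L1 (fun x : mR => u x * expi (- (t * x))) by apply: L1_expi => //; meas.
rewrite !FTE -cintegralZ// (@cintegral_affine _ 1 d _ _ (L1Z _ L1e)) ?oner_neq0// normr1 mul1r.
apply: eq_cintegral => x; rewrite mul1r mulrCA -expiD; congr (_ * expi _); ring.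
Qed.

(** Plancherel for the increment, whose Fourier transform is (e^{itd} - 1) times that of [u]. The
    right-hand side may be infinite. *)
Lemma shift_energy (u : mR -> R[i]) (d : R) : L1 u -> L2 u ->
  ((2 * pi)%:E * \int[leb]_v (normc (u (v + d)%R - u v) ^+ 2)%:E <=
   (d ^+ 2)%:E * \int[leb]_t (t ^+ 2 * normc (FT u t) ^+ 2)%:E)%E.
Proof.
move=> L1u L2u.
have L1d : L1 (fun v => u (v + d)).
  by have := L1_affine d (oner_neq0 R) L1u; under eq_fun do rewrite mul1r.
have L2d : L2 (fun v => u (v + d)).
  have := @L2_wcomp_affine _ (fun=> 1) 1 1 d u (oner_neq0 R) (cmeasurable_cst _ _) (fun=> normc1 R) L2u.
  by under eq_fun do rewrite !mul1r.
have L1D' : L1 (fun v => u (v + d) - u v).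
  by have := L1D L1d (L1Z (-1) L1u); under eq_fun do rewrite mulN1r.
have L2D' : L2 (fun v => u (v + d) - u v) by exact: L2B.
have mFT := measurable_normc (cmeasurable_FT L1u).
have <- : (\int[leb]_t (normc (FT (fun v => u (v + d)%R - u v) t) ^+ 2)%:E =
  (2 * pi)%:E * \int[leb]_v (normc (u (v + d)%R - u v) ^+ 2)%:E)%E.
  rewrite plancherel_csq// EFinM; congr (_ * _)%E.
  by rewrite -nL2_sqr// EFin_expe nL2E// cLnorm2E.
rewrite -ge0_integralZ_EFin ?sqr_ge0//; last 2 first.
- by meas.
- by move=> t; rewrite mulr_ge0 ?sqr_ge0.
apply: ge0_le_integral_EFin.
- by apply: measurable_funX; apply: measurable_normc; exact: cmeasurable_FT.
- by meas.
- by move=> t; exact: sqr_ge0.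
move=> t; have -> : FT (fun v => u (v + d) - u v) t = (expi (t * d) - 1) * FT u t.
  rewrite (_ : (fun v => u (v + d) - u v) = (fun v => u (v + d) + -1 * u v)); last by apply/funext => v; rewrite mulN1r.
  by rewrite FTD//; [rewrite FTZ// FT_shift// mulrBl mulN1r mul1r|exact: L1Z].
rewrite normcM exprMn mulrA; apply: ler_wpM2r; first exact: sqr_ge0.
by rewrite (le_trans (sqr_normc_expi_sub1 _))// exprMn mulrC.
Qed.

Lemma measurable_iter1 (f : mR * mR -> R) : measurable_fun setT f -> (forall u, 0 <= f u) ->
  measurable_fun setT (fun x : mR => \int[leb]_y (f (x, y))%:E)%E.
Proof.
move=> mf f0; apply: (@measurable_fun_fubini_tonelli_F _ _ _ _ _ leb (EFin \o f)).
  exact/measurable_EFinP.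
by move=> u; rewrite lee_fin.
Qed.

Lemma measurable_iter2 (f : mR * mR -> R) : measurable_fun setT f -> (forall u, 0 <= f u) ->
  measurable_fun setT (fun y : mR => \int[leb]_x (f (x, y))%:E)%E.
Proof.
move=> mf f0; apply: (@measurable_fun_fubini_tonelli_G _ _ _ _ _ leb (EFin \o f)).
  exact/measurable_EFinP.
by move=> u; rewrite lee_fin.
Qed.

Lemma integral_swap (f : mR * mR -> R) : measurable_fun setT f -> (forall u, 0 <= f u) ->
  (\int[leb]_x \int[leb]_y (f (x, y))%:E = \int[leb]_y \int[leb]_x (f (x, y))%:E)%E.
Proof.
move=> mf f0; apply: (@fubini_tonelli _ _ _ _ _ leb leb (EFin \o f)).
  exact/measurable_EFinP.
by move=> u; rewrite lee_fin.
Qed.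

(** Here [a] and [b] stand for the moduli of H at two frequencies and [d] for the modulus of the
    difference. AM-GM applied to v (a - b)(a + b) would leave (a + b)^2 / 4; adding the square of v
    (a - b) / 2 turns this into (a^2 + b^2) / 2, the quantity that integrates to second moments. *)
Lemma young_sqr_diff (e v a b d : R) : 0 < e -> 0 <= a -> 0 <= b -> a <= d + b -> b <= d + a ->
  v * (a ^+ 2 - b ^+ 2) - (2 * e)^-1 * (v ^+ 2 * (a ^+ 2 + b ^+ 2)) <= e * d ^+ 2.
Proof.
move=> e0 a0 b0 ab ba; rewrite -subr_ge0.
have -> : e * d ^+ 2 - (v * (a ^+ 2 - b ^+ 2) - (2 * e)^-1 * (v ^+ 2 * (a ^+ 2 + b ^+ 2))) =
  e * (d ^+ 2 - (a - b) ^+ 2) + e^-1 * (e * (a - b) - v * (a + b) / 2) ^+ 2 + e^-1 * (v * (a - b) / 2) ^+ 2.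
  by field; rewrite gt_eqF.
have i0 : 0 <= e^-1 by rewrite invr_ge0 ltW.
apply: addr_ge0; last by apply: mulr_ge0 => //; exact: sqr_ge0.
apply: addr_ge0; last by apply: mulr_ge0 => //; exact: sqr_ge0.
apply: mulr_ge0; first exact: ltW.
by rewrite subr_ge0 -(real_normK (num_real (a - b))) lerXn2r ?nnegrE ?ler_norml//; lra.
Qed.

Lemma Rintegral_comb (A B : mR -> R) (x k : R) : leb.-integrable setT (EFin \o A) -> leb.-integrable setT (EFin \o B) ->
  leb.-integrable setT (EFin \o (fun z : mR => x * (A z - B z) - k * (A z + B z))) /\
  \int[leb]_z (x * (A z - B z) - k * (A z + B z)) =
  x * (\int[leb]_z A z - \int[leb]_z B z) - k * (\int[leb]_z A z + \int[leb]_z B z).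
Proof.
move=> iA iB; have i1 := integrableBR iA iB; have i2 := integrableDR iA iB.
have i3 := integrableZlR x i1; have i4 := integrableZlR k i2.
split; first exact: integrableBR.
by rewrite RintegralB// !RintegralZl// RintegralB// RintegralD.
Qed.

(** Dividing by [d] leaves the remainder (- 2 m + d N) d / (2 l), which tends to 0 with [d]. *)
Lemma tradeoff_limit (N M W m l : R) : 0 < l ->
  (forall d, 0 < d -> d * N <= l * d * M + (2 * (l / d))^-1 * (2 * W - 2 * d * m + d ^+ 2 * N)) ->
  N <= l * M + W / l.
Proof.
move=> l0 h; apply/ler_addgt0Pr => e e0.
(* [C] bounds - 2 m + d N when d <= 1, so d <= 2 l e / C keeps the remainder below [e]; the added 1
   makes [C] positive. *)
pose C := 2 * `|m| + `|N| + 1.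
have C0 : 0 < C by rewrite /C; have := normr_ge0 m; have := normr_ge0 N; lra.
pose d := Num.min 1 (2 * l * e / C).
have d0 : 0 < d by rewrite lt_min ltr01/= divr_gt0// !mulr_gt0.
have d1 : d <= 1 by rewrite ge_min lexx.
have dC : d * C <= 2 * l * e.
  by rewrite -ler_pdivlMr// ge_min lexx orbT.
have := h d d0; rewrite (_ : _ + _ = d * (l * M + W / l + (- 2 * m + d * N) * d / (2 * l))); last first.
  by field; rewrite !gt_eqF.
rewrite ler_pM2l// => /le_trans; apply; rewrite lerD2l ler_pdivrMr ?mulr_gt0//.
apply: (@le_trans _ _ (d * C)); last by rewrite [leRHS]mulrC.
rewrite mulrC ler_pM2l// /C.
have : d * N <= `|N|.
  by apply: le_trans (ler_norm _) _; rewrite normrM (gtr0_norm d0) ler_piMl.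
have := ler_norm (- m); rewrite normrN; lra.
Qed.

(** The infimum of l X + Y / l over l > 0 is 2 sqrt (X Y). *)
Lemma sqr_le_of_tradeoff (N X Y : R) : 0 <= N -> 0 <= X -> 0 <= Y ->
  (forall l, 0 < l -> N <= l * X + Y / l) -> N ^+ 2 <= 4 * X * Y.
Proof.
rewrite le_eqVlt => /predU1P[<-|N0] X0 Y0 h; first by rewrite expr0n/= !mulr_ge0.
have [X00|Xn] := eqVneq X 0.
  (* With X = 0 this choice of l yields N <= N Y / (Y + 1), impossible for N > 0. *)
  have := h ((Y + 1) / N); rewrite divr_gt0 ?ltr_wpDl// => /(_ isT).
  rewrite X00 mulr0 add0r invf_div mulrA ler_pdivlMr ?ltr_wpDl//; nra.
have Xp : 0 < X by rewrite lt_def Xn.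
(* This l makes the first term N / 2, so the second one, 2 X Y / N, is at least N / 2. *)
have := h (N / (2 * X)); rewrite divr_gt0 ?mulr_gt0// => /(_ isT).
rewrite (_ : N / (2 * X) * X = N / 2); last by field.
rewrite invf_div mulrA -lerBlDl ler_pdivlMr//; nra.
Qed.

(** * Heisenberg's inequality for an abstract kernel H with energy density P *)

Section Kernel.
Variables (H : mR * mR -> R[i]) (P : mR -> R).
Hypotheses (mH : cmeasurable setT H) (L1H : forall z, L1 (fun v => H (v, z)))
  (P0 : forall v, 0 <= P v) (iP : leb.-integrable setT (EFin \o P))
  (HP : {ae (@lebesgue_measure R), forall v : mR, (\int[leb]_z (normc (H (v, z)) ^+ 2)%:E = (P v)%:E)%E}).

Let mnH : measurable_fun setT (fun u => normc (H u)).
Proof. exact: measurable_normc. Qed.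

Let mH2 : measurable_fun setT (fun u => normc (H u) ^+ 2).
Proof. by meas. Qed.

Let H20 u : 0 <= normc (H u) ^+ 2.
Proof. exact: sqr_ge0. Qed.

Lemma cmeasurable_section (z : mR) : cmeasurable setT (fun v => H (v, z)).
Proof. by apply: cmeasurable_comp; [|exact: mH]; exact: pair2_measurable. Qed.

Lemma integral_slice_energy : (\int[leb]_z \int[leb]_v (normc (H (v, z)) ^+ 2)%:E = \int[leb]_v (P v)%:E)%E.
Proof.
rewrite -(integral_swap mH2 H20).
apply: ae_eq_integral => //; first exact: (measurable_iter1 mH2 H20).
  by have /integrableP[] := iP.
by apply: filterS HP => v + _.
Qed.

(** By Tonelli the slice energies have the finite total mass of [P], so almost all of them are
    finite. Integrability of slices, in contrast, is assumed for every z, since their transforms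
    must be defined everywhere. *)
Lemma ae_L2_slice : {ae (@lebesgue_measure R), forall z : mR, L2 (fun v => H (v, z))}.
Proof.
have mA : measurable_fun setT (fun z : mR => \int[leb]_v (normc (H (v, z)) ^+ 2)%:E)%E.
  exact: (measurable_iter2 mH2 H20).
have iA : leb.-integrable setT (fun z : mR => \int[leb]_v (normc (H (v, z)) ^+ 2)%:E)%E.
  apply/integrableP; split => //.
  under eq_integral => z _ do rewrite gee0_abs ?csq_ge0//.
  by rewrite integral_slice_energy ltey_eq; have := integrable_fin_num measurableT iP => ->.
apply: filterS (integrable_ae measurableT iA) => z /(_ I) fz.
apply/cL2P; split; first exact: cmeasurable_section.
apply/integrableP; split; first by apply/measurable_EFinP; apply: measurable_funX; apply: measurable_normc; exact: cmeasurable_section.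
under eq_integral => v _ do rewrite gee0_abs ?lee_fin ?sqr_ge0//.
by rewrite -ge0_fin_numE// csq_ge0.
Qed.

Lemma measurable_FT_slice : measurable_fun setT (fun u : mR * mR => normc (FT (fun v => H (v, u.2)) u.1)).
Proof.
apply: measurable_normc; have mK : cmeasurable setT (fun w : (mR * mR) * mR => H (w.2, w.1.2) * expi (- (w.1.1 * w.2))).
  apply: cmeasurableM; last by apply: cmeasurable_expi; meas.
  by apply: (cmeasurable_comp _ mH); meas.
split.
- apply: (eq_measurable_fun (fun u : mR * mR => \int[leb]_v (Re (H (v, u.2) * expi (- (u.1 * v)))))).
    by move=> u _; rewrite FTE.
  by apply: (@measurable_Rintegral R _ _ (fun w : (mR * mR) * mR => Re (H (w.2, w.1.2) * expi (- (w.1.1 * w.2))))); case: mK.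
- apply: (eq_measurable_fun (fun u : mR * mR => \int[leb]_v (Im (H (v, u.2) * expi (- (u.1 * v)))))).
    by move=> u _; rewrite FTE.
  by apply: (@measurable_Rintegral R _ _ (fun w : (mR * mR) * mR => Im (H (w.2, w.1.2) * expi (- (w.1.1 * w.2))))); case: mK.
Qed.

(** The second moment in t of the Fourier transform taken in the first variable. For the wavelet
    kernel it is, up to a constant, the second moment of the wavelet transform; it may be
    infinite. *)
Definition time_spread : \bar R := (\int[leb]_z \int[leb]_t (t ^+ 2 * normc (FT (fun v => H (v, z)) t) ^+ 2)%:E)%E.

Lemma shift_difference_energy (d : R) :
  ((2 * pi)%:E * \int[leb]_v \int[leb]_z (normc (H ((v + d)%R, z) - H (v, z)) ^+ 2)%:E <= (d ^+ 2)%:E * time_spread)%E.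
Proof.
pose fD (u : mR * mR) := normc (H (u.1 + d, u.2) - H u) ^+ 2.
have mD : measurable_fun setT fD.
  apply: measurable_funX; apply: measurable_normc; apply: cmeasurableB => //.
  by apply: (cmeasurable_comp _ mH); meas.
have D0 u : 0 <= fD u by exact: sqr_ge0.
have -> : (\int[leb]_v \int[leb]_z (normc (H ((v + d)%R, z) - H (v, z)) ^+ 2)%:E =
  \int[leb]_z \int[leb]_v (normc (H ((v + d)%R, z) - H (v, z)) ^+ 2)%:E)%E by exact: (integral_swap mD D0).
have mG : measurable_fun setT (fun z : mR => \int[leb]_v (normc (H ((v + d)%R, z) - H (v, z)) ^+ 2)%:E)%E.
  exact: (measurable_iter2 mD D0).
pose fh (u : mR * mR) := u.1 ^+ 2 * normc (FT (fun v => H (v, u.2)) u.1) ^+ 2.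
have mh : measurable_fun setT fh.
  by rewrite /fh; have := measurable_FT_slice => mh; meas.
have h0 u : 0 <= fh u by rewrite /fh mulr_ge0 ?sqr_ge0.
have mK : measurable_fun setT (fun z : mR => \int[leb]_t (t ^+ 2 * normc (FT (fun v => H (v, z)) t) ^+ 2)%:E)%E.
  exact: (measurable_iter2 mh h0).
have G0 z : (0 <= \int[leb]_v (normc (H ((v + d)%R, z) - H (v, z)) ^+ 2)%:E)%E.
  by apply: integral_ge0 => v _; exact: (D0 (v, z)).
have K0 z : (0 <= \int[leb]_t (t ^+ 2 * normc (FT (fun v => H (v, z)) t) ^+ 2)%:E)%E.
  by apply: integral_ge0 => v _; exact: (h0 (v, z)).
rewrite -ge0_integralZl_EFin ?mulr_ge0 ?pi_ge0// /time_spread -ge0_integralZl_EFin ?sqr_ge0//.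
apply: ae_ge0_le_integral => //.
- by move=> z _; rewrite mule_ge0// lee_fin mulr_ge0 ?pi_ge0.
- by apply: measurable_funeM.
- by move=> z _; rewrite mule_ge0// lee_fin sqr_ge0.
- by apply: measurable_funeM.
by apply: filterS ae_L2_slice => z L2z _; exact: shift_energy.
Qed.

(** If t^2 |FT|^2 vanishes almost everywhere then so does FT, the point t = 0 being negligible, and
    Plancherel makes almost every slice null. This later rules out a product of 0 and [+oo]. *)
Lemma time_spread_eq0 : time_spread = 0%E -> \int[leb]_v P v = 0.
Proof.
move=> M0.
pose fh (u : mR * mR) := u.1 ^+ 2 * normc (FT (fun v => H (v, u.2)) u.1) ^+ 2.
have mh : measurable_fun setT fh.
  by rewrite /fh; have := measurable_FT_slice => mh; meas.
have h0 u : 0 <= fh u by rewrite /fh mulr_ge0 ?sqr_ge0.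
have mK := measurable_iter2 mh h0.
have K0 z : (0 <= \int[leb]_t (fh (t, z))%:E)%E by apply: integral_ge0 => t _; rewrite lee_fin.
have aez : {ae (@lebesgue_measure R), forall z : mR, (\int[leb]_t (fh (t, z))%:E = 0)%E}.
  have /(ae_eq_integral_abs leb measurableT mK) : (\int[leb]_z `|\int[leb]_t (fh (t, z))%:E| = 0)%E.
    by under eq_integral => z _ do rewrite gee0_abs//.
  by apply: filterS => z /(_ I).
rewrite /Rintegral -integral_slice_energy; suff -> : (\int[leb]_z \int[leb]_v (normc (H (v, z)) ^+ 2)%:E = \int[leb]_(z in setT) 0)%E by rewrite integral0.
apply: ae_eq_integral => //; first exact: (measurable_iter2 mH2 H20).
apply: (@filterS2 _ _ _ _ _ _ _ aez ae_L2_slice) => z tz L2z _ /=.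
have mz : measurable_fun setT (fun t : mR => fh (t, z)).
  by apply: (measurableT_comp mh); exact: pair2_measurable.
have /(ae_eq_integral_abs leb measurableT) : (\int[leb]_t `|(fh (t, z))%:E| = 0)%E.
  by under eq_integral => t _ do rewrite gee0_abs ?lee_fin//.
move=> /(_ (proj2 (measurable_EFinP _ _) mz)) aet.
have := plancherel_csq (L1H z) L2z.
rewrite (_ : (\int[leb]_v (normc (FT (fun v => H (v, z)) v) ^+ 2)%:E)%E = (\int[leb]_(z in setT) 0)%E); last first.
  apply: ae_eq_integral => //.
    by apply/measurable_EFinP; apply: measurable_funX; apply: measurable_normc; exact: cmeasurable_FT.
  apply: (@filterS2 _ _ _ _ _ _ _ aet (ae_neq 0)) => t /(_ I) + t0 _ => -[] /eqP.
  by rewrite /fh mulf_eq0 sqrf_eq0 (negbTE t0)/= => /eqP ->.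
rewrite integral0 => /(congr1 fine)/= /eqP; rewrite eq_sym mulf_eq0 mulf_eq0 pnatr_eq0 (gt_eqF (pi_gt0 R))/= => /eqP z0.
by rewrite -cLnorm2E -nL2E// -EFin_expe nL2_sqr// z0.
Qed.

Lemma fiber_integrable (v : mR) : (\int[leb]_z (normc (H (v, z)) ^+ 2)%:E = (P v)%:E)%E ->
  leb.-integrable setT (EFin \o (fun z : mR => normc (H (v, z)) ^+ 2)) /\ \int[leb]_z (normc (H (v, z)) ^+ 2) = P v.
Proof.
move=> hv; split; last by rewrite /Rintegral hv.
apply/integrableP; split; first by apply/measurable_EFinP; apply: (measurableT_comp mH2); exact: pair1_measurable.
by under eq_integral => z _ do rewrite gee0_abs ?lee_fin ?sqr_ge0//; rewrite hv ltry.
Qed.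

(** [young_sqr_diff] integrated over z. Both of its side conditions are the triangle inequality for
    the moduli of H at [v] and [v']. *)
Lemma fiber_shift_bound (x v v' : mR) (e : R) : 0 < e -> (\int[leb]_z (normc (H (v, z)) ^+ 2)%:E = (P v)%:E)%E ->
  (\int[leb]_z (normc (H (v', z)) ^+ 2)%:E = (P v')%:E)%E ->
  ((x * (P v - P v') - (2 * e)^-1 * (x ^+ 2 * (P v + P v')))%:E <= e%:E * \int[leb]_z (normc (H (v', z) - H (v, z)) ^+ 2)%:E)%E.
Proof.
move=> e0 /fiber_integrable[ia <-] /fiber_integrable[ib <-].
have mc (w : mR) : cmeasurable setT (fun z => H (w, z)) by apply: cmeasurable_comp mH; exact: pair1_measurable.
have tri (z w : R[i]) : normc z <= normc (w - z) + normc w.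
  by rewrite -(normcN (w - z)) opprB; apply: le_trans (le_normcD _ _); rewrite subrK.
have id : leb.-integrable setT (EFin \o (fun z : mR => normc (H (v', z) - H (v, z)) ^+ 2)).
  apply: (le_integrableR _ _ (integrableDR (integrableZlR 2 ia) (integrableZlR 2 ib))).
    by apply: measurable_funX; apply: measurable_normc; exact: cmeasurableB.
  move=> z; rewrite ger0_norm ?sqr_ge0// !sqr_normc ReD ImD ReN ImN.
  move: (Re (H (v', z))) (Im (H (v', z))) (Re (H (v, z))) (Im (H (v, z))) => a b c d.
  by have := sqr_ge0 (a + c); have := sqr_ge0 (b + d); nra.
rewrite -[X in (_ * X)%E]fineK; last exact: (integrable_fin_num measurableT id).
rewrite -EFinM lee_fin -/(Rintegral leb setT (fun z : mR => normc (H (v', z) - H (v, z)) ^+ 2)).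
rewrite (mulrA (2 * e)^-1); have [ic <-] := Rintegral_comb x ((2 * e)^-1 * x ^+ 2) ia ib.
rewrite -RintegralZl//; apply: le_Rintegral => //; first exact: integrableZlR.
move=> z _; rewrite -(mulrA (2 * e)^-1); apply: young_sqr_diff; rewrite ?normc_ge0 ?tri//.
by apply: le_trans (tri _ (H (v, z))) _; rewrite -normcN opprB.
Qed.

(** By translation, v (P v - P (v + d)) integrates to d times the mass, and v^2 (P v + P (v + d)) to
    the last bracket. The Young parameter is l / d: multiplied by the d^2 of the shift estimate it
    leaves l d, of the same order in [d] as the left-hand side. *)
Lemma uncertainty_shift_step (M d l : R) : time_spread = M%:E -> leb.-integrable setT (EFin \o (fun v : mR => v ^+ 2 * P v)) ->
  0 < d -> 0 < l ->
  d * \int[leb]_v P v <= l * d * (M / (2 * pi)) +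
    (2 * (l / d))^-1 * (2 * \int[leb]_v (v ^+ 2 * P v) - 2 * d * \int[leb]_v (v * P v) + d ^+ 2 * \int[leb]_v P v).
Proof.
move=> hM iW d0 l0.
have e0 : 0 < l / d by rewrite divr_gt0.
have mP : measurable_fun setT P by have /integrableP[/measurable_EFinP] := iP.
have i1 : leb.-integrable setT (EFin \o (fun v : mR => v * P v)).
  apply: (le_integrableR _ _ (integrableDR iP iW)); first by meas.
  (* The first moment is dominated through |v| <= 1 + v^2. *)
  move=> v; rewrite normrM (ger0_norm (P0 v)) -[leRHS](_ : (1 + v ^+ 2) * P v = _); last by ring.
  apply: ler_wpM2r => //; have := normr_ge0 v; have := real_normK (num_real v); move: `|v| => y <-; nra.
have sh (f : mR -> R) : leb.-integrable setT (EFin \o f) -> leb.-integrable setT (EFin \o (fun v : mR => f (v + d))) /\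
   \int[leb]_v f (v + d) = \int[leb]_v f v.
  move=> fi; have := integrable_affine d (oner_neq0 R) fi; have := Rintegral_affine d (oner_neq0 R) fi.
  rewrite (_ : (fun v : mR => f (1 * v + d)) = (fun v : mR => f (v + d))); last by apply/funext => v; rewrite mul1r.
  rewrite (_ : (EFin \o (fun v : mR => f (v + d))) = (fun v : mR => (EFin \o f) (1 * v + d))); last by apply/funext => v; rewrite mul1r.
  by rewrite normr1 mul1r => -> ->.
pose c := (2 * (l / d))^-1.
have [iP' _] := sh _ iP.
have [i1' s1] : leb.-integrable setT (EFin \o (fun v : mR => v * P (v + d))) /\
   \int[leb]_v (v * P (v + d)) = \int[leb]_v (v * P v) - d * \int[leb]_v P v.
  have ii := integrableBR i1 (integrableZlR d iP).
  have e : \int[leb]_v (v * P v - d * P v) = \int[leb]_v (v * P v) - d * \int[leb]_v P v.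
    by rewrite RintegralB ?RintegralZl//; exact: integrableZlR.
  have [] := sh _ ii; rewrite e => h1 h2; split.
    by apply: eq_integrable h1 => // v _ /=; congr EFin; ring.
  by rewrite -h2; apply: eq_Rintegral => v _; ring.
have [i2' s2] : leb.-integrable setT (EFin \o (fun v : mR => v ^+ 2 * P (v + d))) /\
   \int[leb]_v (v ^+ 2 * P (v + d)) = \int[leb]_v (v ^+ 2 * P v) - 2 * d * \int[leb]_v (v * P v) + d ^+ 2 * \int[leb]_v P v.
  have ia := integrableBR iW (integrableZlR (2 * d) i1).
  have ii := integrableDR ia (integrableZlR (d ^+ 2) iP).
  have e : \int[leb]_v (v ^+ 2 * P v - 2 * d * (v * P v) + d ^+ 2 * P v) =
      \int[leb]_v (v ^+ 2 * P v) - 2 * d * \int[leb]_v (v * P v) + d ^+ 2 * \int[leb]_v P v.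
    rewrite RintegralD//; last exact: integrableZlR.
    by rewrite RintegralB ?RintegralZl//; exact: integrableZlR.
  have [] := sh _ ii; rewrite e => h1 h2; split.
    by apply: eq_integrable h1 => // v _ /=; congr EFin; ring.
  by rewrite -h2; apply: eq_Rintegral => v _; ring.
pose r (v : mR) := (v * P v - v * P (v + d)) - c * (v ^+ 2 * P v + v ^+ 2 * P (v + d)).
have ir1 := integrableBR i1 i1'.
have ir2 := integrableDR iW i2'.
have ir : leb.-integrable setT (EFin \o r) by apply: integrableBR => //; exact: integrableZlR.
have rE : \int[leb]_v r v = d * \int[leb]_v P v - c * (2 * \int[leb]_v (v ^+ 2 * P v) - 2 * d * \int[leb]_v (v * P v) + d ^+ 2 * \int[leb]_v P v).
  rewrite /r RintegralB//; last exact: integrableZlR.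
  by rewrite RintegralB// RintegralZl// RintegralD// s1 s2; ring.
rewrite -/c -lerBlDr -rE.
pose fD (u : mR * mR) := normc (H (u.1 + d, u.2) - H u) ^+ 2.
have mD : measurable_fun setT fD.
  apply: measurable_funX; apply: measurable_normc; apply: cmeasurableB => //.
  by apply: (cmeasurable_comp _ mH); meas.
have D0 u : 0 <= fD u by exact: sqr_ge0.
have mQ := measurable_iter1 mD D0.
(* [r] may be negative, while the comparison of extended integrals needs a nonnegative integrand.
   Since the right-hand side is nonnegative, passing to the positive part costs nothing. *)
have aer : {ae (@lebesgue_measure R), forall v : mR, ((Num.max (r v) 0)%:E <= (l / d)%:E * \int[leb]_z (fD (v, z))%:E)%E}.
  have HPd := ae_affine d (oner_neq0 R) HP.
  apply: (@filterS2 _ _ _ _ _ _ _ HP HPd) => v; rewrite mul1r => hv hvd.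
  rewrite maxEle; case: ifP => _.
    by rewrite mule_ge0 ?lee_fin ?(ltW e0)//; apply: integral_ge0 => z _; rewrite lee_fin.
  apply: le_trans (fiber_shift_bound v e0 hv hvd); rewrite lee_fin le_eqVlt; apply/orP; left; apply/eqP.
  by rewrite /r /c; ring.
have rp : leb.-integrable setT (EFin \o (fun v => Num.max (r v) 0)).
  have mr : measurable_fun setT r by have /integrableP[/measurable_EFinP] := ir.
  apply: (le_integrableR (g := fun v => `|r v|)).
  - by apply: measurable_maxr.
  - by move=> v; rewrite ger0_norm ?le_max ?lexx ?orbT// ge_max normr_ge0 ler_norm.
  - exact: (integrable_abse ir).
apply: (@le_trans _ _ (\int[leb]_v (Num.max (r v) 0))).
  by apply: le_Rintegral => // v _; rewrite le_max lexx.
rewrite -lee_fin /Rintegral fineK; last exact: integrable_fin_num.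
apply: (@le_trans _ _ (\int[leb]_v ((l / d)%:E * \int[leb]_z (fD (v, z))%:E))%E).
  apply: ae_ge0_le_integral => //.
  - by move=> v _; rewrite lee_fin le_max lexx orbT.
  - by have /integrableP[] := rp.
  - by move=> v _; rewrite mule_ge0 ?lee_fin ?(ltW e0)//; apply: integral_ge0 => z _; rewrite lee_fin.
  - exact: measurable_funeM.
  - by apply: filterS aer => v + _.
rewrite ge0_integralZl_EFin ?(ltW e0)//; last by move=> v _; apply: integral_ge0 => z _; rewrite lee_fin.
have := shift_difference_energy d; rewrite hM -EFinM.
rewrite -lee_pdivlMl ?mulr_gt0 ?pi_gt0// => hs.
apply: le_trans (lee_wpmul2l _ hs) _; first by rewrite lee_fin (ltW e0).
rewrite -!EFinM lee_fin le_eqVlt; apply/orP; left; apply/eqP.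
have pn : pi != 0 :> R by rewrite gt_eqF ?pi_gt0.
have dn : d != 0 by rewrite gt_eqF.
by move: (@pi R) pn => p pn; field; rewrite pn dn.
Qed.

Lemma uncertainty_tradeoff (M l : R) : time_spread = M%:E -> leb.-integrable setT (EFin \o (fun v : mR => v ^+ 2 * P v)) -> 0 < l ->
  \int[leb]_v P v <= l * (M / (2 * pi)) + (\int[leb]_v (v ^+ 2 * P v)) / l.
Proof.
move=> hM iW l0; apply: (tradeoff_limit (m := \int[leb]_v (v * P v)) l0) => d d0.
exact: uncertainty_shift_step.
Qed.

End Kernel.
End Uncertainty.

(** * The special affine wavelet transform *)

Section Wavelet.
Context (R : realType).
Local Notation mR := (measurableTypeR R).
Local Notation Re := (@complex.Re R).
Local Notation Im := (@complex.Im R).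
Local Notation L1 := (cLp 1%:E).
Local Notation L2 := (cLp 2%:E).
Local Notation Rplus := (`]0%R, +oo[%classic : set mR).

(** The density of dz / z extended by 0 to z <= 0, so that the half-plane integrals become integrals
    over the whole plane. *)
Definition winv (z : mR) : R := if 0 < z then z^-1 else 0.

Lemma Rplus_indicE (z : mR) : \1_Rplus z = (0 < z)%R%:R :> R.
Proof.
rewrite indicE; congr (_%:R : R); congr nat_of_bool.
by apply/idP/idP; rewrite inE/= in_itv/= andbT.
Qed.

Lemma measurable_winv : measurable_fun setT winv.
Proof.
apply: (eq_measurable_fun (fun z : mR => \1_Rplus z * z `^ (-1))).
  move=> z _; rewrite Rplus_indicE /winv; case: ifPn => z0; last by rewrite mul0r.
  by rewrite mul1r powR_inv1// ltW.
by apply: measurable_funM; [apply: measurable_indic|exact: measurable_powR].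
Qed.

Lemma winv_ge0 z : 0 <= winv z.
Proof. by rewrite /winv; case: ifP => // z0; rewrite invr_ge0 ltW. Qed.

Variables (L : saft_param R) (hB : sB L != 0).
Variables (psi f : R -> R[i]) (Cpsi : R).
Hypotheses (hpsi : L2 psi) (hf : L2 f) (Cpsi0 : 0 < Cpsi).
Variable G : mR * mR -> R[i].
Hypotheses (mG : cmeasurable ([set: mR] `*` Rplus) G)
  (hG : forall z : R, 0 < z -> {ae (@lebesgue_measure R), forall w : mR, G (w, z) = saft L (saw_Psi L psi ^~ z) w})
  (hadm : {ae (@lebesgue_measure R), forall w : mR,
          (\int[@lebesgue_measure R]_(z in Rplus) (normc (G (z * w, z)) ^+ 2 / z)%:E)%E = Cpsi%:E}).

(** [G] is only known to be measurable on the upper half-plane; the extension by zero is measurable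
    everywhere. *)
Definition Gext (u : mR * mR) : R[i] := if 0 < u.2 then G u else 0.

Lemma cmeasurable_Gext : cmeasurable setT Gext.
Proof.
have mD : measurable ([set: mR] `*` Rplus) by exact: measurableX.
have memD (u : mR * mR) : (u \in [set: mR] `*` Rplus) = (0 < u.2).
  by apply/idP/idP; rewrite inE/= in_itv/= andbT => // -[].
case: mG => /(measurable_restrictT _ mD) m1 /(measurable_restrictT _ mD) m2; split.
- by apply: eq_measurable_fun m1 => u _; rewrite patchE memD /Gext; case: ifP.
- by apply: eq_measurable_fun m2 => u _; rewrite patchE memD /Gext; case: ifP.
Qed.

(** The two exponents add up to that of [chirp L (z * y)], so this is chirp(z y) times the conjugate
    of psi(- y). This explains the shape of [saw_Psi]: at y = (t - x) / z the chirp becomes that of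
    t - x, independent of z. *)
Definition chirped_wavelet (z : R) (y : mR) : R[i] := saw_Psi L psi y z * chirp L y.

(** Built from the jointly measurable version rather than from [saft], because z and the frequency
    vary together in the Tonelli arguments; [isFT_Vchirp] shows that for each z > 0 it is still a
    Fourier transform of the chirped wavelet. *)
Definition wavelet_hat (z : mR) : mR -> R[i] := unsaft L (fun w => Gext (w, z)).

Lemma L2_saw_Psi (z : R) : L2 (saw_Psi L psi ^~ z).
Proof.
have mm : cmeasurable setT (fun x : mR => expi ((sA L * x ^+ 2 * (z ^+ 2 - 1) + 2 * x * sp L * (z - 1)) / (2 * sB L))).
  by apply: cmeasurable_expi; meas.
have N10 : -1 != 0 :> R by rewrite oppr_eq0 oner_eq0.
have := L2_wcomp_affine 0 N10 mm (fun=> normc_expi _) (L2J hpsi).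
by congr (cLp _ _); apply/funext => x; rewrite mulN1r addr0.
Qed.

Lemma L2_Vchirp z : L2 (chirped_wavelet z).
Proof. exact: (L2_chirp L (L2_saw_Psi z)). Qed.

Lemma cmeasurable_Vhat2 : cmeasurable setT (fun u : mR * mR => wavelet_hat u.2 (u.2 * u.1)).
Proof.
apply: cmeasurableM.
  apply: cmeasurableM; first exact: cmeasurable_cst.
  by apply: cmeasurableJ; apply: cmeasurable_expi; meas.
by apply: cmeasurable_comp; [|exact: cmeasurable_Gext]; meas.
Qed.

Lemma isFT_Vchirp (z : R) : 0 < z -> isFT (chirped_wavelet z) (wavelet_hat z).
Proof.
move=> z0; apply: isFT_ae (is_saft_isFT hB (L2_saw_Psi z) (saftP hB (L2_saw_Psi z))) _ _.
  apply: cmeasurableM.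
    apply: cmeasurableM; first exact: cmeasurable_cst.
    by apply: cmeasurableJ; apply: cmeasurable_expi; meas.
  by apply: (cmeasurable_comp (h := fun v : mR => (sB L * v, z) : mR * mR)); [meas|exact: cmeasurable_Gext].
have h := ae_affine 0 hB (hG z0). have FF : Filter (nbhs (almost_everywhere (@lebesgue_measure R))). by exact _.
move: h; apply: filterS => v; rewrite addr0 => e.
by rewrite /wavelet_hat /unsaft /Gext z0 e.
Qed.

Definition signal_hat : mR -> R[i] := unsaft L (saft L f).

Lemma isFT_Fhat : isFT (fun x => f x * chirp L x) signal_hat.
Proof. exact: is_saft_isFT (saftP hB hf). Qed.

Lemma L2_Fhat : L2 signal_hat. Proof. by case: isFT_Fhat. Qed.

(* The factor [sqrt (1 / z)] absorbs the measure [dz / z]. *)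
Definition wavelet_kernel (u : mR * mR) : R[i] := real_complex R (Num.sqrt (winv u.2)) * (signal_hat u.1 * wavelet_hat u.2 (u.2 * u.1)).

Lemma cmeasurable_Hker : cmeasurable setT wavelet_kernel.
Proof.
apply: cmeasurableM.
  split => //=; apply: (measurableT_comp (@measurable_sqrt R)).
  by apply: measurableT_comp; [exact: measurable_winv|meas].
apply: cmeasurableM; last exact: cmeasurable_Vhat2.
by apply: cmeasurable_comp; [|case: L2_Fhat => h _; exact: h]; meas.
Qed.

Lemma L2_Vhat_dil (z : R) : 0 < z -> L2 (fun v => wavelet_hat z (z * v)).
Proof.
move=> z0; have [L2V _] := isFT_Vchirp z0.
have := @L2_wcomp_affine _ (fun=> 1) 1 z 0 _ (lt0r_neq0 z0) (cmeasurable_cst _ _) (fun=> normc1 R) L2V.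
by congr (cLp _ _); apply/funext => v; rewrite mul1r addr0.
Qed.

(** A product of two L^2 functions when z > 0, and zero otherwise. *)
Lemma L1_Hker (z : mR) : L1 (fun v => wavelet_kernel (v, z)).
Proof.
have [z0|z0] := ltP 0 z.
  exact: (L1Z (real_complex R (Num.sqrt (winv z))) (L2M_L1 L2_Fhat (L2_Vhat_dil z0))).
have -> : (fun v => wavelet_kernel (v, z)) = (fun v => 0 * signal_hat v * signal_hat v).
  apply/funext => v; rewrite /wavelet_kernel /winv /= ltNge z0/= sqrtr0.
  by rewrite (_ : real_complex R 0 = 0)// !mul0r.
by under eq_fun do rewrite -mulrA; exact: (L1Z 0 (L2M_L1 L2_Fhat L2_Fhat)).
Qed.

Lemma normc_unsaft g v : normc (unsaft L g v) ^+ 2 = 2 * pi * `|sB L| * normc (g (sB L * v)) ^+ 2.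
Proof.
rewrite /unsaft !normcM normcV !normc_conjc normc_phase mulr1 exprMn exprVn.
by rewrite sqr_normc_KB// invrK.
Qed.

(** The factor [2 * pi * |sB L|] is the inverse of |K_B|^2, introduced when [unsaft] strips the
    constant from the SAFT of the wavelet. *)
Definition admissible_scale : R := 2 * pi * `|sB L| * Cpsi.

Lemma admissible_scale_gt0 : 0 < admissible_scale.
Proof. by rewrite !mulr_gt0 ?pi_gt0// normr_gt0. Qed.

Definition kernel_mass (v : mR) : R := admissible_scale * normc (signal_hat v) ^+ 2.

Lemma Pden_ge0 v : 0 <= kernel_mass v.
Proof. by rewrite mulr_ge0 ?sqr_ge0// ltW// admissible_scale_gt0. Qed.

Lemma integrable_Pden : leb.-integrable setT (EFin \o kernel_mass).
Proof. by apply: integrableZlR; have /cL2P[] := L2_Fhat. Qed.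

Lemma Rplus_mem (z : mR) : (z \in Rplus) = (0 < z).
Proof. by apply/idP/idP; rewrite inE/= in_itv/= andbT. Qed.

(** Admissibility at the point w = B v: [unsaft] at z v evaluates [G] at B (z v) = z (B v). Null
    sets are preserved because [sB L] is nonzero. *)
Lemma Hker_fiber : {ae (@lebesgue_measure R), forall v : mR, (\int[leb]_z (normc (wavelet_kernel (v, z)) ^+ 2)%:E = (kernel_mass v)%:E)%E}.
Proof.
have h := ae_affine 0 hB hadm.
have FF : Filter (nbhs (almost_everywhere (@lebesgue_measure R))) by exact _.
move: h; apply: filterS => v; rewrite addr0 integral_mkcond => hv.
pose c := 2 * pi * `|sB L| * normc (signal_hat v) ^+ 2.
have c0 : 0 <= c.
  apply: mulr_ge0; last exact: sqr_ge0.
  by rewrite !mulr_ge0 ?pi_ge0.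
pose g (z : mR) := winv z * normc (Gext (z * (sB L * v), z)) ^+ 2.
have mg : measurable_fun setT g.
  apply: measurable_funM; first exact: measurable_winv.
  apply: measurable_funX; apply: measurable_normc.
  by apply: (cmeasurable_comp (h := fun z : mR => (z * (sB L * v), z) : mR * mR)); [meas|exact: cmeasurable_Gext].
have g0 z : 0 <= g z by rewrite mulr_ge0 ?winv_ge0 ?sqr_ge0.
have hg : (\int[leb]_z (g z)%:E = Cpsi%:E)%E.
  rewrite -hv; apply: eq_integral => z _; rewrite patchE Rplus_mem /g /winv /Gext /=.
  by case: ifP => z0; [rewrite mulrC|rewrite mul0r].
transitivity (\int[leb]_z (c * g z)%:E)%E.
  apply: eq_integral => z _; congr EFin.
  have e : normc (wavelet_hat z (z * v)) ^+ 2 = _ := normc_unsaft (fun w => Gext (w, z)) (z * v).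
  rewrite /wavelet_kernel (normcM (real_complex R _)) (normcM (signal_hat _)) !exprMn normc_real e real_normK ?num_real// sqr_sqrtr ?winv_ge0//.
  by rewrite /g /c /= (mulrCA (sB L)); ring.
by rewrite ge0_integralZ_EFin// hg -EFinM /kernel_mass /admissible_scale /c; congr EFin; ring.
Qed.

Lemma L2_flip h (t z : R) : 0 < z -> L2 h -> L2 (fun x : mR => conjc (h ((t - x) / z))).
Proof.
move=> z0 L2h; have zn0 : z != 0 by rewrite gt_eqF.
have a0 : - z^-1 != 0 by rewrite oppr_eq0 invr_eq0.
have := L2J (L2_wcomp_affine (t / z) a0 (cmeasurable_cst _ _) (fun=> normc1 R) L2h).
congr (cLp _ _); apply/funext => x; rewrite mul1r; congr (conjc (h _)); by field.
Qed.

Definition atom_const (t z : R) : R[i] := conjc (KB L / real_complex R (Num.sqrt z)) * expi (- ((sA L * t ^+ 2 + 2 * sp L * t) / (2 * sB L))).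

(** Since x^2 + (t - x)^2 = t^2 - 2 x (t - x), the product chirp(x) chirp(t - x) equals chirp(t)
    times exp(- i A x (t - x) / B). The chirp of t does not involve x and goes into [atom_const]. *)
Lemma saw_atomE (t z x : R) : 0 < z ->
  conjc (saw_atom L psi t z x) = atom_const t z * (chirp L x * chirped_wavelet z ((t - x) / z)).
Proof.
move=> z0; have zn0 : z != 0 by rewrite gt_eqF.
rewrite /saw_atom conjcM [conjc (_ * psi _)]conjcM /atom_const /chirped_wavelet /saw_Psi /chirp.
rewrite (_ : - ((t - x) / z) = (x - t) / z); last by field.
rewrite -expiN (_ : - (sA L * x * (t - x) / sB L) = - ((sA L * t ^+ 2 + 2 * sp L * t) / (2 * sB L)) +
  ((sA L * x ^+ 2 + 2 * sp L * x) / (2 * sB L) + (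
    (sA L * ((t - x) / z) ^+ 2 * (z ^+ 2 - 1) + 2 * ((t - x) / z) * sp L * (z - 1)) / (2 * sB L) +
    (sA L * ((t - x) / z) ^+ 2 + 2 * sp L * ((t - x) / z)) / (2 * sB L)))); last first.
  by field; rewrite zn0 hB.
rewrite 3!expiD; move: (expi _) (expi _) (expi _) (expi _) (conjc _) (conjc _) => a b c d e g; ring.
Qed.

Lemma sqr_normc_atom_const (t z : R) : 0 < z -> normc (atom_const t z) ^+ 2 = (2 * pi * `|sB L|)^-1 / z.
Proof.
move=> z0; rewrite normcM normc_expi mulr1 normc_conjc normcM exprMn sqr_normc_KB//; congr (_ * _).
by rewrite normcV normc_real exprVn real_normK ?num_real// sqr_sqrtr// ltW.
Qed.

(** Parseval between the signal and the flipped wavelet. The constant collects 1 / (2 pi |B| z) from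
    the atom and z^2 / (4 pi^2) from Parseval; after division by z^2 the remaining 1 / z is the
    squared weight of [wavelet_kernel]. The argument is - t because the flip contributes
    e^{+itv}. *)
Lemma sqr_normc_sawt (t z : R) : 0 < z ->
  normc (sawt L psi f t z) ^+ 2 / z ^+ 2 = (8 * pi ^+ 3 * `|sB L|)^-1 * normc (FT (fun v => wavelet_kernel (v, z)) (- t)) ^+ 2.
Proof.
move=> z0; have zn0 : z != 0 by rewrite gt_eqF.
have L2u := L2_flip t z0 (L2_Vchirp z).
pose X := cintegral (fun v => signal_hat v * wavelet_hat z (z * v) * expi (t * v)).
pose Y := cintegral (fun x => f x * chirp L x * conjc (conjc (chirped_wavelet z ((t - x) / z)))).
have XY : real_complex R z * X = real_complex R (2 * pi) * Y.
  rewrite -(isFT_parseval (L2_chirp L hf) L2u isFT_Fhat (isFT_flip t z0 (L2_Vchirp z) (isFT_Vchirp z0))).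
  rewrite -cintegralZ; last by apply: L1_expi; [meas|exact: L2M_L1 L2_Fhat (L2_Vhat_dil z0)].
  apply: eq_cintegral => v; move: (wavelet_hat z (z * v)) (signal_hat v) => V F; rewrite !conjcM conjcK -expiN opprK (_ : conjc (real_complex R z) = real_complex R z); last first.
    by apply: complex_ext => /=; rewrite ?oppr0.
  by ring.
have sE : sawt L psi f t z = atom_const t z * Y.
  rewrite -cintegralZ; last exact: L2M_L1 (L2_chirp L hf) (L2J L2u).
  by apply: eq_cintegral => x; rewrite saw_atomE// conjcK; ring.
have FE : FT (fun v => wavelet_kernel (v, z)) (- t) = real_complex R (Num.sqrt z^-1) * X.
  rewrite FTE -cintegralZ; last by apply: L1_expi; [meas|exact: L2M_L1 L2_Fhat (L2_Vhat_dil z0)].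
  by apply: eq_cintegral => v; rewrite /wavelet_kernel /winv /= z0 mulNr opprK !mulrA.
move: X Y XY sE FE => X Y XY sE FE.
have nXY : `|z| * normc X = `|2 * pi| * normc Y.
  by have := congr1 (@normc R) XY; rewrite !normcM !normc_real.
have {}nXY : z ^+ 2 * normc X ^+ 2 = (2 * pi) ^+ 2 * normc Y ^+ 2.
  by rewrite -[z ^+ 2]real_normK ?num_real// -[(2 * pi) ^+ 2]real_normK ?num_real// -!exprMn nXY.
rewrite sE (normcM (atom_const t z)) FE (normcM (real_complex R _)) !exprMn sqr_normc_atom_const// normc_real real_normK ?num_real// !sqr_sqrtr ?invr_ge0 ?(ltW z0)//.
have pn : pi != 0 :> R by rewrite gt_eqF ?pi_gt0.
have bn : `|sB L| != 0 by rewrite normr_eq0.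
move: nXY; move: (normc X ^+ 2) (normc Y ^+ 2) => x y xy.
have -> : y = z ^+ 2 * x / (2 ^+ 2 * pi ^+ 2) by rewrite xy; move: (@pi R) pn => p pn; field.
by move: (@pi R) (`|sB L|) pn bn => p b pn bn; field; rewrite pn bn zn0.
Qed.

Lemma integral_reflect (k : R) (q : mR -> R) : 0 <= k -> measurable_fun setT q -> (forall t, 0 <= q t) ->
  (\int[leb]_t (k * q (- t))%:E = k%:E * \int[leb]_t (q t)%:E)%E.
Proof.
move=> k0 mq q0; have N10 : -1 != 0 :> R by rewrite oppr_eq0 oner_eq0.
rewrite (ge0_integral_affine 0 N10 (proj2 (measurable_EFinP _ _) mq)); last by move=> t; rewrite lee_fin.
rewrite normrN normr1 mul1e -ge0_integralZ_EFin//; last by apply: (measurableT_comp mq); exact: measurable_affine.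
by apply: eq_integral => t _; rewrite mulN1r addr0.
Qed.

Lemma wavelet_energy :
  (\int[(@lebesgue_measure R \x @lebesgue_measure R)%E]_(u in [set: mR] `*` Rplus)
       (u.1 ^+ 2 * normc (sawt L psi f u.1 u.2) ^+ 2 / u.2 ^+ 2)%R%:E =
   ((8 * pi ^+ 3 * `|sB L|)^-1)%:E * time_spread wavelet_kernel)%E.
Proof.
set k := (8 * pi ^+ 3 * `|sB L|)^-1.
have k0 : 0 <= k by rewrite invr_ge0 !mulr_ge0 ?exprn_ge0 ?pi_ge0.
pose gg (u : mR * mR) := k * (u.1 ^+ 2 * normc (FT (fun v => wavelet_kernel (v, u.2)) (- u.1)) ^+ 2).
have mh := measurable_FT_slice cmeasurable_Hker.
have mg : measurable_fun setT gg.
  apply: measurable_funM; first exact: measurable_cst.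
  apply: measurable_funM; first by meas.
  apply: measurable_funX.
  by apply: (measurableT_comp (g := fun u : mR * mR => (- u.1, u.2) : mR * mR) mh); meas.
have g0 u : 0 <= gg u by rewrite mulr_ge0// mulr_ge0 ?sqr_ge0.
rewrite integral_mkcond.
transitivity (\int[(@lebesgue_measure R \x @lebesgue_measure R)%E]_u (gg u)%:E)%E.
  apply: eq_integral => u _; rewrite patchE.
  have -> : (u \in [set: mR] `*` Rplus) = (0 < u.2).
    by apply/idP/idP; rewrite inE/= in_itv/= andbT => // -[].
  rewrite /gg; case: ifPn => z0; first by rewrite -mulrA sqr_normc_sawt// mulrCA.
  rewrite (_ : FT _ _ = 0) ?normc0 ?expr0n ?mulr0//.
  rewrite FTE; transitivity (cintegral (fun _ : mR => 0 : R[i])).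
    by apply: eq_cintegral => v; rewrite /wavelet_kernel /winv /= (negbTE z0) sqrtr0 (_ : real_complex R 0 = 0)// !mul0r.
  by rewrite /cintegral /= /Rintegral integral0.
rewrite (@fubini_tonelli2 _ _ _ _ _ leb leb (EFin \o gg))//; last exact/measurable_EFinP.
have hz (z : mR) : measurable_fun setT (fun t : mR => t ^+ 2 * normc (FT (fun v => wavelet_kernel (v, z)) t) ^+ 2).
  have := cmeasurable_FT (L1_Hker z) => /measurable_normc m1; meas.
have hn (z t : mR) : 0 <= t ^+ 2 * normc (FT (fun v => wavelet_kernel (v, z)) t) ^+ 2 by rewrite mulr_ge0 ?sqr_ge0.
rewrite /time_spread -ge0_integralZl_EFin//; last 2 first.
- by move=> z _; apply: integral_ge0 => t _; rewrite lee_fin.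
- apply: (@measurable_iter2 R (fun u : mR * mR => u.1 ^+ 2 * normc (FT (fun v => wavelet_kernel (v, u.2)) u.1) ^+ 2)).
    by meas.
  by move=> u; exact: hn.
apply: eq_integral => z _.
rewrite -(integral_reflect k0 (hz z) (hn z)).
by apply: eq_integral => t _; rewrite /gg /= sqrrN.
Qed.

(** The substitution w = B v: its Jacobian |B| cancels the |B| of [normc_unsaft], and w^2 = B^2 v^2
    leaves B^2 in the denominator. *)
Lemma saft_energy : (\int[leb]_v (v ^+ 2 * kernel_mass v)%:E =
  (2 * pi * admissible_scale / sB L ^+ 2)%:E * \int[leb]_w (w ^+ 2 * normc (saft L f w) ^+ 2)%:E)%E.
Proof.
have [L2s _] := saftP hB hf.
have ms : measurable_fun setT (fun w : mR => w ^+ 2 * normc (saft L f w) ^+ 2).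
  by have := measurable_normc (proj1 L2s) => m1; meas.
have s0 (w : mR) : 0 <= w ^+ 2 * normc (saft L f w) ^+ 2 by rewrite mulr_ge0 ?sqr_ge0.
rewrite (ge0_integral_affine 0 hB (proj2 (measurable_EFinP _ _) ms)); last by move=> w; rewrite lee_fin.
have b0 : 0 < `|sB L| by rewrite normr_gt0.
have kp := admissible_scale_gt0.
have c0 : 0 <= 2 * pi * admissible_scale / sB L ^+ 2 * `|sB L|.
  by rewrite !mulr_ge0 ?invr_ge0 ?sqr_ge0 ?pi_ge0// ltW.
rewrite muleA -EFinM -ge0_integralZ_EFin//; last by apply: (measurableT_comp ms); exact: measurable_affine.
apply: eq_integral => v _; congr EFin; rewrite addr0 /kernel_mass normc_unsaft exprMn.
by field.
Qed.

Lemma mass_Pden : \int[leb]_v kernel_mass v = 2 * pi * admissible_scale * nL2 f ^+ 2.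
Proof.
rewrite RintegralZl//; last by have /cL2P[] := L2_Fhat.
rewrite -nL2_sqr; last exact: L2_Fhat.
rewrite (isFT_norm (L2_chirp L hf) isFT_Fhat) exprMn sqr_sqrtr ?mulr_ge0 ?pi_ge0//.
rewrite [nL2 (fun x => f x * chirp L x)]nL2_expi; ring.
Qed.

(** Pure bookkeeping of constants, with p for pi, b for |B|, c for C_psi, n for the squared norm of
    f, m for the spread in t and i for the second moment of the SAFT. *)
Lemma uncertainty_rescale (p b c n m i : R) : 0 < p -> 0 < b -> 0 < c -> 0 <= n -> 0 <= m -> 0 <= i ->
  (2 * p * (2 * p * b * c) * n) ^+ 2 <= 4 * (m / (2 * p)) * (2 * p * (2 * p * b * c) / b ^+ 2 * i) ->
  Num.sqrt c * b / 2 * n <= Num.sqrt ((8 * p ^+ 3 * b)^-1 * m) * Num.sqrt i.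
Proof.
move=> p0 b0 c0 n0 m0 i0 h.
have k0 : 0 < 8 * p ^+ 3 * b by rewrite !mulr_gt0// exprn_gt0.
have km0 : 0 <= (8 * p ^+ 3 * b)^-1 * m by rewrite mulr_ge0// invr_ge0 ltW.
rewrite -(ler_pXn2r (n := 2))// ?nnegrE ?mulr_ge0 ?sqrtr_ge0 ?(ltW b0)//.
rewrite !exprMn !sqr_sqrtr// ?(ltW c0)//.
(* Multiplying the square of the goal by 64 p^4 c turns its two sides into those of [h]: both
   left-hand sides become 16 p^4 b^2 c^2 n^2 and both right-hand sides 8 p c m i / b. *)
have q0 : 0 < 64 * p ^+ 4 * c by rewrite !mulr_gt0// exprn_gt0.
rewrite -(ler_pM2l q0); apply: le_trans (le_trans _ h) _; rewrite le_eqVlt; apply/orP; left; apply/eqP.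
- by field.
- by field; rewrite !gt_eqF.
Qed.

Lemma wavelet_uncertainty :
  ~ {ae (@lebesgue_measure R), forall x : mR, f x = 0} ->
  ((\int[(@lebesgue_measure R \x @lebesgue_measure R)%E]_(u in [set: mR] `*` Rplus)
       (u.1 ^+ 2 * normc (sawt L psi f u.1 u.2) ^+ 2 / u.2 ^+ 2)%R%:E)
       `^ (2^-1)%R
   * (\int[@lebesgue_measure R]_w (w ^+ 2 * normc (saft L f w) ^+ 2)%R%:E)
       `^ (2^-1)%R
   >= (Num.sqrt Cpsi * `|sB L| / 2)%R%:E * cLnorm 2%:E f ^+ 2)%E.
Proof.
move=> hf0.
have mH := cmeasurable_Hker; have L1H := L1_Hker; have P0 := Pden_ge0.
have iP := integrable_Pden; have HP := Hker_fiber.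
have kp := admissible_scale_gt0; have pp := pi_gt0 R.
have bp : 0 < `|sB L| by rewrite normr_gt0.
(* The nontriviality of f enters here; through Plancherel it makes the mass of the kernel positive,
   and hence both moments nonzero. *)
have n0 : 0 < nL2 f ^+ 2.
  rewrite lt_def sqr_ge0 andbT; apply/negP => /eqP n0; apply: hf0.
  have /cL2P[mf if2] := hf.
  have mn : measurable_fun setT (fun x : mR => (normc (f x) ^+ 2)%:E) by have /integrableP[] := if2.
  have /(ae_eq_integral_abs leb measurableT mn) : (\int[leb]_x `|(normc (f x) ^+ 2)%:E| = 0)%E.
    under eq_integral => x _ do rewrite gee0_abs ?lee_fin ?sqr_ge0//.
    by rewrite -cLnorm2E -nL2E// -EFin_expe n0.
  by apply: filterS => x /(_ I)[] /eqP; rewrite sqrf_eq0 => /eqP/eq0_normc.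
have N0 : 0 < \int[leb]_v kernel_mass v by rewrite mass_Pden; do 3 (apply: mulr_gt0 => //).
rewrite wavelet_energy.
set k := (8 * pi ^+ 3 * `|sB L|)^-1.
have kk : 0 < k by rewrite invr_gt0 !mulr_gt0 ?exprn_gt0.
have M0 : (0 <= time_spread wavelet_kernel)%E.
  by apply: integral_ge0 => z _; apply: integral_ge0 => t _; rewrite lee_fin mulr_ge0 ?sqr_ge0.
have Mn0 : time_spread wavelet_kernel != 0%E.
  by apply/eqP => /(time_spread_eq0 mH L1H iP HP) => z; move: N0; rewrite z ltxx.
have We := saft_energy.
set I2 := (\int[leb]_w (w ^+ 2 * normc (saft L f w) ^+ 2)%:E)%E in We *.
have I20 : (0 <= I2)%E by apply: integral_ge0 => w _; rewrite lee_fin mulr_ge0 ?sqr_ge0.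
have mP : measurable_fun setT (fun v : mR => v ^+ 2 * kernel_mass v).
  have /integrableP[/measurable_EFinP mP _] := iP; meas.
have q0 (v : mR) : 0 <= v ^+ 2 * kernel_mass v := mulr_ge0 (sqr_ge0 v) (P0 v).
(* A vanishing second moment would force [kernel_mass] to vanish away from v = 0, hence almost
   everywhere, contradicting the positive mass. *)
have I2n0 : I2 != 0%E.
  apply/eqP => I2z; rewrite I2z mule0 in We.
  have /(ae_eq_integral_abs leb measurableT) : (\int[leb]_v `|(v ^+ 2 * kernel_mass v)%:E| = 0)%E.
    by under eq_integral => v _ do rewrite gee0_abs ?lee_fin ?q0//.
  move=> /(_ (proj2 (measurable_EFinP _ _) mP)) aev.
  suff z : (\int[leb]_v (kernel_mass v)%:E = \int[leb]_(v in setT) 0)%E.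
    by move: N0; rewrite /Rintegral z integral0 ltxx.
  apply: ae_eq_integral => //; first by have /integrableP[] := iP.
  apply: (@filterS2 _ _ _ _ _ _ _ aev (ae_neq 0)) => v /(_ I) + v0 _ => -[] /eqP.
  by rewrite mulf_eq0 sqrf_eq0 (negbTE v0)/= => /eqP ->.
(* If one factor is infinite the product is [+oo], since the other factor is nonzero; otherwise it
   could be 0 by the convention 0 * [+oo] = 0. Past these two cases everything is real. *)
have [My|Mf] := eqVneq (time_spread wavelet_kernel) +oo%E.
  rewrite My gt0_muley ?lte_fin// poweRyr ?invr_neq0// gt0_mulye ?leey//.
  by apply: poweR_gt0; rewrite lt0e I2n0.
have [Iy|If] := eqVneq I2 +oo%E.
  rewrite Iy poweRyr ?invr_neq0// gt0_muley ?leey//.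
  by apply: poweR_gt0; rewrite mule_gt0 ?lte_fin// lt0e Mn0.
have Mfin : time_spread wavelet_kernel \is a fin_num by rewrite ge0_fin_numE// ltey.
have Ifin : I2 \is a fin_num by rewrite ge0_fin_numE// ltey.
move: We; rewrite -(fineK Ifin) -EFinM => We.
have iW : leb.-integrable setT (EFin \o (fun v : mR => v ^+ 2 * kernel_mass v)).
  apply/integrableP; split; first exact/measurable_EFinP.
  under eq_integral => v _ do rewrite gee0_abs ?lee_fin ?q0//.
  by rewrite We ltry.
have main l : 0 < l -> _ := uncertainty_tradeoff mH L1H P0 iP HP (esym (fineK Mfin)) iW.
have m0 : 0 <= fine (time_spread wavelet_kernel) by exact: fine_ge0.
have i0 : 0 <= fine I2 by exact: fine_ge0.
have WE : \int[leb]_v (v ^+ 2 * kernel_mass v) = 2 * pi * admissible_scale / sB L ^+ 2 * fine I2 by rewrite /Rintegral We.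
have -> : (k%:E * time_spread wavelet_kernel)%E = (k * fine (time_spread wavelet_kernel))%:E by rewrite EFinM fineK.
rewrite !poweR12_sqrt ?lee_fin//; last by apply: mulr_ge0 => //; exact: ltW.
have sqE (a : R) : sqrte a%:E = (Num.sqrt a)%:E by [].
rewrite !sqE -EFinM.
rewrite -nL2E// -EFin_expe -EFinM lee_fin.
have X0 : 0 <= fine (time_spread wavelet_kernel) / (2 * pi) by rewrite divr_ge0// mulr_ge0// ltW.
have Y0 : 0 <= 2 * pi * admissible_scale / sB L ^+ 2 * fine I2.
  by rewrite !mulr_ge0 ?invr_ge0 ?sqr_ge0// ltW.
(* The tradeoff holds for every l > 0, so l can be optimised. *)
have := @sqr_le_of_tradeoff _ _ _ _ (ltW N0) X0 Y0.
rewrite -[in X in (X -> _)]WE => /(_ main).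
rewrite mass_Pden WE; move: (fine (time_spread wavelet_kernel)) (fine I2) (nL2 f ^+ 2) m0 i0 n0 => m i n m0 i0 n0 h.
apply: uncertainty_rescale => //; first exact: ltW.
by rewrite real_normK ?num_real.
Qed.

End Wavelet.

Theorem theorem4p3 (R : realType) (L : saft_param R)
    (hdet : sA L * sD L - sB L * sC L = 1) (hB : sB L != 0)
    (psi f : R -> R[i]) (Cpsi : R)
    (hpsi : cLp 2%:E psi) (hadm : saw_admissible L psi Cpsi)
    (hf : cLp 2%:E f)
    (hf0 : ~ {ae (@lebesgue_measure R), forall x, f x = 0}) :
  ((\int[(@lebesgue_measure R \x @lebesgue_measure R)%E]_(u in
       [set: measurableTypeR R] `*`
         (`]0%R, +oo[%classic : set (measurableTypeR R)))
       (u.1 ^+ 2 * normc (sawt L psi f u.1 u.2) ^+ 2 / u.2 ^+ 2)%R%:E)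
       `^ (2^-1)%R
   * (\int[@lebesgue_measure R]_w (w ^+ 2 * normc (saft L f w) ^+ 2)%R%:E)
       `^ (2^-1)%R
   >= (Num.sqrt Cpsi * `|sB L| / 2)%R%:E * cLnorm 2%:E f ^+ 2)%E.
Proof.
case: hadm => C0 [G [mG hG hG2]].
exact: (wavelet_uncertainty hB hpsi hf C0 mG hG hG2 hf0).
Qed.
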